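(* Let $(V,Y,\mathbf 1,\omega)$ be an $\mathbb R$-graded vertex operator superalgebra of central charge $c$, let $\sigma$ be its parity automorphism, let $g\in\mathrm{Aut}(V)$ commute with $\sigma$, and let $M$ be a $V$-module stable under $\sigma$ and $g$. Let $v\in V$ be homogeneous of weight $wt(v)\in\mathbb R$ with $gv=\theta^{-1}v$ for some $\theta\in U(1)$, and put $\phi=\exp(2\pi i\,wt(v))\in U(1)$. Then for any $v_1,\dots,v_n\in V$ (with $v$ inserted at $z$ and $v_r$ inserted at $z_r$), $$F_M(g;(v,z),(v_1,z_1),\dots,(v_n,z_n);\tau)=\delta_{\theta,1}\delta_{\phi,1}\,\mathrm{STr}_M\!\left(g\,o(v)\,Y_M(q_1^{L(0)}v_1,q_1)\cdots Y_M(q_n^{L(0)}v_n,q_n)\,q^{L(0)-c/24}\right)$$ $$+\sum_{r=1}^{n}\sum_{m\ge 0}p(v,v_1v_2\cdots v_{r-1})\,P_{m+1}\!\left[\begin{array}{c}\theta\\ \phi\end{array}\right](z-z_r,\tau)\,F_M(g;(v_1,z_1),\dots,(v[m]v_r,z_r),\dots,(v_n,z_n);\tau).$$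
   Context: VOSA conventions. An $\mathbb R$-graded vertex operator superalgebra (VOSA) is $(V,Y,\mathbf 1,\omega)$ where $V=V_{\bar 0}\oplus V_{\bar 1}$ is a complex superspace with parity $p(a)\in\mathbb Z/2\mathbb Z$, and $V=\bigoplus_{r\ge r_0}V_r$ is a (countable) grading by real numbers bounded below, $V_r=V_{\bar 0,r}\oplus V_{\bar 1,r}$, $\mathbf 1\in V_{\bar 0,0}$, $\omega\in V_{\bar 0,2}$. The linear map $Y(a,z)=\sum_{n\in\mathbb Z}a(n)z^{-n-1}$, $a(n)\in\mathrm{End}V$, satisfies: $a(n)\mathbf 1=\delta_{n,-1}a$ for $n\ge -1$; $a(n)V_\alpha\subset V_{\alpha+p(a)}$; locality $(x-y)^N[Y(a,x),Y(b,y)]=0$ for $N\gg0$, with the graded commutator $[A,B]=AB-(-1)^{p(A)p(B)}BA$; $Y(\mathbf 1,z)=\mathrm{Id}$; $Y(\omega,z)=\sum_nL(n)z^{-n-2}$ with $L(n)$ generating a Virasoro algebra of central charge $c$; $Y(L(-1)a,z)=\frac{d}{dz}Y(a,z)$; and $V_r=\{a: L(0)a=ra\}$, where $r=wt(a)$. A $V$-module $M=M_{\bar 0}\oplus M_{\bar 1}$ has vertex operators $Y_M$ with integral modes satisfying the analogous axioms (including associativity/commutator formula); it is graded by real $L(0)$-eigenvalues bounded below with finite-dimensional homogeneous spaces, so that supertraces make sense. $\sigma a=(-1)^{p(a)}a$. ''Stable under $g$'' means that $g$ acts on $M$ with $gY_M(a,z)g^{-1}=Y_M(ga,z)$, and $\sigma$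 acts on $M$ as the parity. Zero mode: $o(v)=v(wt(v)-1)$ if $wt(v)\in\mathbb Z$ and $o(v)=0$ otherwise (acting on $M$). Square bracket modes: $Y[v,z]=\sum_{n\in\mathbb Z}v[n]z^{-n-1}=Y(q_z^{L(0)}v,q_z-1)$, where $q_z=\exp(z)$. Supertrace: $\mathrm{STr}_M(X)=\mathrm{Tr}_M(\sigma X)=\mathrm{Tr}_{M_{\bar 0}}(X)-\mathrm{Tr}_{M_{\bar 1}}(X)$. $n$-point function: with $\tau$ in the upper half plane, $q=\exp(2\pi i\tau)$, $q_i=\exp(z_i)$ and $q_i^{L(0)}=\exp(z_iL(0))$, $$F_M(g;(v_1,z_1),\dots,(v_n,z_n);\tau)=\mathrm{STr}_M\!\left(g\,Y_M(q_1^{L(0)}v_1,q_1)\cdots Y_M(q_n^{L(0)}v_n,q_n)q^{L(0)-c/24}\right).$$ Sign: $p(v,v_1\cdots v_{r-1})=1$ for $r=1$ and $(-1)^{p(v)[p(v_1)+\cdots+p(v_{r-1})]}$ for $r>1$ (for parity-homogeneous vectors, extended by linearity). Twisted Weierstrass functions: for $(\theta,\phi)\in U(1)\times U(1)$, $\phi=\exp(2\pi i\lambda)$ with $0\le\lambda<1$, and $k\ge1$, $$P_k\!\left[\begin{array}{c}\theta\\ \phi\end{array}\right](z,\tau)=\frac{(-1)^k}{(k-1)!}\sum_{n\in\mathbb Z+\lambda}{}^{\!\!\prime}\ \frac{n^{k-1}e^{nz}}{1-\theta^{-1}q^{n}},\qquad q^n=e^{2\pi i n\tau},$$ where the prime means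 that $n=0$ is omitted if $(\theta,\phi)=(1,1)$ (and $0^0=1$). The series converges absolutely and locally uniformly on $|q|<|q_z|<1$, and $P_k$ denotes its meromorphic continuation in $z$ (in the identity, it is expanded in the region $|q_z|>|q_{r}|>|q\,q_z|$ matching the order of the operators in the trace). *)

(* Defs.v *)
From HB Require Import structures.
From mathcomp Require Import all_boot all_order all_algebra complex.
From mathcomp Require Import all_classical all_reals all_analysis.

Set Implicit Arguments.
Unset Strict Implicit.
Unset Printing Implicit Defensive.
Import Order.TTheory GRing.Theory Num.Theory numFieldNormedType.Exports.
Local Open Scope classical_set_scope.
Local Open Scope ring_scope.
Local Open Scope complex_scope.

Section ComplexAnalysis.
Context {R : realType}.
Local Notation C := R[i].

Definition cexp (z : C) : C :=
  (expR (complex.Re z))%:C * (cos (complex.Im z) +i* sin (complex.Im z)).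

Definition twopii : C := 0 +i* (2 * pi).

(* q^x = exp (2 pi i x tau) for a real exponent x *)
Definition qpow (tau : C) (x : R) : C := cexp (twopii * x%:C * tau).

(* Unconditional (equivalently, absolute) summability of a complex family. *)
Definition has_sum (I : choiceType) (f : I -> C) (s : C) : Prop :=
  forall eps : R, 0 < eps ->
    exists A0 : set I, finite_set A0 /\
      forall A : set I, finite_set A -> A0 `<=` A ->
        `|\sum_(i \in A) f i - s| < eps%:C.

Definition holomorphic_near (f : C^o -> C^o) (p : C^o) : Prop :=
  \forall z \near p, derivable f z 1.

(* Meromorphic on the whole plane: locally a quotient of holomorphic functions
   with denominator nonvanishing off p.  The value at a pole is irrelevant. *)
Definition meromorphic (P : C -> C) : Prop :=
  forall p : C^o, exists f h : C^o -> C^o,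
    [/\ holomorphic_near f p, holomorphic_near h p &
        \forall z \near p, z != p -> h z != 0 /\ P z = f z / h z].

(* The term of index n = j + lam in the series defining P_k[theta; phi]. *)
Definition weier_term (theta phi : C) (lam : R) (k : nat) (tau z : C)
    (j : int) : C :=
  let n : R := j%:~R + lam in
  (-1) ^+ k / (k.-1)`!%:R *
  if [&& n == 0, theta == 1 & phi == 1] then 0
  else n%:C ^+ k.-1 * cexp (n%:C * z) / (1 - theta^-1 * qpow tau n).

(* P is P_k[theta; phi](-, tau): the meromorphic continuation of the sum of
   the series from the annulus |q| < |q_z| < 1. *)
Definition is_weierstrass (theta phi : C) (lam : R) (k : nat) (tau : C)
    (P : C -> C) : Prop :=
  meromorphic P /\
  forall z : C, `|qpow tau 1| < `|cexp z| < 1 ->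
    has_sum (weier_term theta phi lam k tau z) (P z).

(* p (n, j) is the coefficient of e^(n z) q^j in the expansion of
   P_k[theta; phi](z, tau) on |q_z| > 1 > |q q_z|, which is the region
   |q_z| > |q_r| > |q q_z| for the difference z - z_r.  Since n and j are
   real, absolute convergence for all tau and z determines p uniquely. *)
Definition is_weierstrass_expansion (theta phi : C) (lam : R) (k : nat)
    (p : R * R -> C) : Prop :=
  forall tau : C, 0 < complex.Im tau ->
    exists P : C -> C, is_weierstrass theta phi lam k tau P /\
      forall z : C, `|qpow tau 1 * cexp z| < 1 < `|cexp z| ->
        has_sum (fun e : R * R => p e * cexp (e.1%:C * z) * qpow tau e.2)
          (P z).

End ComplexAnalysis.

Section LinearAlgebra.
Context {R : realType}.
Local Notation C := R[i].
Variable U : lmodType C.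

Record superspace := Superspace {
  par_proj :> bool -> {linear U -> U};
  par_projK : forall al be u,
    par_proj al (par_proj be u) = if al == be then par_proj al u else 0;
  par_proj_sum : forall u, u = par_proj false u + par_proj true u }.

Definition has_parity (S : superspace) (al : bool) (u : U) : Prop :=
  S al u = u.

Definition parity_aut (S : superspace) (u : U) : U := S false u - S true u.

(* A B - (-1)^(al be) B A, for A and B of parities al and be *)
Definition scomm (al be : bool) (A B : U -> U) (u : U) : U :=
  A (B u) - (-1) ^+ (al * be)%N *: B (A u).

Definition eigsp (T : U -> U) (l : C) : set U := [set u | T u = l *: u].

Definition eigen_decomp (T : U -> U) (u : U) (f : C -> U) : Prop :=
  [/\ finite_set [set l | f l != 0],
      forall l, eigsp T l (f l) &
      u = \sum_(l \in [set: C]) f l].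

Definition eigen_comp (T : U -> U) (l : C) (u : U) : U :=
  xget 0 [set w | exists f, eigen_decomp T u f /\ w = f l].

(* U is the direct sum of the eigenspaces of T for the real eigenvalues
   r >= r0. *)
Definition graded_from (T : U -> U) (r0 : R) : Prop :=
  forall u, exists f, eigen_decomp T u f /\
    forall l, f l != 0 -> exists2 r : R, r0 <= r & l = r%:C.

Definition is_basis (W : set U) (d : nat) (e : 'I_d -> U) : Prop :=
  (forall i, W (e i)) /\
  forall u, W u -> exists! a : 'rV[C]_d, u = \sum_i a 0 i *: e i.

Definition finite_dim (W : set U) : Prop :=
  exists (d : nat) (e : 'I_d -> U), is_basis W e.

(* The trace of X on the finite-dimensional X-stable subspace W. *)
Definition trace_on (W : set U) (X : U -> U) : C :=
  xget 0 [set t | exists (d : nat) (e : 'I_d -> U) (A : 'M[C]_d),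
    [/\ is_basis W e, forall j, X (e j) = \sum_i A i j *: e i & t = \tr A]].

End LinearAlgebra.

Section VertexOperatorSuperalgebra.
Context {R : realType}.
Local Notation C := R[i].

Definition virasoro (U : lmodType C) (c : C) (L : int -> U -> U) : Prop :=
  forall (m n : int) (u : U),
    L m (L n u) - L n (L m u) =
      (m - n)%:~R *: L (m + n) u +
      (if m + n == 0 then ((m ^+ 3 - m)%:~R / 12%:R * c) *: u else 0).

(* (x - y)^N [Y(a,x), Y(b,y)] = 0, in modes *)
Definition local_at (U : lmodType C) (al be : bool) (N : nat)
    (A B : int -> U -> U) : Prop :=
  forall (m n : int) (u : U),
    \sum_(i < N.+1) (((-1) ^+ i *+ 'C(N, i)) : C) *:
      scomm al be (A (m + (N - i)%:Z)) (B (n + i%:Z)) u = 0.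

Definition gbin (m : int) (i : nat) : C :=
  (\prod_(j < i) (m%:~R - j%:R)) / i`!%:R.

Record vosa (c : C) (V : lmodType C) := Vosa {
  vpar : superspace V;
  vmode : V -> int -> V -> V;
  vac : V;
  omega : V;
  vmode_linl : forall n b, linear (fun a => vmode a n b);
  vmode_linr : forall a n, linear (vmode a n);
  vmode_trunc : forall a b, exists N : int, forall n, N <= n ->
    vmode a n b = 0;
  vgraded : exists r0, graded_from (vmode omega 1) r0;
  vcountable : countable [set r : R | exists2 a, a != 0 &
    eigsp (vmode omega 1) r%:C a];
  vac_even : has_parity vpar false vac;
  vac_wt : eigsp (vmode omega 1) 0 vac;
  omega_even : has_parity vpar false omega;
  omega_wt : eigsp (vmode omega 1) 2 omega;
  vcreation : forall a (n : int), -1 <= n ->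
    vmode a n vac = if n == -1 then a else 0;
  vmode_par : forall al be a n b, has_parity vpar al a ->
    has_parity vpar be b -> has_parity vpar (al (+) be) (vmode a n b);
  vlocality : forall al be a b, has_parity vpar al a ->
    has_parity vpar be b -> exists N0 : nat, forall N, (N0 <= N)%N ->
      local_at al be N (vmode a) (vmode b);
  vmode_vac : forall n b, vmode vac n b = if n == -1 then b else 0;
  vvirasoro : virasoro c (fun n => vmode omega (n + 1));
  vderivation : forall a n b,
    vmode (vmode omega 0 a) n b = (- n)%:~R *: vmode a (n - 1) b }.

(* g in Aut(V) is not assumed to preserve the parity. *)
Definition is_automorphism (c : C) (V : lmodType C) (A : vosa c V)
    (g : {linear V -> V}) : Prop :=
  [/\ bijective g, g (vac A) = vac A, g (omega A) = omega A &
      forall a n b, g (vmode A a n b) = vmode A (g a) n (g b)].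

(* The Borcherds identity contains the commutator formula (n = 0) and
   associativity (m = 0); all its sums are finite by truncation. *)
Record vmodule (c : C) (V : lmodType C) (A : vosa c V) (M : lmodType C) :=
  Vmodule {
  mpar : superspace M;
  mmode : V -> int -> M -> M;
  mmode_linl : forall n w, linear (fun a => mmode a n w);
  mmode_linr : forall a n, linear (mmode a n);
  mmode_trunc : forall a w, exists N : int, forall n, N <= n ->
    mmode a n w = 0;
  mgraded : exists r0, graded_from (mmode (omega A) 1) r0;
  mfinite : forall l, finite_dim (eigsp (mmode (omega A) 1) l);
  mmode_par : forall al be a n w, has_parity (vpar A) al a ->
    has_parity mpar be w -> has_parity mpar (al (+) be) (mmode a n w);
  mlocality : forall al be a b, has_parity (vpar A) al a ->
    has_parity (vpar A) be b -> exists N0 : nat, forall N, (N0 <= N)%N ->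
      local_at al be N (mmode a) (mmode b);
  mmode_vac : forall n w, mmode (vac A) n w = if n == -1 then w else 0;
  mvirasoro : virasoro c (fun n => mmode (omega A) (n + 1));
  mderivation : forall a n w,
    mmode (vmode A (omega A) 0 a) n w = (- n)%:~R *: mmode a (n - 1) w;
  mborcherds : forall al be a b (m n k : int) w, has_parity (vpar A) al a ->
    has_parity (vpar A) be b ->
    \sum_(i \in [set: nat])
      gbin m i *: mmode (vmode A a (n + i%:Z) b) (m + k - i%:Z) w =
    \sum_(i \in [set: nat]) ((-1) ^+ i * gbin n i) *:
      (mmode a (m + n - i%:Z) (mmode b (k + i%:Z) w) -
       (-1) ^+ (`|n|%N + al * be)%N *:
         mmode b (n + k - i%:Z) (mmode a (m + i%:Z) w)) }.

(* M is stable under g through gM, and sigma acts on M as the parity. *)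
Definition stable_under (c : C) (V : lmodType C) (A : vosa c V)
    (M : lmodType C) (B : vmodule A M) (g : {linear V -> V})
    (gM : {linear M -> M}) : Prop :=
  [/\ bijective gM,
      forall a n w, gM (mmode B a n w) = mmode B (g a) n (gM w) &
      forall w, gM (parity_aut (mpar B) w) = parity_aut (mpar B) (gM w)].

End VertexOperatorSuperalgebra.

Section SquareBracket.
Context {R : realType}.
Local Notation C := R[i].

(* Formal power series in z, as coefficient sequences. *)
Definition fps := nat -> C.
Definition fps_mul (f g : fps) : fps :=
  fun n => \sum_(i < n.+1) f i * g (n - i)%N.
Definition fps_one : fps := fun n => (n == 0%N)%:R.
Definition fps_pow (f : fps) (k : nat) : fps := iter k (fps_mul f) fps_one.
(* The inverse of f when f 0 = 1, by the geometric series in 1 - f. *)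
Definition fps_inv (f : fps) : fps :=
  fun n => \sum_(j < n.+1) fps_pow (fun i => fps_one i - f i) j n.
Definition fps_powz (f : fps) (k : int) : fps :=
  match k with
  | Posz k => fps_pow f k
  | Negz k => fps_pow (fps_inv f) k.+1
  end.

(* exp (h z) and (exp z - 1) / z *)
Definition fps_exp (h : C) : fps := fun n => h ^+ n / n`!%:R.
Definition fps_expm1 : fps := fun n => (n.+1)`!%:R^-1.

(* The coefficient of z^(-m-1) in exp (h z) (exp z - 1)^(-k-1)
   = z^(-k-1) exp (h z) ((exp z - 1) / z)^(-k-1). *)
Definition sq_coef (h : R) (k m : int) : C :=
  match k - m with
  | Posz j => fps_mul (fps_exp h%:C) (fps_powz fps_expm1 (- k - 1)) j
  | Negz _ => 0
  end.

Variables (c : C) (V : lmodType C) (A : vosa c V).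

Definition wt_comp (r : R) (a : V) : V :=
  eigen_comp (vmode A (omega A) 1) r%:C a.

(* a[m] b *)
Definition sq_mode (a : V) (m : int) (b : V) : V :=
  \sum_(r \in [set: R]) \sum_(k \in [set: int])
    sq_coef r k m *: vmode A (wt_comp r a) k b.

End SquareBracket.

(* The n-point functions are formal series in q_1, ..., q_n with real
   exponents and in q with complex exponents (because of q^(-c/24)): the value
   at e is the coefficient of q_1^(e.1 0 0) ... q_n^(e.1 0 (n-1)) q^(e.2). *)
Section FormalSeries.
Context {R : realType}.
Local Notation C := R[i].

Definition qseries (n : nat) := ('rV[R]_n * C)%type -> C.

Definition qs_mul (n : nat) (f h : qseries n) : qseries n :=
  fun e => \sum_(d \in [set: ('rV[R]_n * C)%type]) f d * h (e - d).

(* A series in q_{z_1}, ..., q_{z_n}, q seen as one in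
   q_z, q_{z_1}, ..., q_{z_n}, q. *)
Definition qs_lift (n : nat) (f : qseries n) : qseries n.+1 :=
  fun e => if e.1 0 ord0 == 0 then f (\row_i e.1 0 (lift ord0 i), e.2) else 0.

(* The substitution of z - z_r in a series with coefficients p (x, j) of
   e^(x z) q^j. *)
Definition qs_diff (n : nat) (r : 'I_n) (p : R * R -> C) : qseries n.+1 :=
  fun e =>
    let x := e.1 0 ord0 in
    if (e.1 == x *: (delta_mx 0 ord0 - delta_mx 0 (lift ord0 r))) &&
       (complex.Im e.2 == 0)
    then p (x, complex.Re e.2) else 0.

Variables (c : C) (V : lmodType C) (A : vosa c V).
Variables (M : lmodType C) (B : vmodule A M).

(* The coefficient of q^s in STr_M(X q^(L(0) - c/24)). *)
Definition STr (X : M -> M) (s : C) : C :=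
  let L0 := mmode B (omega A) 1 in
  let l := s + c / 24%:R in
  trace_on (eigsp L0 l)
    (fun w => eigen_comp L0 l (parity_aut (mpar B) (X w))).

(* The coefficient of q_1^x in Y_M(q_1^{L(0)} u, q_1). *)
Definition vertex_coef (u : V) (x : R) (w : M) : M :=
  \sum_(r \in [set: R]) \sum_(k \in [set k : int | r - k%:~R - 1 = x])
    mmode B (wt_comp A r u) k w.

(* The coefficient of q_1^{x_1} ... q_n^{x_n} in
   Y_M(q_1^{L(0)} v_1, q_1) ... Y_M(q_n^{L(0)} v_n, q_n). *)
Definition vertex_prod (n : nat) (vs : n.-tuple V) (x : 'rV[R]_n) (w : M) : M :=
  foldr (fun i => vertex_coef (tnth vs i) (x 0 i)) w (enum 'I_n).

Definition npoint (gM : M -> M) (n : nat) (vs : n.-tuple V) : qseries n :=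
  fun e => STr (fun w => gM (vertex_prod vs e.1 w)) e.2.

(* o(v) for v of weight r *)
Definition zero_mode (r : R) (v : V) (w : M) : M :=
  if r \is a Num.int then mmode B v (Num.floor r - 1) w else 0.

Definition npoint_zero (gM : M -> M) (r : R) (v : V) (n : nat)
    (vs : n.-tuple V) : qseries n :=
  fun e => STr (fun w => gM (zero_mode r v (vertex_prod vs e.1 w))) e.2.

Definition psign (n : nat) (al : bool) (ep : {ffun 'I_n -> bool}) (r : 'I_n) :
    C := (-1) ^+ (al * \sum_(s < n | (s < r)%N) ep s)%N.

(* p(v, v_1 ... v_{r-1}) F_M(g; v_1, ..., v[m] v_r, ..., v_n), extended
   multilinearly to v, v_1, ..., v_n that need not be parity-homogeneous. *)
Definition npoint_insert (gM : M -> M) (v : V) (n : nat) (vs : n.-tuple V)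
    (r : 'I_n) (m : nat) : qseries n :=
  fun e => \sum_(al : bool) \sum_(ep : {ffun 'I_n -> bool})
    psign al ep r *
    npoint gM
      [tuple (let u := vpar A (ep i) (tnth vs i) in
              if i == r then sq_mode A (vpar A al v) m%:Z u else u) | i < n] e.

End FormalSeries.

(* Main.v *)
Require Import Defs.
From HB Require Import structures.
From mathcomp Require Import all_boot all_order all_algebra complex.
From mathcomp Require Import finmap ring lra zify.
From mathcomp Require Import all_classical all_reals all_analysis.

Set Implicit Arguments.
Unset Strict Implicit.
Unset Printing Implicit Defensive.
Import Order.TTheory GRing.Theory Num.Theory numFieldNormedType.Exports.
Local Open Scope classical_set_scope.
Local Open Scope ring_scope.
Local Open Scope complex_scope.

(* The coefficient of q_z^x in Y_M(q_z^L(0) v, q_z) is the mode v(N) with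
   N = wt v - 1 - x, which shifts the L(0)-weight by x.  Its commutator with
   Y_M(q_1^L(0) u, q_1) is sum_m ((-x)^m / m!) Y_M(q_1^L(0) v[m]u, q_1), up to
   the shift by x of the exponent of q_1: the binomial coefficients of the
   commutator formula are residues of exp((h+1) z) (exp z - 1)^(-k-1).  Moving
   v(N) around the supertrace gives T(s) = S(s) + theta T(s + x) for the
   coefficient T(s) of q^s, where S(s) collects the commutators.  As T vanishes
   in low weight, this is solved by iteration, downwards for x > 0 and upwards
   for x < 0; for x = 0 one divides by 1 - theta, and when theta = 1 the
   equation says S = 0 while T is the term with o(v).

   The powers of theta so obtained are the coefficients of P_k in the region
   |q_z| > 1 > |q q_z|.  For the meromorphic continuation, N steps of the
   geometric expansion of 1 / (1 - theta^-1 q^n), in either direction according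
   to the sign of n, leave a series that converges in a strip growing with N;
   the terms removed sum to translates of sum_(n >= 0) n^(k-1) e^(n z), a
   rational function of e^z up to the factor e^(lambda z). *)

(** * Unordered summation *)

(** The identity is one of formal series, so convergence of traces never enters: for fixed exponents
    only finitely many terms of a product with P_k survive, because traces vanish when the real part
    of the level is low. Analysis serves only to identify the coefficients as those of P_k. The
    delicate point there is the line |q_z| = 1. The sum of n^(k-1) e^(n z) over all n, split into n
    >= 0 and n < 0, continues to G - G = 0; this is what allows 1 / (1 - x) to be replaced by x / (1
    - x), for x = theta^-1 q^n, on passing to |q_z| > 1. When theta = phi = 1 the slot n = 0 is
    omitted from the series but not from that sum, so for k = 1 the crossing leaves a constant term.
    The constant is harmless in the identity, where it multiplies S = 0. On the algebraic side the
    signs exist only for parity-homogeneous vectors, and truncations only for one weight component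
    at a time. Everything is therefore proved for components and summed, with truncation bounds that
    may be enlarged so that finitely many components can share one. *)

Section Summation.
Context {R : realType}.
Local Notation C := R[i].

(** Norms in [C] take values in [C], whose order is partial; the bound [K] is real because the empty
    sum already gives 0 <= [K]. *)
Definition abs_bounded (I : choiceType) (f : I -> C) : Prop :=
  exists K : C, forall X : {fset I}, \sum_(i <- X) `|f i| <= K.

Lemma pos_complexP (e : C) : 0 < e -> exists2 r : R, 0 < r & e = r%:C.
Proof.
move=> e0; have /complex_realP[r er] := gtr0_real e0.
by exists r => //; rewrite er ltcR in e0.
Qed.

Lemma has_sumP (I : choiceType) (f : I -> C) (s : C) :
  has_sum f s <-> forall e : C, 0 < e -> exists X : {fset I},
    forall Y : {fset I}, (X `<=` Y)%fset -> `|\sum_(i <- Y) f i - s| < e.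
Proof.
split=> [fs e /pos_complexP[r r0 ->]|fs r r0].
  have [A [finA hA]] := fs r r0.
  exists (fset_set A) => Y AY.
  have := hA [set` Y] (finite_fset Y).
  rewrite fsbig_finite//= set_fsetK; apply => x Ax /=.
  by apply: (fsubsetP AY); rewrite in_fset_set// inE.
have [|X hX] := fs r%:C; first by rewrite ltcR.
exists [set` X]; split=> // A finA XA.
rewrite fsbig_finite//=; apply: hX; apply/fsubsetP => x xX.
by rewrite in_fset_set// inE; apply: XA.
Qed.

Lemma big_fsubset_split (I : choiceType) (f : I -> C) (X Y : {fset I}) :
  (X `<=` Y)%fset ->
  \sum_(i <- Y) f i = \sum_(i <- X) f i + \sum_(i <- (Y `\` X)%fset) f i.
Proof.
move=> XY; rewrite (big_fsetID _ (mem X))/=; congr (_ + _).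
  congr (\sum_(i <- enum_fset _) _); apply/fsetP => i; rewrite !inE/=.
  by have [/(fsubsetP XY)->|] := boolP (i \in X); rewrite ?andbF.
congr (\sum_(i <- enum_fset _) _); apply/fsetP => i; rewrite !inE/=.
by rewrite andbC.
Qed.

Lemma eq_has_sum (I : choiceType) (f g : I -> C) (s : C) :
  f =1 g -> has_sum f s -> has_sum g s.
Proof. by move=> /funext ->. Qed.

Lemma has_sumD (I : choiceType) (f g : I -> C) (s t : C) :
  has_sum f s -> has_sum g t -> has_sum (fun i => f i + g i) (s + t).
Proof.
move=> /has_sumP fs /has_sumP gt; apply/has_sumP => e e0.
have e20 : 0 < e / 2 by rewrite divr_gt0.
have [X hX] := fs _ e20; have [Y hY] := gt _ e20.
exists (X `|` Y)%fset => Z; rewrite fsubUset => /andP[XZ YZ].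
rewrite big_split/= opprD addrACA (splitr e).
by rewrite (le_lt_trans (ler_normD _ _))// ltrD ?hX ?hY.
Qed.

Lemma has_sumZ (I : choiceType) (a : C) (f : I -> C) (s : C) :
  has_sum f s -> has_sum (fun i => a * f i) (a * s).
Proof.
move=> /has_sumP fs; apply/has_sumP => e e0.
have [->|a0] := eqVneq a 0.
  exists fset0 => Y _; rewrite mul0r subr0 big1 ?normr0// => i _.
  by rewrite mul0r.
have [|X hX] := fs (e / `|a|); first by rewrite divr_gt0 ?normr_gt0.
exists X => Y /hX; rewrite -mulr_sumr -mulrBr normrM.
by rewrite ltr_pdivlMr ?normr_gt0// mulrC.
Qed.

Lemma has_sumN (I : choiceType) (f : I -> C) (s : C) :
  has_sum f s -> has_sum (fun i => - f i) (- s).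
Proof.
move=> /(has_sumZ (-1)); rewrite mulN1r; apply: eq_has_sum => i.
by rewrite mulN1r.
Qed.

Lemma has_sumB (I : choiceType) (f g : I -> C) (s t : C) :
  has_sum f s -> has_sum g t -> has_sum (fun i => f i - g i) (s - t).
Proof. by move=> fs /has_sumN; apply: has_sumD. Qed.

Lemma has_sum_unique (I : choiceType) (f : I -> C) (s t : C) :
  has_sum f s -> has_sum f t -> s = t.
Proof.
move=> /has_sumP fs /has_sumP ft; apply/eqP; rewrite -subr_eq0 -normr_eq0.
apply: contraT => st0.
have st : 0 < `|s - t| by rewrite lt_def st0 normr_ge0.
have st2 : 0 < `|s - t| / 2 by rewrite divr_gt0.
have [X hX] := fs _ st2; have [Y hY] := ft _ st2.
have := ltrD (hX _ (fsubsetUl X Y)) (hY _ (fsubsetUr X Y)).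
rewrite -splitr distrC => /(le_lt_trans (ler_normD _ _)).
by rewrite addrA subrK ltxx.
Qed.

Lemma has_sum_finite (I : choiceType) (f : I -> C) (X : {fset I}) :
  (forall i, i \notin X -> f i = 0) -> has_sum f (\sum_(i <- X) f i).
Proof.
move=> f0; apply/has_sumP => e e0; exists X => Y XY.
rewrite (big_fsetID _ (mem X))/=.
rewrite [X in _ + X - _]big1_fset => [|i]; last first.
  by rewrite !inE/= => /andP[_ /f0 ->].
rewrite addr0 (_ : [fset x in Y | x \in X]%fset = X) ?subrr ?normr0//.
apply/fsetP => i; rewrite !inE/=; have [iX|] := boolP (i \in X).
  by rewrite (fsubsetP XY).
by rewrite andbF.
Qed.

Lemma has_sum0 (I : choiceType) : has_sum (fun _ : I => 0 : C) 0.
Proof.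
have := @has_sum_finite I (fun=> 0 : C) fset0 (fun _ _ => erefl).
by rewrite big1.
Qed.

Lemma has_sum_single (I : choiceType) (i : I) (a : C) :
  has_sum (fun j => if j == i then a else 0) a.
Proof.
have := @has_sum_finite I (fun j => if j == i then a else 0) [fset i]%fset.
rewrite big_seq_fset1 eqxx; apply => j; rewrite inE.
by move=> /negbTE ->.
Qed.

Lemma has_sum_le (I : choiceType) (f : I -> C) (s K : C) :
  (forall X : {fset I}, \sum_(i <- X) `|f i| <= K) -> has_sum f s ->
  `|s| <= K.
Proof.
move=> fK /has_sumP fs.
have KR : K \is Num.real.
  by rewrite ger0_real//; have := fK fset0; rewrite big_seq_fset0.
(* Negating an inequality in the partial order of [C] requires both sides to be real, hence [KR]. *)
rewrite real_leNgt ?normr_real//; apply/negP => Ks.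
have [|X /(_ X (fsubset_refl X))] := fs (`|s| - K); first by rewrite subr_gt0.
apply/negP; rewrite -real_leNgt ?rpredB ?normr_real//.
rewrite lerBlDr -{1}[s](subKr (\sum_(i <- X) f i)).
apply: le_trans (ler_normB _ _) _; rewrite addrC.
by rewrite lerD// (le_trans (ler_norm_sum _ _ _)).
Qed.

(* [f] and [g] agree along [h] except for zero terms. *)
Lemma has_sum_transfer (I J : choiceType) (h : I -> J) (f : I -> C)
    (g : J -> C) (s : C) :
  (forall i i', f i != 0 -> f i' != 0 -> h i = h i' -> i = i') ->
  (forall i, f i != 0 -> g (h i) = f i) ->
  (forall j, g j != 0 -> exists2 i, f i != 0 & h i = j) ->
  has_sum f s -> has_sum g s.
Proof.
move=> hinj gh hsurj /has_sumP fs; apply/has_sumP => e e0.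
have [X hX] := fs e e0.
exists (h @` X)%fset => Y XY.
(* [k] is a partial inverse of [h] on the supports, and [Z] is the pullback of [Y] along it. As [Y]
   contains the image of [X], joining [X] to [Z] adds only zero terms. *)
pose k j : option I := match pselect (exists2 i, f i != 0 & h i = j) with
  | left p => Some (sval (cid2 p)) | right _ => None end.
have kP j i : f i != 0 -> h i = j -> k j = Some i.
  move=> fi hi; rewrite /k; case: pselect => [p|[]]; last by exists i.
  case: (cid2 p) => i' fi' hi' /=; congr Some.
  by apply: hinj => //; rewrite hi hi'.
have kN j : g j = 0 -> k j = None.
  move=> gj; rewrite /k; case: pselect => // p; exfalso; case: p => i fi hi.
  by move: (fi); rewrite -(gh _ fi) hi gj eqxx.
pose Z : {fset I} := [fset i in pmap k (enum_fset Y)]%fset.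
have ZP i : (i \in Z) = (f i != 0) && (h i \in Y).
  rewrite !inE/= mem_pmap; apply/mapP/andP => [[j jY kj]|[fi hiY]]; last first.
    by exists (h i) => //; rewrite (kP _ i).
  have [gj|/hsurj[i' fi' hi']] := eqVneq (g j) 0; first by rewrite kN in kj.
  by move: kj; rewrite (kP _ i')// => -[->]; rewrite hi'.
have -> : \sum_(j <- Y) g j = \sum_(i <- (X `|` Z)%fset) f i.
  rewrite (bigID (fun i => f i != 0))/= [X in _ + X]big1 ?addr0; last first.
    by move=> i /negPn/eqP.
  rewrite [LHS](bigID (fun j => g j != 0))/= [X in _ + X]big1 ?addr0; last first.
    by move=> j /negPn/eqP.
  rewrite -big_filter -[RHS]big_filter.
  have -> : \sum_(i <- [seq i <- (X `|` Z)%fset | f i != 0]) f i =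
      \sum_(j <- map h [seq i <- (X `|` Z)%fset | f i != 0]) g j.
    rewrite big_map !big_filter; apply: eq_bigr => i fi.
    by rewrite gh.
  apply: perm_big; apply: uniq_perm; first exact/filter_uniq/fset_uniq.
    rewrite map_inj_in_uniq; first exact/filter_uniq/fset_uniq.
    by move=> i i'; rewrite !mem_filter => /andP[fi _] /andP[fi' _]; exact: hinj.
  move=> j; rewrite mem_filter; apply/andP/mapP => [[gj jY]|[k0]].
    have [i fi hi] := hsurj _ gj; exists i => //.
    by rewrite mem_filter fi inE ZP fi hi jY orbT.
  rewrite mem_filter => /andP[fi]; rewrite inE ZP fi/= => iXZ ->.
  rewrite gh//; split=> //; case/orP: iXZ => // iX.
  by apply: (fsubsetP XY); apply: in_imfset.
by apply: hX; exact: fsubsetUl.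
Qed.

Lemma abs_bounded_le (I : choiceType) (f g : I -> C) :
  (forall i, `|f i| <= `|g i|) -> abs_bounded g -> abs_bounded f.
Proof.
move=> fg [K gK]; exists K => X; apply: le_trans (gK X).
by apply: ler_sum => i _; exact: fg.
Qed.

Lemma abs_boundedD (I : choiceType) (f g : I -> C) :
  abs_bounded f -> abs_bounded g -> abs_bounded (fun i => f i + g i).
Proof.
move=> [K fK] [L gL]; exists (K + L) => X.
apply: le_trans (lerD (fK X) (gL X)); rewrite -big_split/=.
by apply: ler_sum => i _; exact: ler_normD.
Qed.

Lemma abs_boundedZ (I : choiceType) (a : C) (f : I -> C) :
  abs_bounded f -> abs_bounded (fun i => a * f i).
Proof.
move=> [K fK]; exists (`|a| * K) => X.
under eq_bigr do rewrite normrM.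
by rewrite -mulr_sumr ler_wpM2l.
Qed.

Lemma abs_bounded_transfer (I J : choiceType) (h : I -> J) (f : I -> C)
    (g : J -> C) :
  (forall i i', f i != 0 -> f i' != 0 -> h i = h i' -> i = i') ->
  (forall i, f i != 0 -> g (h i) = f i) ->
  abs_bounded g -> abs_bounded f.
Proof.
move=> hinj gh [K gK]; exists K => X.
rewrite (bigID (fun i => f i != 0))/= [X in _ + X]big1 ?addr0; last first.
  by move=> i /negPn/eqP ->; rewrite normr0.
pose Y : {fset J} := [fset h i | i in [fset i in X | f i != 0]]%fset.
apply: le_trans (gK Y); rewrite -big_filter.
have -> : \sum_(i <- [seq i <- X | f i != 0]) `|f i| =
    \sum_(j <- map h [seq i <- X | f i != 0]) `|g j|.
  by rewrite big_map !big_filter; apply: eq_bigr => i fi; rewrite gh.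
rewrite le_eqVlt; apply/orP; left; apply/eqP.
apply: perm_big; apply: uniq_perm; rewrite ?fset_uniq//.
  rewrite map_inj_in_uniq; first exact/filter_uniq/fset_uniq.
  by move=> i i'; rewrite !mem_filter => /andP[fi _] /andP[fi' _]; exact: hinj.
move=> j; apply/mapP/imfsetP => [[k]|[k]]; rewrite /= ?mem_filter.
  by move=> /andP[a b] ->; exists k => //=; rewrite !inE/= a b.
by rewrite !inE/= => /andP[a b] ->; exists k => //; rewrite mem_filter a b.
Qed.

(** The sum is the supremum of the finite partial sums. This is the only use of completeness; the
    general case follows by positive and negative, then real and imaginary parts. *)
Lemma has_sum_nonneg (I : choiceType) (f : I -> R) (K : R) :
  (forall i, 0 <= f i) -> (forall X : {fset I}, \sum_(i <- X) f i <= K) ->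
  exists s : R, has_sum (fun i => (f i)%:C) s%:C.
Proof.
move=> f0 fK.
pose S : set R := [set \sum_(i <- X) f i | X in [set: {fset I}]].
have supS : has_sup S.
  split; first by exists (\sum_(i <- fset0) f i), fset0.
  by exists K => _ [X _ <-].
exists (sup S); apply/has_sumP => e /pos_complexP[r r0 ->].
have [_ [X _ <-] Xr] := sup_adherent r0 supS.
exists X => Y XY; rewrite -rmorph_sum -rmorphB /= normc_def/= expr0n/= addr0.
rewrite sqrtr_sqr ltcR ltr_norml.
have YS : \sum_(i <- Y) f i <= sup S by apply: sup_upper_bound => //; exists Y.
have XYS : \sum_(i <- X) f i <= \sum_(i <- Y) f i.
  rewrite [leRHS](big_fsetID _ (mem X))/=.
  rewrite (_ : [fset x in Y | x \in X]%fset = X) ?lerDl ?sumr_ge0//.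
  apply/fsetP => i; rewrite !inE/=; have [iX|] := boolP (i \in X).
    by rewrite (fsubsetP XY).
  by rewrite andbF.
by apply/andP; split; lra.
Qed.

Lemma normc_ge_Im (x : C) : `|complex.Im x|%:C <= `|x|.
Proof.
have := normc_ge_Re (x * 'i%C); rewrite ReiNIm normrN normrM.
by rewrite [X in _ * X]normc_def/= expr0n expr1n/= add0r sqrtr1 mulr1.
Qed.

Lemma has_sum_real (I : choiceType) (f : I -> R) :
  abs_bounded (fun i => (f i)%:C) -> exists s : C, has_sum (fun i => (f i)%:C) s.
Proof.
move=> [K fK].
have K0 : 0 <= K by have := fK fset0; rewrite big_seq_fset0.
have /complex_realP[k kK] := ger0_real K0.
have fk (X : {fset I}) : \sum_(i <- X) `|f i| <= k.
  rewrite -lecR -kK rmorph_sum/=; apply: le_trans (fK X).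
  by apply: ler_sum => i _; rewrite normc_def/= expr0n addr0 sqrtr_sqr.
have [||s1 h1] := @has_sum_nonneg I (fun i => Num.max (f i) 0) k.
- by move=> i; rewrite le_max lexx orbT.
- move=> X; apply: le_trans (fk X); apply: ler_sum => i _.
  by rewrite ge_max ler_norm normr_ge0.
have [||s2 h2] := @has_sum_nonneg I (fun i => Num.max (- f i) 0) k.
- by move=> i; rewrite le_max lexx orbT.
- move=> X; apply: le_trans (fk X); apply: ler_sum => i _.
  by rewrite ge_max -normrN ler_norm normr_ge0.
exists (s1%:C - s2%:C); apply: eq_has_sum (has_sumB h1 h2) => i.
rewrite -rmorphB /=; congr (_ %:C).
by case: (lerP (f i) 0); case: (lerP (- f i) 0); lra.
Qed.

Lemma abs_bounded_has_sum (I : choiceType) (f : I -> C) :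
  abs_bounded f -> exists s : C, has_sum f s.
Proof.
move=> fb.
have [|s1 h1] := @has_sum_real I (fun i => complex.Re (f i)).
  apply: abs_bounded_le fb => i; apply: le_trans (normc_ge_Re _).
  by rewrite normc_def/= expr0n addr0 sqrtr_sqr.
have [|s2 h2] := @has_sum_real I (fun i => complex.Im (f i)).
  apply: abs_bounded_le fb => i; apply: le_trans (normc_ge_Im _).
  by rewrite normc_def/= expr0n addr0 sqrtr_sqr.
exists (s1 + 'i%C * s2).
by apply: eq_has_sum (has_sumD h1 (has_sumZ 'i%C h2)) => i; rewrite -complexE.
Qed.

(** Once the norms over [X] come within [e / 2] of their total, so do those over any larger set, and
    the two sums differ by less than [e]. *)
Lemma abs_bounded_tail (I : choiceType) (f : I -> C) : abs_bounded f ->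
  forall e : C, 0 < e -> exists X : {fset I}, forall Y : {fset I},
    [disjoint X & Y]%fset -> \sum_(i <- Y) `|f i| < e.
Proof.
move=> fb e e0.
have [|s /has_sumP hs] := @abs_bounded_has_sum I (fun i => `|f i|).
  by apply: abs_bounded_le fb => i; rewrite normr_id.
have [|X hX] := hs (e / 2); first by rewrite divr_gt0.
exists X => Y XY.
have := ltrD (hX (X `|` Y)%fset (fsubsetUl X Y)) (hX X (fsubset_refl X)).
rewrite -splitr [X in _ + X]distrC => /(le_lt_trans (ler_normD _ _)).
rewrite addrA subrK (big_fsubset_split _ (fsubsetUl X Y)) addrC addKr.
rewrite fsetDUl fsetDv fset0U (_ : (Y `\` X)%fset = Y).
  by rewrite ger0_norm ?sumr_ge0.
by apply/fsetDidPl; rewrite fdisjoint_sym.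
Qed.

(** The error has three parts of size [e / 3]: the terms of [Z] outside [Y], small by absolute
    summability; the inner sums cut at [Cf i]; and the outer sum cut at [D]. *)
Lemma has_sum_pair (I J : choiceType) (f : I * J -> C) (g : I -> C) (s : C) :
  abs_bounded f -> (forall i, has_sum (fun j => f (i, j)) (g i)) ->
  has_sum g s -> has_sum f s.
Proof.
move=> fb fg /has_sumP gs; apply/has_sumP => e e0.
have e30 : 0 < e / 3 by rewrite divr_gt0.
have [X hX] := abs_bounded_tail fb e30.
have [B hB] := gs _ e30.
exists X => Y XY.
pose D : {fset I} := (B `|` [fset p.1 | p in Y])%fset.
(* The inner error is shared among the elements of [D]; the successor avoids a division by zero when
   [D] is empty. *)
have d0 : 0 < e / 3 / (#|` D|.+1)%:R by rewrite divr_gt0.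
have /choice[Cf hC] : forall i, exists Z : {fset J},
    ([fset p.2 | p in Y] `<=` Z)%fset /\
    `|\sum_(j <- Z) f (i, j) - g i| < e / 3 / (#|` D|.+1)%:R.
  move=> i; have /has_sumP/(_ _ d0)[Z hZ] := fg i.
  exists (Z `|` [fset p.2 | p in Y])%fset; split; first exact: fsubsetUr.
  by apply: hZ; exact: fsubsetUl.
pose E := \sum_(i <- D) \sum_(j <- Cf i) f (i, j).
have h1 : `|E - \sum_(i <- D) g i| <= e / 3.
  rewrite -sumrB (le_trans (ler_norm_sum _ _ _))//.
  apply: le_trans (_ : \sum_(i <- D) (e / 3 / (#|` D|.+1)%:R) <= _).
    by apply: ler_sum => i _; apply/ltW; have [] := hC i.
  rewrite big_const_seq count_predT iter_addr_0 -[_ *+ _]mulr_natr.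
  have dn0 : (#|` D|.+1)%:R != 0 :> C by rewrite pnatr_eq0.
  rewrite -[leRHS](divfK dn0) ler_wpM2l ?ler_nat ?leqnSn// ltW//.
have h2 : `|\sum_(i <- D) g i - s| < e / 3 by apply: hB; exact: fsubsetUl.
pose Z : {fset I * J} := [fset p in [seq (i, j) | i <- D, j <- Cf i]]%fset.
have ZE : E = \sum_(p <- Z) f p.
  rewrite /E -(@big_allpairs_dep _ _ _ _ _ _ (fun (x : I) (y : J) => (x, y)) _
    (fun i => enum_fset (Cf i)) f).
  apply: perm_big; apply: uniq_perm; rewrite ?fset_uniq//.
    apply: allpairs_uniq_dep; rewrite ?fset_uniq//.
    by move=> [? ?] [? ?] _ _ /= [-> ->].
  by move=> p; rewrite !inE.
have YZ : (Y `<=` Z)%fset.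
  apply/fsubsetP => -[i j] ijY; rewrite !inE/=; apply/allpairsPdep.
  exists i, j; split=> //.
    by rewrite !inE; apply/orP; right; apply/imfsetP; exists (i, j).
  have [/fsubsetP YC _] := hC i; apply: YC.
  by apply/imfsetP; exists (i, j).
have h3 : `|\sum_(p <- Y) f p - E| < e / 3.
  rewrite ZE (big_fsetID _ (mem Y) Z)/=.
  have -> : [fset x in Z | x \in Y]%fset = Y.
    apply/fsetP => p; rewrite !inE/=; have [pY|] := boolP (p \in Y).
      by have := fsubsetP YZ _ pY; rewrite !inE => ->.
    by rewrite andbF.
  rewrite opprD addrA subrr sub0r normrN (le_lt_trans (ler_norm_sum _ _ _))//.
  apply: hX; apply/fdisjointP => p /(fsubsetP XY) pY.
  by rewrite !inE/= pY andbF.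
have -> : \sum_(i <- Y) f i - s =
  (\sum_(i <- Y) f i - E) + (E - \sum_(i <- D) g i) + (\sum_(i <- D) g i - s).
  by rewrite !addrA !subrK.
rewrite (_ : e = e / 3 + e / 3 + e / 3); last first.
  by rewrite -mulrDl -mulrDl -!mulr2n -!mulrSr -[X in X *+ _]mulr1 -mulrnAr mulfK// pnatr_eq0.
apply: le_lt_trans (ler_normD _ _) _; apply: ltrD => //.
by apply: le_lt_trans (ler_normD _ _) _; apply: ltr_leD.
Qed.

Lemma abs_bounded_pair (I J : choiceType) (f : I * J -> C) (g : I -> C) :
  (forall i (Y : {fset J}), \sum_(j <- Y) `|f (i, j)| <= g i) ->
  abs_bounded g -> abs_bounded f.
Proof.
move=> fg [K gK]; exists K => X.
pose D : {fset I} := [fset p.1 | p in X]%fset.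
pose F : {fset J} := [fset p.2 | p in X]%fset.
apply: le_trans (gK D).
apply: le_trans (_ : \sum_(i <- D) \sum_(j <- F) `|f (i, j)| <= _); last first.
  apply: ler_sum => i _; apply: le_trans (fg i F) _.
  by apply: real_ler_norm; apply: ger0_real; apply: le_trans (fg i fset0); rewrite big_seq_fset0.
pose Z : {fset I * J} := [fset p in [seq (i, j) | i <- D, j <- F]]%fset.
have -> : \sum_(i <- D) \sum_(j <- F) `|f (i, j)| = \sum_(p <- Z) `|f p|.
  rewrite -(@big_allpairs_dep _ _ _ _ _ _ (fun (x : I) (y : J) => (x, y)) _
    (fun=> enum_fset F) (fun p => `|f p|)).
  apply: perm_big; apply: uniq_perm; rewrite ?fset_uniq//.
    apply: allpairs_uniq_dep; rewrite ?fset_uniq//.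
    by move=> [? ?] [? ?] _ _ /= [-> ->].
  by move=> p; rewrite !inE.
rewrite [leRHS](big_fsetID _ (mem X))/=.
have -> : [fset x in Z | x \in X]%fset = X.
  apply/fsetP => -[i j]; rewrite !inE/=; have [pX|] := boolP (_ \in X).
    rewrite andbT; apply/allpairsPdep; exists i, j.
    by split=> //; apply/imfsetP; exists (i, j).
  by rewrite andbF.
by rewrite lerDl sumr_ge0.
Qed.

End Summation.

(** * The complex exponential and meromorphic functions *)

Section Exponential.
Context {R : realType}.
Local Notation C := R[i].
Implicit Types (z w : C) (x y : R).

Lemma norm_le_ReIm z : `|z| <= (`|complex.Re z| + `|complex.Im z|)%:C.
Proof.
rewrite {1}[z]complexE (le_trans (ler_normD _ _))// rmorphD/= normrM.
rewrite lerD//; first by rewrite normc_def/= expr0n addr0 sqrtr_sqr.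
rewrite [X in X * _]normc_def/= expr0n expr1n/= add0r sqrtr1 mul1r.
by rewrite normc_def/= expr0n addr0 sqrtr_sqr.
Qed.

Lemma normcR x : `|x%:C| = `|x|%:C.
Proof. by rewrite normc_def/= expr0n addr0 sqrtr_sqr. Qed.

Lemma Re_realM x z : complex.Re (x%:C * z) = x * complex.Re z.
Proof. by case: z => a b /=; rewrite mul0r subr0. Qed.

Lemma ltcR1 x : (x%:C < 1 :> C) = (x < 1).
Proof. by rewrite -(rmorph1 (real_complex R)) ltcR. Qed.

Lemma ltc1R x : (1 < x%:C :> C) = (1 < x).
Proof. by rewrite -(rmorph1 (real_complex R)) ltcR. Qed.

Lemma norm_realP z : exists2 r : R, 0 <= r & `|z| = r%:C.
Proof.
rewrite normc_def; eexists; last reflexivity.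
exact: sqrtr_ge0.
Qed.

Lemma cexp0 : cexp 0 = 1 :> C.
Proof. by rewrite /cexp/= expR0 cos0 sin0 mul1r. Qed.

Lemma cexpD z w : cexp (z + w) = cexp z * cexp w.
Proof.
case: z w => [a b] [a' b']; rewrite /cexp/= expRD cosD sinD.
by apply/eqP; rewrite eq_complex/=; apply/andP; split; apply/eqP; ring.
Qed.

Lemma norm_cexp z : `|cexp z| = (expR (complex.Re z))%:C.
Proof.
rewrite /cexp normrM normcR (ger0_norm (expR_ge0 _)).
by rewrite [X in _ * X]normc_def/= cos2Dsin2 sqrtr1 mulr1.
Qed.

Lemma cexp_neq0 z : cexp z != 0.
Proof. by rewrite -normr_eq0 norm_cexp -(rmorph0 (real_complex R)) (inj_eq (@complexI _)) gt_eqF// expR_gt0. Qed.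

Lemma cexpN z : cexp (- z) = (cexp z)^-1.
Proof.
apply: (mulIf (cexp_neq0 z)); rewrite mulVf ?cexp_neq0//.
by rewrite -cexpD addNr cexp0.
Qed.

Lemma cexpX (N : nat) z : cexp (N%:R * z) = cexp z ^+ N.
Proof.
elim: N => [|N IHN]; first by rewrite mul0r cexp0 expr0.
by rewrite exprSr -IHN -cexpD -natr1 mulrDl mul1r.
Qed.

Lemma mvt_bound (f df : R -> R) (K y : R) : (forall x, is_derive x 1 f (df x)) ->
  (forall x, `|x| <= `|y| -> `|df x| <= K) -> `|f y - f 0| <= K * `|y|.
Proof.
move=> fd dfK.
have cf : continuous f.
  by move=> x; apply/differentiable_continuous/derivable1_diffP; have [] := fd x.
have [y0|/ltW y0] := leP 0 y.
  have [|c] := @MVT_segment R f df 0 y y0 (fun x _ => fd x).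
    exact: continuous_subspaceT.
  rewrite in_itv/= subr0 => /andP[c0 cy] ->.
  by rewrite normrM ler_wpM2r// dfK// !ger0_norm.
have [|c] := @MVT_segment R f df y 0 y0 (fun x _ => fd x).
  exact: continuous_subspaceT.
rewrite in_itv/= sub0r distrC => /andP[c0 cy] ->.
by rewrite normrM normrN ler_wpM2r// dfK// !ler0_norm// lerN2.
Qed.

Lemma sin_le_norm y : `|sin y| <= `|y|.
Proof.
have := @mvt_bound sin cos 1 y (fun x => is_derive_sin x) (fun x _ => cos_max x).
by rewrite sin0 subr0 mul1r.
Qed.

Lemma cos_sub1_le y : `|cos y - 1| <= `|y| ^+ 2.
Proof.
have := @mvt_bound cos (fun x => - sin x) `|y| y (fun x => is_derive_cos x).
rewrite cos0 expr2; apply => x xy; rewrite normrN.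
exact: le_trans (sin_le_norm x) xy.
Qed.

Lemma cos_sub1_le1 y : `|cos y - 1| <= `|y|.
Proof.
have := @mvt_bound cos (fun x => - sin x) 1 y (fun x => is_derive_cos x).
by rewrite cos0 mul1r; apply => x xy; rewrite normrN sin_max.
Qed.

Lemma sin_sub_le y : `|sin y - y| <= `|y| ^+ 2.
Proof.
have := @mvt_bound (fun x => sin x - x) (fun x => cos x - 1) `|y| y.
rewrite sin0 !subr0 expr2; apply.
by move=> x xy; exact: le_trans (cos_sub1_le1 x) xy.
Qed.

Lemma expR_sub1_le x : `|expR x - 1| <= `|x| * expR `|x|.
Proof.
have h1 := expR_ge1Dx x; have h2 := expR_ge1Dx (- x).
have h3 := expRxMexpNx_1 x; have h4 := expR_gt0 x.
have h5 := expR_gt0 (- x).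
have [x0|x0] := leP 0 x.
  rewrite (ger0_norm x0) ger0_norm; last by lra.
  nra.
rewrite (ltr0_norm x0) ltr0_norm; last by nra.
nra.
Qed.

Lemma expR_sub1x_le x : `|expR x - 1 - x| <= `|x| ^+ 2 * expR `|x|.
Proof.
have h1 := expR_ge1Dx x; have h2 := expR_sub1_le x.
rewrite ger0_norm; last by lra.
have h : expR x - 1 - x <= `|x| * `|expR x - 1|.
  rewrite -normrM; apply: le_trans (ler_norm _).
  have h3 := expRxMexpNx_1 x; have h4 := expR_gt0 x.
  have h5 := expR_ge1Dx (- x).
  nra.
apply: le_trans h _; rewrite expr2 -mulrA ler_wpM2l//.
Qed.

(** The real and imaginary parts of the error split into four terms, each at most [r ^+ 2 * expR r];
    hence the 4. *)
Lemma cexp_taylor w (r : R) : `|w| = r%:C ->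
  `|cexp w - 1 - w| <= (4 * r ^+ 2 * expR r)%:C.
Proof.
move=> wr; have r0 : 0 <= r by rewrite -ler0c -wr.
have xr : `|complex.Re w| <= r by rewrite -lecR -wr normc_ge_Re.
have yr : `|complex.Im w| <= r by rewrite -lecR -wr normc_ge_Im.
case: w wr xr yr => x y /= wr xr yr.
have er : 1 <= expR r by rewrite -expR0 ler_expR.
have exr : expR x <= expR r by rewrite ler_expR; exact: le_trans (ler_norm x) xr.
have eaxr : expR `|x| <= expR r by rewrite ler_expR.
apply: le_trans (norm_le_ReIm _) _; rewrite lecR /cexp/=.
have -> : expR x * cos y - 0 * sin y - 1 - x =
  (expR x - 1 - x) + expR x * (cos y - 1) by ring.
have -> : expR x * sin y + 0 * cos y - 0 - y =
  (expR x - 1) * sin y + (sin y - y) by ring.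
have sqx : `|x| ^+ 2 <= r ^+ 2 by rewrite ler_pXn2r// nnegrE.
have sqy : `|y| ^+ 2 <= r ^+ 2 by rewrite ler_pXn2r// nnegrE.
have a1 : `|expR x - 1 - x| <= r ^+ 2 * expR r.
  by apply: le_trans (expR_sub1x_le x) _; apply: ler_pM => //; rewrite ?exprn_ge0// expR_ge0.
have a2 : `|expR x * (cos y - 1)| <= r ^+ 2 * expR r.
  rewrite normrM mulrC (ger0_norm (expR_ge0 _)); apply: ler_pM => //; rewrite ?expR_ge0//.
  exact: le_trans (cos_sub1_le y) sqy.
have a3 : `|(expR x - 1) * sin y| <= r ^+ 2 * expR r.
  rewrite normrM expr2 mulrAC; apply: ler_pM => //.
    by apply: le_trans (expR_sub1_le x) _; apply: ler_pM => //; exact: expR_ge0.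
  exact: le_trans (sin_le_norm y) yr.
have a4 : `|sin y - y| <= r ^+ 2 * expR r.
  apply: le_trans (sin_sub_le y) _; apply: le_trans sqy _.
  by rewrite ler_peMr// exprn_ge0.
have := ler_normD (expR x - 1 - x) (expR x * (cos y - 1)).
have := ler_normD ((expR x - 1) * sin y) (sin y - y).
by move=> b1 b2; rewrite -mulrA; lra.
Qed.

(** A quadratic error bound with explicit constants can be summed over a series term by term, which
    the definition of the derivative as a limit does not allow directly. *)
Lemma derivable_quadratic (f : C^o -> C^o) (z d : C) (K rho : R) : 0 < rho ->
  (forall (h : C) (r : R), `|h| = r%:C -> r <= rho ->
    `|f (z + h) - f z - h * d| <= (K * r ^+ 2)%:C) -> derivable f z 1.
Proof.
move=> rho0 fK; apply/cvg_ex; exists d; apply/cvgrPdist_lt => e /pos_complexP[e' e'0 ->].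
have d0 : 0 < (e' / (`|K| + 1)) by rewrite divr_gt0// ltr_pwDr.
near=> h.
have [r r0 hr] := norm_realP h.
have h0 : h != 0 by near: h; exact: nbhs_dnbhs_neq.
have rrho : r <= rho.
  by rewrite -lecR -hr; near: h; apply: dnbhs0_le; rewrite ltcR.
have re : r < e' / (`|K| + 1).
  by rewrite -ltcR -hr; near: h; apply: dnbhs0_lt; rewrite ltcR.
have rpos : 0 < r by rewrite -ltcR -hr normr_gt0.
have := fK h r hr rrho.
rewrite /= [h *: 1]mulr1 [h + z]addrC => fh.
have -> : d - h^-1 *: (f (z + h) - f z) = - h^-1 * (f (z + h) - f z - h * d).
  by rewrite mulNr mulrBr mulKf// opprB.
rewrite normrM normrN normfV hr.
apply: le_lt_trans (_ : (r%:C)^-1 * (K * r ^+ 2)%:C < _); first by rewrite ler_wpM2l// invr_ge0 -hr.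
rewrite -rmorphV/= ?unitfE ?gt_eqF// -rmorphM/= ltcR.
have -> : r^-1 * (K * r ^+ 2) = K * r by field; rewrite gt_eqF.
move: re; rewrite ltr_pdivlMr ?ltr_pwDr// => re.
have := ler_norm K; nra.
Unshelve. all: by end_near. Qed.

Lemma derivable_cexp_linear (a : C) (b : C) (z : C^o) :
  derivable (fun z : C^o => cexp (a * z + b) : C^o) z 1.
Proof.
have [s s0 as'] := norm_realP a.
have [t t0 at'] := norm_realP (cexp (a * z + b)).
apply: (@derivable_quadratic _ z (a * cexp (a * z + b)) (t * (4 * s ^+ 2 * expR s)) 1) => // h r hr r1.
have r0 : 0 <= r by rewrite -ler0c -hr.
have -> : a * (z + h) + b = (a * z + b) + a * h by ring.
rewrite cexpD.
have -> : cexp (a * z + b) * cexp (a * h) - cexp (a * z + b) -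
  h * (a * cexp (a * z + b)) = cexp (a * z + b) * (cexp (a * h) - 1 - a * h) by ring.
rewrite normrM at' -!mulrA rmorphM/= ler_wpM2l ?ler0c//.
have ahr : `|a * h| = (s * r)%:C by rewrite normrM as' hr rmorphM.
apply: le_trans (cexp_taylor ahr) _; rewrite lecR exprMn.
have ee : expR (s * r) <= expR s by rewrite ler_expR ler_piMr.
have -> : 4 * (s * (s * (expR s * r ^+ 2))) = 4 * (s ^+ 2 * r ^+ 2) * expR s.
  by ring.
by rewrite ler_wpM2l// !mulr_ge0// ?exprn_ge0.
Qed.

Lemma expR_ge_sqr (t : R) : 0 <= t -> t ^+ 2 <= 2 * expR t.
Proof.
move=> t0; have := @expR_ge1Dxn R t 1 t0; rewrite (_ : 2`!%:R = 2)// => h.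
have := sqr_ge0 t; lra.
Qed.

(** The Taylor errors of the terms are summed. The frequencies [nu i] have both signs, so each error
    is dominated by the sizes of the term on the two lines u + rho and u - rho together. *)
Lemma dirichlet_derivable (I : choiceType) (a : I -> C) (nu : I -> R)
    (Phi : C^o -> C^o) (u rho : R) : 0 < rho ->
  (forall z : C, `|complex.Re z - u| <= rho ->
     has_sum (fun i => a i * cexp ((nu i)%:C * z)) (Phi z)) ->
  abs_bounded (fun i => a i * (expR (nu i * (u + rho)))%:C) ->
  abs_bounded (fun i => a i * (expR (nu i * (u - rho)))%:C) ->
  forall z : C^o, complex.Re z = u -> derivable Phi z 1.
Proof.
move=> rho0 hPhi [K1 hK1] [K2 hK2] z zu.
have K10 : 0 <= K1 by have := hK1 fset0; rewrite big_seq_fset0.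
have K20 : 0 <= K2 by have := hK2 fset0; rewrite big_seq_fset0.
have /complex_realP[k1 k1E] := ger0_real K10.
have /complex_realP[k2 k2E] := ger0_real K20.
have enu i : expR (nu i * u + `|nu i| * rho) <=
    expR (nu i * (u + rho)) + expR (nu i * (u - rho)).
  have [n0|n0] := leP 0 (nu i).
    by rewrite (ger0_norm n0) mulrDr lerDl expR_ge0.
  rewrite (ltr0_norm n0).
  have -> : nu i * u + - nu i * rho = nu i * (u - rho) by ring.
  by rewrite lerDr expR_ge0.
have hdom (b : I -> C) (k : R) : 0 <= k ->
    (forall i, `|b i| <= `|a i| * (k * expR (nu i * u + `|nu i| * rho))%:C) ->
    forall X : {fset I}, \sum_(i <- X) `|b i| <= k%:C * (K1 + K2).
  move=> k0 bk X; apply: le_trans (_ : \sum_(i <- X) k%:C *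
      (`|a i * (expR (nu i * (u + rho)))%:C| +
       `|a i * (expR (nu i * (u - rho)))%:C|) <= _).
    apply: ler_sum => i _; apply: le_trans (bk i) _.
    rewrite !normrM -mulrDr mulrCA ler_wpM2l//.
    rewrite !normcR !(ger0_norm (expR_ge0 _)) -rmorphD -rmorphM /= lecR.
    by rewrite ler_wpM2l.
  by rewrite -mulr_sumr big_split/= ler_wpM2l ?ler0c// lerD.
have nrho i : `|nu i| <= rho^-1 * expR (`|nu i| * rho).
  rewrite ler_pdivlMl// mulrC; have := expR_ge1Dx (`|nu i| * rho); lra.
have [|D hD] := @abs_bounded_has_sum _ _ (fun i => a i * (nu i)%:C * cexp ((nu i)%:C * z)).
  exists (rho^-1%:C * (K1 + K2)); apply: hdom => [|i]; first by rewrite invr_ge0 ltW.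
  rewrite normrM norm_cexp normrM normcR -mulrA ler_wpM2l// -rmorphM lecR.
  by rewrite Re_realM zu expRD mulrCA mulrC ler_wpM2l ?expR_ge0.
(* With increments up to [rho / 2], one factor exp (|nu| rho / 2) bounds the exponential of the
   increment and a second one absorbs the square, by t^2 <= 2 e^t at t = |nu| rho / 2. The 4 of
   [cexp_taylor] thus becomes 16 / rho^2, then 32 / rho^2. *)
apply: (@derivable_quadratic _ z D (32 / rho ^+ 2 * (k1 + k2)) (rho / 2)).
  by rewrite divr_gt0.
move=> h r hr rrho.
have r0 : 0 <= r by rewrite -ler0c -hr.
have reh : `|complex.Re h| <= r by rewrite -lecR -hr normc_ge_Re.
have hz : has_sum (fun i => a i * cexp ((nu i)%:C * z)) (Phi z).
  by apply: hPhi; rewrite zu subrr normr0 ltW.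
have hzh : has_sum (fun i => a i * cexp ((nu i)%:C * (z + h))) (Phi (z + h)).
  by apply: hPhi; rewrite raddfD/= zu addrC addKr (le_trans reh)//; lra.
have c0 : 0 <= 32 / rho ^+ 2 * r ^+ 2 by rewrite mulr_ge0 ?divr_ge0 ?exprn_ge0// ltW.
have c1 : 0 <= 16 / rho ^+ 2 * r ^+ 2 by rewrite mulr_ge0 ?divr_ge0 ?exprn_ge0// ltW.
have := has_sumB (has_sumB hzh hz) (has_sumZ h hD).
apply: has_sum_le => X; apply: le_trans (hdom _ (32 / rho ^+ 2 * r ^+ 2) _ _ X) _.
- exact: c0.
- move=> i /=.
  have -> : a i * cexp ((nu i)%:C * (z + h)) - a i * cexp ((nu i)%:C * z) -
      h * (a i * (nu i)%:C * cexp ((nu i)%:C * z)) =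
    a i * (cexp ((nu i)%:C * z) * (cexp ((nu i)%:C * h) - 1 - (nu i)%:C * h)).
    by rewrite mulrDr cexpD; ring.
  rewrite normrM ler_wpM2l// normrM norm_cexp Re_realM zu.
  have nh : `|(nu i)%:C * h| = (`|nu i| * r)%:C by rewrite normrM normcR hr rmorphM.
  apply: le_trans (_ : (expR (nu i * u))%:C * (4 * (`|nu i| * r) ^+ 2 * expR (`|nu i| * r))%:C <= _).
    by rewrite ler_wpM2l ?ler0c ?expR_ge0// cexp_taylor.
  rewrite -rmorphM/= lecR expRD [leRHS]mulrCA ler_wpM2l ?expR_ge0//.
  have e1 : (`|nu i| * rho / 2) ^+ 2 <= 2 * expR (`|nu i| * rho / 2).
    by apply: expR_ge_sqr; rewrite divr_ge0// mulr_ge0// ltW.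
  have e2 : expR (`|nu i| * r) <= expR (`|nu i| * rho / 2).
    by rewrite ler_expR -mulrA ler_wpM2l.
  have -> : expR (`|nu i| * rho) = expR (`|nu i| * rho / 2) * expR (`|nu i| * rho / 2).
    by rewrite -expRD -splitr.
  rewrite [leRHS]mulrA; apply: ler_pM => //; rewrite ?mulr_ge0 ?exprn_ge0 ?expR_ge0 ?mulr_ge0//.
  have -> : 4 * (`|nu i| * r) ^+ 2 = 16 / rho ^+ 2 * r ^+ 2 * (`|nu i| * rho / 2) ^+ 2.
    by field; rewrite gt_eqF.
  have -> : 32 / rho ^+ 2 * r ^+ 2 * expR (`|nu i| * rho / 2) =
     16 / rho ^+ 2 * r ^+ 2 * (2 * expR (`|nu i| * rho / 2)) by field; rewrite gt_eqF.
  by rewrite ler_wpM2l.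
by rewrite k1E k2E -rmorphD -rmorphM lecR/= mulrAC.
Qed.

End Exponential.

(** * Local quotients of holomorphic functions *)

Section Meromorphic.
Context {R : realType}.
Local Notation C := R[i].

Definition meromorphic_at (P : C -> C) (p : C^o) : Prop :=
  exists f h : C^o -> C^o,
    [/\ holomorphic_near f p, holomorphic_near h p &
        \forall z \near p, z != p -> h z != 0 /\ P z = f z / h z].

Lemma near_everywhere (Q : C -> Prop) (p : C^o) :
  (forall z, Q z) -> \forall z \near p, Q z.
Proof.
by move=> hQ; apply/(nbhs_ballP p); exists 1 => //=; rewrite ltr01.
Qed.

Lemma holomorphic_nearM (f g : C^o -> C^o) (p : C^o) :
  holomorphic_near f p -> holomorphic_near g p ->
  holomorphic_near (fun z => f z * g z : C^o) p.
Proof. by apply: filterS2 => z; exact: (@derivableM C C^o f g z 1). Qed.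

Lemma holomorphic_nearD (f g : C^o -> C^o) (p : C^o) :
  holomorphic_near f p -> holomorphic_near g p ->
  holomorphic_near (fun z => f z + g z : C^o) p.
Proof. by apply: filterS2 => z; exact: (@derivableD C C^o C^o f g z 1). Qed.

Lemma holomorphic_near_cst (a : C) (p : C^o) :
  holomorphic_near (fun=> a : C^o) p.
Proof. by apply: near_everywhere => z; exact: (@derivable_cst C C^o C^o a z 1). Qed.

Lemma meromorphic_at_holomorphic (f : C^o -> C^o) (p : C^o) :
  holomorphic_near f p -> meromorphic_at f p.
Proof.
move=> hf; exists f, (fun=> 1); split.
- exact: hf.
- exact: holomorphic_near_cst.
by apply: near_everywhere => z _; rewrite oner_neq0 divr1.
Qed.

Lemma eq_meromorphic_at (P Q : C -> C) (p : C^o) :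
  (\forall z \near p, P z = Q z) -> meromorphic_at P p -> meromorphic_at Q p.
Proof.
move=> PQ [f [h [hf hh Pf]]]; exists f, h; split.
- exact: hf.
- exact: hh.
by apply: filterS2 PQ Pf => z <-.
Qed.

Lemma meromorphic_atD (P Q : C -> C) (p : C^o) :
  meromorphic_at P p -> meromorphic_at Q p ->
  meromorphic_at (fun z => P z + Q z) p.
Proof.
move=> [f [h [hf hh Pf]]] [f' [h' [hf' hh' Qf]]].
exists (fun z => f z * h' z + f' z * h z), (fun z => h z * h' z); split.
- by apply: holomorphic_nearD; apply: holomorphic_nearM.
- exact: holomorphic_nearM.
apply: filterS2 Pf Qf => z Pf Qf zp.
have [h0 ->] := Pf zp; have [h0' ->] := Qf zp.
by split; [rewrite mulf_neq0|field; rewrite h0 h0'].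
Qed.

Lemma meromorphic_atM (P Q : C -> C) (p : C^o) :
  meromorphic_at P p -> meromorphic_at Q p ->
  meromorphic_at (fun z => P z * Q z) p.
Proof.
move=> [f [h [hf hh Pf]]] [f' [h' [hf' hh' Qf]]].
exists (fun z => f z * f' z), (fun z => h z * h' z); split.
- exact: holomorphic_nearM.
- exact: holomorphic_nearM.
apply: filterS2 Pf Qf => z Pf Qf zp.
have [h0 ->] := Pf zp; have [h0' ->] := Qf zp.
by split; [rewrite mulf_neq0|field; rewrite h0 h0'].
Qed.

Lemma meromorphic_at_cst (a : C) (p : C^o) : meromorphic_at (fun=> a) p.
Proof.
by apply: meromorphic_at_holomorphic; exact: holomorphic_near_cst.
Qed.

Lemma meromorphic_atZ (a : C) (P : C -> C) (p : C^o) :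
  meromorphic_at P p -> meromorphic_at (fun z => a * P z) p.
Proof. by apply: meromorphic_atM; exact: meromorphic_at_cst. Qed.

Lemma meromorphic_at_sum (n : nat) (P : nat -> C -> C) (p : C^o) :
  (forall i, (i < n)%N -> meromorphic_at (P i) p) ->
  meromorphic_at (fun z => \sum_(i < n) P i z) p.
Proof.
elim: n => [|n IHn] hP.
  have -> : (fun z => \sum_(i < 0) P i z) = fun=> 0.
    by apply/funext => z; rewrite big_ord0.
  exact: meromorphic_at_cst.
have -> : (fun z => \sum_(i < n.+1) P i z) =
    fun z => \sum_(i < n) P i z + P n z.
  by apply/funext => z; rewrite big_ord_recr.
by apply: meromorphic_atD; [apply: IHn => i /ltnW|]; exact: hP.
Qed.

Lemma meromorphic_at_cexp (a b : C) (p : C^o) :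
  meromorphic_at (fun z => cexp (a * z + b)) p.
Proof.
apply: meromorphic_at_holomorphic; apply: near_everywhere => z.
exact: derivable_cexp_linear.
Qed.

(** If e^h = 1, the Taylor bound gives r <= 4 r^2 e^r for r = |h|, which fails for 0 < r < 1/12
    because e^r < 3. Hence the poles of 1 / (1 - e^(z + a)) are isolated. *)
Lemma cexp_neq1_near0 (h : C) : h != 0 -> `|h| < (1 / 12)%:C -> cexp h != 1.
Proof.
move=> h0; have [r r0 hr] := norm_realP h; rewrite hr ltcR => r12.
have rpos : 0 < r by rewrite -ltcR -hr normr_gt0.
apply/negP => /eqP e1; have := cexp_taylor hr.
rewrite e1 subrr sub0r normrN hr lecR.
have h3 : expR r < 3.
  have := expRxMexpNx_1 r; have := expR_ge1Dx (- r); have := expR_gt0 r.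
  by have := expR_gt0 (- r); nra.
rewrite leNgt => /negP; apply.
have -> : 4 * r ^+ 2 * expR r = r * (4 * r * expR r) by ring.
rewrite -[ltRHS]mulr1 ltr_pM2l//.
have := expR_gt0 r; nra.
Qed.

Lemma derivable_cexp_shift (a : C) (z : C^o) :
  derivable (fun z : C^o => cexp (z + a) : C^o) z 1.
Proof.
have -> : (fun z : C^o => cexp (z + a)) = (fun z => cexp (1 * z + a) : C^o).
  by apply/funext => w; rewrite mul1r.
exact: derivable_cexp_linear.
Qed.

Lemma holomorphic_near_cexp (a : C) (p : C^o) :
  holomorphic_near (fun z : C^o => cexp (z + a) : C^o) p.
Proof. by apply: near_everywhere => z; exact: derivable_cexp_shift. Qed.

Lemma meromorphic_at_inv (a : C) (p : C^o) :
  meromorphic_at (fun z => (1 - cexp (z + a))^-1) p.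
Proof.
exists (fun=> 1), (fun z => 1 + (- 1) * cexp (z + a)); split.
- exact: holomorphic_near_cst.
- apply: holomorphic_nearD; first exact: holomorphic_near_cst.
  apply: holomorphic_nearM; first exact: holomorphic_near_cst.
  exact: holomorphic_near_cexp.
suff : \forall z \near p, z != p -> cexp (z + a) != 1.
  apply: filterS => z hz /hz hz1; rewrite mulN1r div1r; split => //.
  by rewrite subr_eq0 eq_sym.
have [e1|e1] := eqVneq (cexp (p + a)) 1.
  have : \forall z \near p, `|z - p| < (1 / 12)%:C.
    apply/(nbhs_ballP p); exists (1 / 12)%:C => /=; first by rewrite ltcR.
    by move=> z; rewrite /ball/= distrC.
  apply: filterS => z zp zNp.
  have -> : z + a = (z - p) + (p + a) by rewrite addrA subrK.
  rewrite cexpD e1 mulr1; apply: cexp_neq1_near0 => //.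
  by rewrite subr_eq0.
have cf : {for p, continuous (fun z : C^o => cexp (z + a) : C^o)}.
  apply: (@differentiable_continuous C C^o C^o).
  by apply/derivable1_diffP; exact: derivable_cexp_shift.
have d0 : 0 < `|cexp (p + a) - 1| by rewrite normr_gt0 subr_eq0.
move/cvgrPdist_lt/(_ _ d0): cf; apply: filterS => z hz _.
by apply: contraTneq hz => ->; rewrite ltxx.
Qed.

End Meromorphic.

(** * Twisted Weierstrass functions and their expansions *)

Section GeometricSums.
Context {R : realType}.
Local Notation C := R[i].

Lemma sum_geom_le (rho : R) (X : {fset nat}) : 0 <= rho < 1 ->
  \sum_(i <- X) `|(rho ^+ i)%:C| <= ((1 - rho)^-1)%:C.
Proof.
move=> /andP[r0 r1].
have [N XN] : exists N, forall i, i \in X -> (i < N)%N.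
  exists (\max_(i <- X) i).+1 => i iX; rewrite ltnS.
  exact: (@leq_bigmax_seq _ (enum_fset X) predT id i iX isT).
pose Y : {fset nat} := [fset i in iota 0 N]%fset.
have XY : (X `<=` Y)%fset.
  apply/fsubsetP => i iX; rewrite !inE/= mem_iota leq0n.
  exact: XN.
have geom n : (1 - rho) * (\sum_(i <- iota 0 n) rho ^+ i) <= 1.
  have -> : (1 - rho) * (\sum_(i <- iota 0 n) rho ^+ i) = 1 - rho ^+ n.
    elim: n => [|n IHn]; first by rewrite big_nil mulr0 expr0 subrr.
    by rewrite -addn1 iotaD big_cat/= add0n big_seq1 mulrDr IHn addn1 exprS; ring.
  by rewrite gerBl exprn_ge0.
apply: le_trans (_ : \sum_(i <- Y) `|(rho ^+ i)%:C| <= _).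
  by rewrite (big_fsubset_split _ XY) lerDl sumr_ge0.
have -> : \sum_(i <- Y) `|(rho ^+ i)%:C| = (\sum_(i <- iota 0 N) rho ^+ i)%:C.
  rewrite rmorph_sum/=; under eq_bigr do rewrite normcR ger0_norm ?exprn_ge0//.
  apply: perm_big; apply: uniq_perm; rewrite ?fset_uniq ?iota_uniq// => i.
  by rewrite !inE.
rewrite lecR -[leRHS]mul1r ler_pdivlMr ?subr_gt0//.
by rewrite mulrC geom.
Qed.

Lemma abs_bounded_geom (rho : R) : 0 <= rho < 1 ->
  abs_bounded (fun i : nat => (rho ^+ i)%:C).
Proof. by move=> r01; exists ((1 - rho)^-1)%:C => X; exact: sum_geom_le. Qed.

Lemma exprn_le_fact (t : R) (k : nat) : 0 <= t -> t ^+ k <= k`!%:R * expR t.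
Proof.
move=> t0; case: k => [|k].
  by rewrite expr0 fact0 mul1r -expR0 ler_expR.
have := expR_ge1Dxn k t0 => h.
rewrite mulrC -ler_pdivrMr ?ltr0n ?fact_gt0//; lra.
Qed.

(** Half of the decay rate pays for the power, by t^k <= k! e^t; the other half leaves a geometric
    series in |j|. The factor [expR (s / 2)] in [K'] comes from |j| <= |j + lam| + 1. *)
Lemma abs_bounded_int (f : int -> C) (lam K s : R) (k : nat) :
  0 <= lam < 1 -> 0 < s -> 0 <= K ->
  (forall j : int, `|f j| <=
    (K * `|j%:~R + lam| ^+ k * expR (- (`|j%:~R + lam| * s)))%:C) ->
  abs_bounded f.
Proof.
move=> /andP[l0 l1] s0 K0 hf.
pose rho := expR (- (s / 2)).
have rho01 : 0 <= rho < 1.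
  by rewrite expR_ge0 expR_lt1 oppr_lt0 divr_gt0.
pose K' := K * (k`!%:R / (s / 2) ^+ k) * expR (s / 2).
have K'0 : 0 <= K'.
  have s2 : 0 <= s / 2 by rewrite divr_ge0// ltW.
  by rewrite /K' !mulr_ge0 ?invr_ge0 ?exprn_ge0 ?expR_ge0.
have hf' j : `|f j| <= `|K'%:C * (rho ^+ `|j|%N)%:C|.
  apply: le_trans (hf j) _; rewrite -rmorphM normcR lecR/=.
  rewrite [leRHS]ger0_norm; last by rewrite mulr_ge0// exprn_ge0// expR_ge0.
  set y := `|_ + lam|; have y0 : 0 <= y by exact: normr_ge0.
  have hy : `|j|%:R <= y + 1.
    rewrite natr_absz intr_norm.
    have -> : j%:~R = (j%:~R + lam) - lam :> R by ring.
    by apply: le_trans (ler_normB _ _) _; rewrite lerD2l ger0_norm// ltW.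
  have h1 : y ^+ k <= k`!%:R / (s / 2) ^+ k * expR (y * (s / 2)).
    have ys : 0 <= y * (s / 2) by rewrite mulr_ge0// divr_ge0// ltW.
    have := exprn_le_fact k ys; rewrite exprMn -ler_pdivlMr ?exprn_gt0 ?divr_gt0//.
    by rewrite mulrAC.
  have h2 : expR (- (y * (s / 2))) <= expR (s / 2) * rho ^+ `|j|%N.
    rewrite /rho -expRM_natl -expRD ler_expR.
    have s2 : 0 < s / 2 by rewrite divr_gt0.
    nra.
  have -> : expR (- (y * s)) = expR (- (y * (s / 2))) * expR (- (y * (s / 2))).
    by rewrite -expRD; congr expR; field.
  rewrite /K' -!mulrA ler_wpM2l// mulrA [leRHS]mulrA.
  have h3 : y ^+ k * expR (- (y * (s / 2))) <= k`!%:R / (s / 2) ^+ k.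
    apply: le_trans (ler_wpM2r (expR_ge0 _) h1) _.
    by rewrite -[leLHS]mulrA expRxMexpNx_1 mulr1.
  apply: ler_pM => //.
  by rewrite mulr_ge0 ?exprn_ge0 ?expR_ge0.
apply: (abs_bounded_le hf'); apply: abs_boundedZ.
have gb := abs_bounded_geom rho01.
have -> : (fun j : int => (rho ^+ `|j|%N)%:C) =
   fun j : int => (if 0 <= j then (rho ^+ `|j|%N)%:C else 0) +
      (if j < 0 then (rho ^+ `|j|%N)%:C else 0).
  by apply/funext => j; case: leP; rewrite ?addr0 ?add0r.
apply: abs_boundedD; apply: (abs_bounded_transfer (h := absz) _ _ gb).
- by move=> i i'; case: ifP => [i0 _|]; [|by rewrite eqxx]; case: ifP => [i0' _|]; [|by rewrite eqxx]; lia.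
- by move=> i; case: ifP; rewrite ?eqxx.
- by move=> i i'; case: ifP => [i0 _|]; [|by rewrite eqxx]; case: ifP => [i0' _|]; [|by rewrite eqxx]; lia.
- by move=> i; case: ifP; rewrite ?eqxx.
Qed.

Lemma has_sum_shift (f : int -> C) (s : C) :
  has_sum f s -> has_sum (fun j => f (j - 1)) s.
Proof.
apply: (@has_sum_transfer _ _ _ (fun j => j + 1)).
- by move=> i i' _ _ /addIr.
- by move=> i _; rewrite addrK.
- by move=> j fj; exists (j - 1) => //; rewrite subrK.
Qed.

Lemma has_sum_geom (x : C) : `|x| < 1 -> has_sum (fun i : nat => x ^+ i) (1 - x)^-1.
Proof.
move=> x1; have [r r0 xr] := norm_realP x.
have r1 : r < 1 by rewrite -ltcR -xr.
have [|s hs] := @abs_bounded_has_sum _ _ (fun i : nat => x ^+ i).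
  apply: (@abs_bounded_le _ _ _ (fun i : nat => (r ^+ i)%:C)).
    by move=> i; rewrite normrX xr normcR ger0_norm ?exprn_ge0// rmorphXn.
  by apply: abs_bounded_geom; rewrite r0.
have hs' : has_sum (fun i : nat => (if i == 0%N then 1 else 0) +
    (if i == 0%N then 0 else x ^+ i)) (1 + x * s).
  apply: has_sumD; first exact: has_sum_single.
  apply: (@has_sum_transfer _ _ _ succn) (has_sumZ x hs).
  - by move=> i i' _ _ [].
  - by move=> i _ /=; rewrite exprS.
  - by case=> [|j]/=; rewrite ?eqxx// => xj; exists j; rewrite -?exprS.
have sE : s = 1 + x * s.
  apply: has_sum_unique hs _; apply: eq_has_sum hs' => -[|i]/=.
    by rewrite addr0 expr0.
  by rewrite add0r.
have x1' : 1 - x != 0.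
  by rewrite subr_eq0; apply: contraTneq x1 => <-; rewrite normr1 ltxx.
suff -> : (1 - x)^-1 = s by [].
apply: (mulfI x1'); rewrite mulfV//.
by rewrite mulrBl mul1r {1}sE addrK.
Qed.

Lemma has_sum_sum (I : choiceType) (n : nat) (F : nat -> I -> C) (s : nat -> C) :
  (forall i, (i < n)%N -> has_sum (F i) (s i)) ->
  has_sum (fun j => \sum_(i < n) F i j) (\sum_(i < n) s i).
Proof.
elim: n => [|n IHn] Fs.
  rewrite big_ord0; apply: eq_has_sum (@has_sum0 R I) => j.
  by rewrite big_ord0.
rewrite big_ord_recr/=.
apply: eq_has_sum (has_sumD (IHn (fun i h => Fs i (ltnW h))) (Fs n (leqnn _))).
by move=> j; rewrite big_ord_recr.
Qed.

Section Eulerian.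
Variable lam : R.
Hypothesis lam01 : 0 <= lam < 1.
Local Notation nu j := (j%:~R + lam).

Lemma nu_ge0 (j : int) : 0 <= j -> 0 <= nu j.
Proof.
case/andP: lam01 => l0 _ j0; rewrite addr_ge0//.
by rewrite ler0z.
Qed.

Lemma nu_lt0 (j : int) : j < 0 -> nu j < 0.
Proof.
case/andP: lam01 => _ l1 j0.
have : j%:~R <= (-1)%:~R :> R by rewrite ler_int; lia.
by rewrite intrN/=; lra.
Qed.

(* [G] is found by induction on [k]: multiplication of the series by [1 - e^z]
   replaces [n^k] by [n^k - (n - 1)^k], up to a boundary term. *)
Lemma exists_eulerian (k : nat) : exists G : C -> C,
  [/\ forall (a : C) (p : C^o), meromorphic_at (fun z => G (z + a)) p,
    forall z : C, complex.Re z < 0 ->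
      has_sum (fun j : int => if 0 <= j then
        (nu j)%:C ^+ k * cexp ((nu j)%:C * z) else 0) (G z) &
    forall z : C, 0 < complex.Re z ->
      has_sum (fun j : int => if j < 0 then
        (nu j)%:C ^+ k * cexp ((nu j)%:C * z) else 0) (- G z)].
Proof.
elim/ltn_ind: k => k IHk.
have /choice[Gs hGs] : forall i : nat, exists G : C -> C, (i < k)%N ->
  [/\ forall (a : C) (p : C^o), meromorphic_at (fun z => G (z + a)) p,
    forall z : C, complex.Re z < 0 ->
      has_sum (fun j : int => if 0 <= j then
        (nu j)%:C ^+ i * cexp ((nu j)%:C * z) else 0) (G z) &
    forall z : C, 0 < complex.Re z ->
      has_sum (fun j : int => if j < 0 then
        (nu j)%:C ^+ i * cexp ((nu j)%:C * z) else 0) (- G z)].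
  move=> i; case: (ltnP i k) => [ik|]; last by exists (fun=> 0).
  by have [G hG] := IHk i ik; exists G.
(* These are the coefficients of x^k - (x - 1)^k, which has degree below [k]; all smaller exponents
   occur, hence the strong induction. *)
pose b i : C := - ((-1) ^+ (k - i) *+ 'C(k, i)).
have diff (x : C) : x ^+ k - (x - 1) ^+ k = \sum_(i < k) b i * x ^+ i.
  rewrite [x - 1]addrC exprDn big_ord_recr/= subnn binn expr0 mulr1n mul1r.
  rewrite opprD addrCA subrr addr0 -sumrN; apply: eq_bigr => i _.
  by rewrite /b mulNr mulrnAl.
have hsum (f : int -> bool) (z : C) (t : nat -> C) :
    (forall i, (i < k)%N -> has_sum (fun j : int => if f j then
        (nu j)%:C ^+ i * cexp ((nu j)%:C * z) else 0) (t i)) ->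
    has_sum (fun j : int => if f j then
      (\sum_(i < k) b i * (nu j)%:C ^+ i) * cexp ((nu j)%:C * z) else 0)
      (\sum_(i < k) b i * t i).
  move=> ft.
  have := @has_sum_sum _ k (fun i (j : int) => b i * (if f j then
        (nu j)%:C ^+ i * cexp ((nu j)%:C * z) else 0)) (fun i => b i * t i).
  move=> /(_ (fun i ik => has_sumZ (b i) (ft i ik))).
  apply: eq_has_sum => j; case: (f j); last by rewrite big1// => i _; rewrite mulr0.
  by rewrite mulr_suml; apply: eq_bigr => i _; rewrite mulrA.
have one_sub (z : C) : complex.Re z != 0 -> 1 - cexp z != 0.
  move=> z0; rewrite subr_eq0; apply: contraNneq z0 => /(congr1 Num.norm).
  rewrite norm_cexp normr1 => /complexI/esym/eqP.
  by rewrite -expR0 (inj_eq (@expR_inj R)).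
(* The first term is the boundary term: after the shift, j = 0 receives a contribution of index -1
   that the sum over j >= 0 does not contain. In the sum over j < 0 the same contribution is shifted
   out of range, so it occurs with the opposite sign, as do the lower functions; this is why one [G]
   serves both half-planes up to sign. *)
pose H z := (nu (-1))%:C ^+ k * cexp (lam%:C * z) + \sum_(i < k) b i * Gs i z.
have nuB j : (nu (j - 1))%:C = (nu j)%:C - 1 :> C.
  by rewrite -(rmorph1 (real_complex R)) -rmorphB; congr _%:C; rewrite intrB/=; ring.
have cexp_shift j z : cexp z * ((nu (j - 1))%:C ^+ k * cexp ((nu (j - 1))%:C * z)) =
    ((nu j)%:C - 1) ^+ k * cexp ((nu j)%:C * z).
  by rewrite mulrCA -cexpD nuB; congr (_ * cexp _); ring.
have Hnu0 z : cexp ((nu 0)%:C * z) = cexp (lam%:C * z) by rewrite add0r.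
have ebd (z : C) (sg : bool) : (if sg then complex.Re z < 0 else 0 < complex.Re z) ->
    abs_bounded (fun j : int => if (if sg then 0 <= j else j < 0) then
        (nu j)%:C ^+ k * cexp ((nu j)%:C * z) else 0).
  move=> hz; apply: (@abs_bounded_int _ lam 1 `|complex.Re z| k) => // [|j].
    by rewrite normr_gt0; case: sg hz => h; [rewrite lt_eqF|rewrite gt_eqF].
  rewrite mul1r; case: ifP => [hj|_]; last first.
    by rewrite normr0 ler0c mulr_ge0 ?exprn_ge0 ?expR_ge0.
  rewrite normrM norm_cexp Re_realM normrX normcR -rmorphXn -rmorphM lecR/=.
  rewrite ler_wpM2l ?exprn_ge0// ler_expR.
  case: sg hz hj => [hz /nu_ge0 hj|hz /nu_lt0 hj].
    by rewrite (ger0_norm hj) (ltr0_norm hz) mulrN opprK.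
  by rewrite (ltr0_norm hj) (gtr0_norm hz) mulNr opprK.
exists (fun z => H z * (1 - cexp z)^-1); split.
- move=> a p; apply: meromorphic_atM; last exact: meromorphic_at_inv.
  apply: meromorphic_atD.
    apply: meromorphic_atZ.
    have -> : (fun z => cexp (lam%:C * (z + a))) =
        (fun z => cexp (lam%:C * z + lam%:C * a)).
      by apply/funext => z; rewrite mulrDr.
    exact: meromorphic_at_cexp.
  apply: (@meromorphic_at_sum _ k (fun i z => b i * Gs i (z + a))) => i ik.
  by apply: meromorphic_atZ; have [] := hGs i ik.
- move=> z z0.
  have [s hs] := abs_bounded_has_sum (ebd z true z0).
  suff -> : H z / (1 - cexp z) = s by [].
  suff -> : H z = s * (1 - cexp z) by rewrite mulfK// one_sub// lt_eqF.
  rewrite mulrBr mulr1 [s * _]mulrC; apply/esym.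
  apply: has_sum_unique (has_sumB hs (has_sumZ (cexp z) (has_sum_shift hs))) _.
  have := has_sumD (has_sum_single (0 : int) ((nu (-1))%:C ^+ k * cexp (lam%:C * z)))
    (hsum (fun j => 0 <= j) z (Gs^~ z) (fun i ik => let: And3 _ h _ := hGs i ik in h z z0)).
  apply: eq_has_sum => j /=; rewrite -diff.
  case: (ltgtP j 0) => [j0|j0|->].
  - by rewrite (_ : 0 <= j - 1 = false) ?mulr0 ?subr0 ?addr0//; lia.
  - have -> : 0 <= j - 1 by lia.
    by rewrite cexp_shift add0r mulrBl.
  - by rewrite /= mulr0 subr0 Hnu0 -[-1]sub0r nuB; ring.
- move=> z z0.
  have [s hs] := abs_bounded_has_sum (ebd z false z0).
  suff -> : - (H z / (1 - cexp z)) = s by [].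
  suff -> : H z = - (s * (1 - cexp z)).
    by rewrite mulNr opprK mulfK// one_sub// gt_eqF.
  rewrite mulrBr mulr1 [s * _]mulrC; apply/esym.
  apply: has_sum_unique (has_sumN (has_sumB hs (has_sumZ (cexp z) (has_sum_shift hs)))) _.
  have := has_sumB (has_sum_single (0 : int) ((nu (-1))%:C ^+ k * cexp (lam%:C * z)))
    (hsum (fun j => j < 0) z (fun i => - Gs i z) (fun i ik => let: And3 _ _ h := hGs i ik in h z z0)).
  have -> : (nu (-1))%:C ^+ k * cexp (lam%:C * z) - \sum_(i < k) b i * - Gs i z = H z.
    by rewrite /H -sumrN; congr (_ + _); apply: eq_bigr => i _; rewrite mulrN opprK.
  apply: eq_has_sum => j /=; rewrite -diff.
  case: (ltgtP j 0) => [j0|j0|->].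
  - have -> : j - 1 < 0 by lia.
    by rewrite cexp_shift sub0r mulrBl.
  - by rewrite (_ : j - 1 < 0 = false) ?mulr0 ?subr0 ?oppr0//; lia.
  - have -> : (0 : int) - 1 < 0 by lia.
    by rewrite cexp_shift Hnu0 -[-1]sub0r nuB subr0 sub0r opprK.
Qed.

End Eulerian.
End GeometricSums.

(** * Meromorphic continuation strip by strip *)

Section Weierstrass.
Context {R : realType}.
Local Notation C := R[i].
Variables (theta om : C) (lam : R) (k : nat).
Hypotheses (theta1 : `|theta| = 1) (lam01 : 0 <= lam < 1).
Hypothesis (om_lt0 : complex.Re om < 0).
Local Notation nu j := (j%:~R + lam).
Local Notation T := (- complex.Re om).

Let T_gt0 : 0 < T. Proof. by rewrite oppr_gt0. Qed.

Definition ratio (j : int) : C := theta^-1 * cexp ((nu j)%:C * om).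

Lemma theta_neq0 : theta != 0.
Proof. by rewrite -normr_eq0 theta1 oner_eq0. Qed.

Lemma ratio_neq0 j : ratio j != 0.
Proof. by rewrite mulf_neq0 ?invr_eq0 ?theta_neq0 ?cexp_neq0. Qed.

Lemma norm_ratio j : `|ratio j| = (expR (- (nu j * T)))%:C.
Proof.
by rewrite normrM normfV theta1 invr1 mul1r norm_cexp Re_realM mulrN opprK.
Qed.

Lemma norm_ratioV j : `|ratio j|^-1 = (expR (nu j * T))%:C.
Proof. by rewrite norm_ratio expRN fmorphV invrK. Qed.

Lemma ratio_eq1 j : ratio j = 1 -> j = 0 /\ lam = 0.
Proof.
move=> /(congr1 Num.norm); rewrite norm_ratio normr1 => /complexI e1.
have /expR_inj/eqP : expR (- (nu j * T)) = expR 0 by rewrite expR0.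
rewrite oppr_eq0 mulf_eq0 (gt_eqF T_gt0) orbF.
case: (ltP j 0) => [/(nu_lt0 lam01)/lt_eqF -> //|j0].
have /andP[l0 _] := lam01.
rewrite paddr_eq0 ?ler0z// => /andP[]; rewrite intr_eq0 => /eqP -> /eqP ->.
by [].
Qed.

(** For j >= 1 the ratio has norm at most e^(-T). For j <= -1 one writes 1 / (1 - x) = - x^-1 / (1 -
    x^-1), where x^-1 has norm at most e^((lam - 1) T). At j = 0 the norm may be 1, so that single
    value gets its own constant; it is 0 if the ratio is 1. *)
Lemma ratio_inv_bound : exists2 K : R, 0 <= K & forall j,
  `|(1 - ratio j)^-1| <= (K * (if 0 <= j then 1 else expR (nu j * T)))%:C.
Proof.
have /andP[l0 l1] := lam01.
have [K0 K00 K0E] := norm_realP (1 - ratio 0)^-1.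
pose K1 := (1 - expR (- T))^-1; pose K2 := (1 - expR ((lam - 1) * T))^-1.
have K1p : 0 < 1 - expR (- T) by rewrite subr_gt0 expR_lt1 oppr_lt0.
have K2p : 0 < 1 - expR ((lam - 1) * T).
  by rewrite subr_gt0 expR_lt1 nmulr_rlt0 ?subr_lt0.
have K10 : 0 <= K1 by rewrite invr_ge0 ltW.
have K20 : 0 <= K2 by rewrite invr_ge0 ltW.
have inv_bound (w : C) (e d : R) : `|w| = e%:C -> e <= d -> 0 < 1 - d ->
    `|(1 - w)^-1| <= ((1 - d)^-1)%:C.
  move=> we ed d1; have h : (1 - d)%:C <= `|1 - w|.
    apply: le_trans (lerB_dist _ _); rewrite normr1 we rmorphB/=.
    by rewrite lerD2l lerN2 lecR.
  rewrite normfV fmorphV/= lef_pV2// posrE ?ltcR//.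
  by rewrite -ltcR; apply: lt_le_trans h; rewrite ltcR.
exists (K0 + K1 + K2); first by rewrite !addr_ge0.
move=> j; case: (ltgtP j 0) => j0.
- have jN1 : j%:~R <= -1 :> R by rewrite -(intrN _ 1) ler_int; lia.
  have -> : (1 - ratio j)^-1 = - (ratio j)^-1 * (1 - (ratio j)^-1)^-1.
    have r0 := ratio_neq0 j.
    have r1 : 1 - ratio j != 0.
      by rewrite subr_eq0; apply/eqP => /esym/ratio_eq1[j00 _]; rewrite j00 in j0.
    have r1' : ratio j - 1 != 0 by rewrite -opprB oppr_eq0.
    by field; rewrite r0 r1' r1.
  rewrite normrM normrN normfV norm_ratioV.
  rewrite mulrC rmorphM; apply: ler_pM => //; first by rewrite ler0c expR_ge0.
  apply: le_trans (inv_bound _ (expR (nu j * T)) (expR ((lam - 1) * T)) _ _ K2p) _.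
  + by rewrite normfV norm_ratioV.
  + by rewrite ler_expR ler_pM2r//; lra.
  + by rewrite lecR -/K2; lra.
- have jN1 : 1 <= j%:~R :> R by rewrite (ler_int R 1); lia.
  apply: le_trans (inv_bound _ _ (expR (- T)) (norm_ratio j) _ K1p) _.
    by rewrite ler_expR lerN2 (ler_peMl (ltW T_gt0))//; lra.
  by rewrite mulr1 lecR -/K1; lra.
- by rewrite j0 K0E mulr1 lecR; lra.
Qed.

(* What is left of [1 / (1 - x)], for [x = ratio j], when [N] terms of its
   geometric series in [x] (if [0 <= j]) or in [x^-1] (if [j < 0]) are removed. *)
Definition remainder_coef (N : nat) (j : int) : C :=
  (nu j)%:C ^+ k * (if 0 <= j then ratio j ^+ N else ratio j ^- N) /
  (1 - ratio j).

(** After [N] steps the terms have size about e^(n (u - N T)) for n > 0 and e^(n (u + (N + 1) T))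
    for n < 0, where u is the real part of z. The case N = 0 is the annulus |q| < |q_z| < 1. *)
Definition in_strip (N : nat) (u : R) := - (N.+1%:R * T) < u < N%:R * T.

Lemma remainder_coef_bounded N (u : R) : in_strip N u ->
  abs_bounded (fun j => remainder_coef N j * (expR (nu j * u))%:C).
Proof.
move=> /andP[u1 u2]; have [K K0 hK] := ratio_inv_bound.
pose s := Num.min (N%:R * T - u) (u + N.+1%:R * T).
have s1 : s <= N%:R * T - u by rewrite ge_min lexx.
have s2 : s <= u + N.+1%:R * T by rewrite ge_min lexx orbT.
apply: (@abs_bounded_int _ _ lam K s k) => // [|j].
  by rewrite lt_min subr_gt0 u2 -ltrBlDr sub0r u1.
have -> : remainder_coef N j * (expR (nu j * u))%:C = (nu j)%:C ^+ k *
   ((if 0 <= j then ratio j ^+ N else ratio j ^- N) *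
     (1 - ratio j)^-1 * (expR (nu j * u))%:C).
  by rewrite /remainder_coef -!mulrA.
rewrite normrM normrX normcR -rmorphXn -[K * _ * _]mulrA [K * _]mulrCA.
rewrite [X in _ <= X]rmorphM ler_wpM2l ?ler0c ?exprn_ge0//.
rewrite normrM normcR (ger0_norm (expR_ge0 _)) normrM.
apply: le_trans (ler_wpM2r _ (ler_wpM2l (normr_ge0 _) (hK j))) _.
  by rewrite ler0c expR_ge0.
case: ifP => [/(nu_ge0 lam01)|/negbT]; last rewrite -ltNge => /(nu_lt0 lam01).
  move=> n0; rewrite mulr1 normrX norm_ratio -rmorphXn -!rmorphM lecR/=.
  rewrite mulrAC mulrC ler_wpM2l// -expRM_natl -expRD ler_expR (ger0_norm n0).
  nra.
move=> n0; rewrite normfV normrX norm_ratio -rmorphXn -fmorphV -!rmorphM lecR/=.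
rewrite -expRM_natl -expRN mulrCA -mulrA ler_wpM2l// -!expRD ler_expR (ltr0_norm n0).
by rewrite -natr1 in s2; nra.
Qed.

Definition remainder_sum (N : nat) (z : C) : C :=
  xget 0 [set s | has_sum (fun j => remainder_coef N j * cexp ((nu j)%:C * z)) s].

Lemma remainder_sumP N (z : C) : in_strip N (complex.Re z) ->
  has_sum (fun j => remainder_coef N j * cexp ((nu j)%:C * z)) (remainder_sum N z).
Proof.
move=> hz; have [|s hs] := @abs_bounded_has_sum _ _
    (fun j => remainder_coef N j * cexp ((nu j)%:C * z)).
  apply: abs_bounded_le (remainder_coef_bounded hz) => j.
  by rewrite normrM norm_cexp Re_realM [leRHS]normrM normcR (ger0_norm (expR_ge0 _)).
by rewrite /remainder_sum; case: xgetP => [t _ //|/(_ s)].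
Qed.

Lemma Re_near (p : C^o) (P : R -> Prop) :
  (\forall u \near complex.Re p, P u) -> \forall z \near p, P (complex.Re z).
Proof.
move=> /nbhs_ballP[e /= e0 he]; apply/(nbhs_ballP p).
exists e%:C => /=; first by rewrite ltcR.
move=> z; rewrite /ball/= => pz; apply: he; rewrite /ball/=.
by rewrite -ltcR; apply: le_lt_trans pz; rewrite -raddfB normc_ge_Re.
Qed.

Lemma in_strip_near N (u : R) : in_strip N u -> \forall v \near u, in_strip N v.
Proof.
move=> /andP[h1 h2]; near=> v; apply/andP; split.
- near: v; exact: lt_nbhsr.
- near: v; exact: lt_nbhsl.
Unshelve. all: by end_near. Qed.

Lemma meromorphic_at_remainder N (p : C^o) : in_strip N (complex.Re p) ->
  meromorphic_at (remainder_sum N) p.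
Proof.
move=> hp; apply: meromorphic_at_holomorphic.
have := Re_near (in_strip_near hp); apply: filterS => z hz.
have /nbhs_ballP[e /= e0 he] := in_strip_near hz.
have e20 : 0 < e / 2 by rewrite divr_gt0.
have hball (v : R) : `|v - complex.Re z| <= e / 2 -> in_strip N v.
  move=> hv; apply: he; rewrite /ball/= distrC (le_lt_trans hv)//; lra.
apply: (@dirichlet_derivable _ _ (remainder_coef N) (fun j => nu j) _
  (complex.Re z) (e / 2)) => //.
- by move=> w hw; apply: remainder_sumP; exact: hball.
- by apply: remainder_coef_bounded; apply: hball; rewrite addrC addKr ger0_norm// ltW.
- apply: remainder_coef_bounded; apply: hball.
  by rewrite addrC addKr normrN ger0_norm// ltW.
Qed.

Variable G : C -> C.
Hypotheses (G_meromorphic : forall (a : C) (p : C^o),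
    meromorphic_at (fun z => G (z + a)) p)
  (G_neg : forall z : C, complex.Re z < 0 ->
      has_sum (fun j : int => if 0 <= j then
        (nu j)%:C ^+ k * cexp ((nu j)%:C * z) else 0) (G z))
  (G_pos : forall z : C, 0 < complex.Re z ->
      has_sum (fun j : int => if j < 0 then
        (nu j)%:C ^+ k * cexp ((nu j)%:C * z) else 0) (- G z)).

(* Each of the [N] geometric steps produces the term that the series omits. *)
Definition omitted : C := if ratio 0 == 1 then (nu 0)%:C ^+ k else 0.

Definition partial_weier (N : nat) (z : C) : C :=
  \sum_(i < N) (theta ^- i * G (z + i%:R * om)) +
  \sum_(i < N) (theta ^+ i.+1 * G (z + - (i.+1%:R * om))) +
  remainder_sum N z - N%:R * omitted.

Lemma ratioX_cexp (N : nat) j z : theta ^- N * cexp ((nu j)%:C * (z + N%:R * om)) =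
  ratio j ^+ N * cexp ((nu j)%:C * z).
Proof.
rewrite mulrDr cexpD (mulrCA _ N%:R) cexpX /ratio (exprMn _ theta^-1) exprVn.
by rewrite -[RHS]mulrA; congr (_ * _); exact: mulrC.
Qed.

Lemma ratioV_cexp (N : nat) j z : theta ^+ N * cexp ((nu j)%:C * (z + - (N%:R * om))) =
  ratio j ^- N * cexp ((nu j)%:C * z).
Proof.
have rN := expf_neq0 N (ratio_neq0 j).
have tN := expf_neq0 N theta_neq0.
apply: (mulfI rN); rewrite [RHS]mulrA mulfV// mul1r.
rewrite mulrCA -ratioX_cexp mulrA mulfV// mul1r.
by rewrite subrK.
Qed.

(** With x = [ratio j], this is x^N / (1 - x) = x^N + x^(N+1) / (1 - x) for j >= 0 and x^-N / (1 -
    x) = - x^-(N+1) + x^-(N+1) / (1 - x) for j < 0. On strip [N] the arguments z + N om and z - (N +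
    1) om lie in the half-planes where [G] is given by the sums over j >= 0 and over j < 0
    respectively. *)
Lemma partial_weierS N z : in_strip N (complex.Re z) ->
  partial_weier N z = partial_weier N.+1 z.
Proof.
move=> hz; have [h1 h2] := andP hz.
have hz' : in_strip N.+1 (complex.Re z).
  by apply/andP; split; rewrite -natr1 mulrDl mul1r; have := T_gt0; lra.
have hG1 : complex.Re (z + N%:R * om) < 0.
  by rewrite raddfD/= -(rmorph_nat (real_complex R)) Re_realM; lra.
have hG2 : 0 < complex.Re (z + - (N.+1%:R * om)).
  by rewrite raddfD raddfN/= -(rmorph_nat (real_complex R)) Re_realM; lra.
have h : has_sum (fun j => remainder_coef N.+1 j * cexp ((nu j)%:C * z))
  (remainder_sum N z - theta ^- N * G (z + N%:R * om) +
   theta ^+ N.+1 * - G (z + - (N.+1%:R * om)) + omitted).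
  have := has_sumD (has_sumD (has_sumB (remainder_sumP hz)
    (has_sumZ (theta ^- N) (G_neg hG1))) (has_sumZ (theta ^+ N.+1) (G_pos hG2)))
    (has_sum_single (0 : int) omitted).
  apply: eq_has_sum => j.
  rewrite /remainder_coef; case: (leP 0 j) => j0; last first.
    have r1 : 1 - ratio j != 0.
      by rewrite subr_eq0; apply/eqP => /esym/ratio_eq1[j00 _]; rewrite j00 in j0.
    rewrite mulr0 subr0 lt_eqF// addr0 (mulrCA (theta ^+ _)) ratioV_cexp.
    have rN := expf_neq0 N (ratio_neq0 j); have r0 := ratio_neq0 j.
    by rewrite exprS; field; rewrite rN r0 r1.
  rewrite mulr0 addr0 (mulrCA (theta ^- _)) ratioX_cexp.
  have [r1|r1] := eqVneq (ratio j) 1.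
    (* Here both remainder coefficients are 0, since 1 / 0 = 0, while [G] contributes (nu 0)^k;
       [omitted] cancels it. *)
    have [j00 l0] := ratio_eq1 r1; rewrite j00 in r1 *.
    rewrite eqxx /omitted r1 eqxx subrr invr0 !mulr0 !mul0r sub0r.
    by rewrite expr1n mul1r l0 addr0 mul0r cexp0 mulr1 addNr.
  have -> : (if j == 0 then omitted else 0) = 0.
    by case: eqP => // j00; rewrite /omitted -j00 (negbTE r1).
  have r1' : 1 - ratio j != 0 by rewrite subr_eq0 eq_sym.
  by rewrite addr0 exprS; field.
have := has_sum_unique h (remainder_sumP hz').
rewrite /partial_weier !big_ord_recr/= => <-.
by rewrite -[in RHS]natr1; ring.
Qed.

Lemma partial_weier_le N N' z : (N <= N')%N -> in_strip N (complex.Re z) ->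
  partial_weier N z = partial_weier N' z.
Proof.
move=> /subnKC <-; elim: (N' - N)%N => [|d IHd] hz; first by rewrite addn0.
rewrite IHd// addnS partial_weierS//; have [h1 h2] := andP hz.
have T0 := T_gt0; apply/andP; split.
  by apply: le_lt_trans h1; rewrite lerN2 (ler_wpM2r (ltW T0))// ler_nat; lia.
by apply: (lt_le_trans h2); rewrite (ler_wpM2r (ltW T0))// ler_nat; lia.
Qed.

Lemma in_strip_truncn (u : R) : in_strip (Num.truncn (`|u| / T)).+1 u.
Proof.
have T0 := T_gt0; set N := (Num.truncn _).+1.
have : `|u| / T < N%:R by apply: real_truncnS_gt; exact: num_real.
rewrite ltr_pdivrMr// ltr_norml => /andP[h1 h2]; apply/andP; split => //.
by apply: le_lt_trans h1; rewrite lerN2 (ler_wpM2r (ltW T0))// ler_nat.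
Qed.

(** The number of steps is just large enough that |Re z| < N T; by [partial_weier_le] every
    admissible [N] gives the same value. *)
Definition weier (z : C) : C :=
  partial_weier (Num.truncn (`|complex.Re z| / T)).+1 z.

Lemma weierE N z : in_strip N (complex.Re z) -> weier z = partial_weier N z.
Proof.
move=> hz; rewrite /weier; set N' := (Num.truncn _).+1.
have hz' : in_strip N' (complex.Re z) := in_strip_truncn _.
by have [NN'|/ltnW N'N] := leqP N N'; [rewrite (partial_weier_le NN')|rewrite -(partial_weier_le N'N)].
Qed.

Lemma meromorphic_at_weier (p : C^o) : meromorphic_at weier p.
Proof.
set N := (Num.truncn (`|complex.Re p| / T)).+1.
have hp : in_strip N (complex.Re p) := in_strip_truncn _.
apply: (@eq_meromorphic_at _ (partial_weier N)).
  by apply: filterS (Re_near (in_strip_near hp)) => z /weierE ->.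
apply: meromorphic_atD; last exact: meromorphic_at_cst.
apply: meromorphic_atD; last exact: meromorphic_at_remainder.
apply: meromorphic_atD.
  apply: (@meromorphic_at_sum _ N (fun i z => theta ^- i * G (z + i%:R * om))) => i _.
  exact: meromorphic_atZ.
apply: (@meromorphic_at_sum _ N (fun i z => theta ^+ i.+1 * G (z + - (i.+1%:R * om)))) => i _.
exact: meromorphic_atZ.
Qed.

(* The omitted term is the one with [ratio j = 1], where [1 / 0 = 0]. *)
Lemma weier_has_sum z : complex.Re om < complex.Re z < 0 ->
  has_sum (fun j => (nu j)%:C ^+ k * cexp ((nu j)%:C * z) / (1 - ratio j)) (weier z).
Proof.
move=> /andP[h1 h2].
have hz : in_strip 0 (complex.Re z).
  by apply/andP; split; rewrite ?mul1r ?mul0r ?opprK.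
rewrite (weierE hz) /partial_weier !big_ord0 !add0r mul0r subr0.
apply: eq_has_sum (remainder_sumP hz) => j.
by rewrite /remainder_coef !expr0 invr1 if_same mulr1 mulrAC.
Qed.

(** The region lies in strip 1, where [G] enters at z and at z - om. Both have positive real part,
    so both are expanded over j < 0, and there -1 - x^-1 + x^-1 / (1 - x) = x / (1 - x). For j >= 0
    the remainder alone is x / (1 - x). *)
Lemma weier_has_sum_pos z : 0 < complex.Re z < - complex.Re om ->
  has_sum (fun j => (nu j)%:C ^+ k * cexp ((nu j)%:C * z) * (ratio j / (1 - ratio j)) -
    (if j == 0 then omitted else 0)) (weier z).
Proof.
move=> /andP[h1 h2].
have hz : in_strip 1 (complex.Re z).
  apply/andP; split; last by rewrite mul1r.
  by have := T_gt0; lra.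
have hz2 : 0 < complex.Re (z - om) by rewrite raddfB/=; have := T_gt0; lra.
rewrite (weierE hz) /partial_weier !big_ord1 mul0r addr0 mul1r expr0 invr1 mul1r mul1r expr1.
have := has_sumB (has_sumD (has_sumD (has_sumN (G_pos h1)) (has_sumZ theta (has_sumN (G_pos hz2))))
   (remainder_sumP hz)) (has_sum_single (0 : int) omitted).
rewrite !opprK; apply: eq_has_sum => j; congr (_ - _).
rewrite /remainder_coef; case: (leP 0 j) => j0.
  by rewrite oppr0 mulr0 !add0r expr1; ring.
have r1 : 1 - ratio j != 0.
  by rewrite subr_eq0; apply/eqP => /esym/ratio_eq1[j00 _]; rewrite j00 in j0.
have := ratioV_cexp 1 j z; rewrite !expr1 mul1r => hr.
rewrite mulrN (mulrCA theta) hr.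
have r0 := ratio_neq0 j.
by field; rewrite r0 r1.
Qed.

End Weierstrass.

(** * Coefficients in the region |q_z| > 1 > |q q_z| *)

Section Expansion.
Context {R : realType}.
Local Notation C := R[i].

(** For [e] = (x, y) this is the coefficient of q^y in w / (1 - w), where w = theta^-1 q^x, expanded
    in powers of w if x > 0 and of w^-1 if x < 0. For w = 1 the value -1 is minus the term that
    [omitted] accounts for. *)
Definition geometric_coef (theta : C) (e : R * R) : C :=
  let y := e.2 / e.1 in
  if e.1 == 0 then
    if e.2 == 0 then (if theta == 1 then -1 else theta^-1 / (1 - theta^-1)) else 0
  else if 0 < e.1 then
    if (y \is a Num.nat) && (0 < y) then theta ^- Num.truncn y else 0
  else if - y \is a Num.nat then - theta ^+ Num.truncn (- y) else 0.

(* The coefficient of e^(x z) q^y in the expansion of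
   (-1)^(k+1) k! P_(k+1)[theta; phi] on |q_z| > 1 > |q q_z|, for
   e = (x, y); the exponents that occur are y = x i with i > 0 when x > 0,
   y = - x i with i >= 0 when x < 0, and y = 0 when x = 0. *)
Definition expansion_coef (theta : C) (lam : R) (k : nat) (e : R * R) : C :=
  if e.1 - lam \is a Num.int then e.1%:C ^+ k * geometric_coef theta e else 0.

Section Sum.
Variables (theta om : C) (lam : R) (k : nat).
Hypotheses (theta1 : `|theta| = 1) (lam01 : 0 <= lam < 1).
Hypothesis (om_lt0 : complex.Re om < 0).
Local Notation nu j := (j%:~R + lam).
Local Notation T := (- complex.Re om).
Local Notation rt := (ratio theta om lam).

Definition zero_coef : C := if theta == 1 then -1 else theta^-1 / (1 - theta^-1).

(* [rt j / (1 - rt j)] is expanded in powers of [rt j] if [nu j > 0], and of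
   its inverse if [nu j < 0]. *)
Definition double_coef (p : int * nat) : C :=
  if nu p.1 == 0 then (if p.2 == 0%N then zero_coef else 0)
  else if 0 < nu p.1 then rt p.1 ^+ p.2.+1 else - rt p.1 ^- p.2.

Definition double_exponent (p : int * nat) : R * R :=
  (nu p.1, if 0 < nu p.1 then nu p.1 * p.2.+1%:R else - nu p.1 * p.2%:R).

Lemma nu_eq0 (j : int) : nu j = 0 -> j = 0 /\ lam = 0.
Proof.
case: (ltP j 0) => [/(nu_lt0 lam01) h1 h2|j0].
  by rewrite h2 ltxx in h1.
have /andP[l0 _] := lam01.
move=> /eqP; rewrite paddr_eq0 ?ler0z// => /andP[].
by rewrite intr_eq0 => /eqP -> /eqP ->.
Qed.

Lemma zero_coefE (j : int) : nu j = 0 ->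
  (nu j)%:C ^+ k * zero_coef = (nu j)%:C ^+ k * (rt j / (1 - rt j)) -
    (if j == 0 then omitted theta om lam k else 0).
Proof.
move=> nj0; have [j0 l0] := nu_eq0 nj0.
rewrite /omitted -j0 eqxx nj0.
have -> : rt j = theta^-1 by rewrite /ratio nj0 mul0r cexp0 mulr1.
rewrite /zero_coef invr_eq1; case: ifP => [/eqP ->|_]; last by rewrite subr0.
by rewrite invr1 subrr invr0 mulr0 mulr0 sub0r mulrN1.
Qed.

Lemma has_sum_double_coef (j : int) :
  has_sum (fun i => (nu j)%:C ^+ k * double_coef (j, i))
   ((nu j)%:C ^+ k * (rt j / (1 - rt j)) -
    (if j == 0 then omitted theta om lam k else 0)).
Proof.
have [nj0|nj0] := eqVneq (nu j) 0.
  rewrite -zero_coefE//; apply: has_sumZ.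
  by rewrite /double_coef/= nj0 eqxx; exact: has_sum_single.
have -> : (if j == 0 then omitted theta om lam k else 0) = 0.
  case: eqP => // j0; rewrite /omitted; case: eqP => // /(ratio_eq1 theta1 lam01 om_lt0)[_ l0].
  by rewrite j0 l0 addr0 eqxx in nj0.
rewrite subr0; apply: has_sumZ; rewrite /double_coef/= (negbTE nj0).
have r0 := ratio_neq0 om lam theta1 j.
have [n0|n0] := ltP 0 (nu j).
  have r1 : `|rt j| < 1.
    rewrite (norm_ratio _ _ theta1) -(rmorph1 (real_complex R)) ltcR expR_lt1.
    by rewrite oppr_lt0 mulr_gt0// oppr_gt0.
  by have := has_sumZ (rt j) (has_sum_geom r1); apply: eq_has_sum => i; rewrite exprS.
have r1 : `|(rt j)^-1| < 1.
  rewrite normfV (norm_ratioV _ _ theta1) -(rmorph1 (real_complex R)) ltcR expR_lt1.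
  by rewrite nmulr_rlt0 ?oppr_gt0// lt_neqAle nj0.
have := has_sumN (has_sum_geom r1).
have -> : - (1 - (rt j)^-1)^-1 = rt j / (1 - rt j).
  have rr : rt j - 1 != 0.
    rewrite subr_eq0; apply/eqP => /(ratio_eq1 theta1 lam01 om_lt0)[j0 l0].
    by rewrite j0 l0 addr0 eqxx in nj0.
  have rr' : 1 - rt j != 0 by rewrite -opprB oppr_eq0.
  by field; rewrite r0 rr rr'.
by apply: eq_has_sum => i; rewrite exprVn.
Qed.

Lemma double_coef_bounded (z : C) : 0 < complex.Re z < T ->
  abs_bounded (fun p : int * nat =>
    (nu p.1)%:C ^+ k * double_coef p * cexp ((nu p.1)%:C * z)).
Proof.
move=> /andP[z0 zT].
have T0 : 0 < T by rewrite oppr_gt0.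
(* The norms of the terms are powers of [rho] = |rt j| or of its inverse, and [rho] is itself a
   ratio, for theta = 1 and the real exponent Re om. The bound is therefore taken at these
   parameters; [L] covers the index with [nu j] = 0. *)
have [K K0 hK] := @ratio_inv_bound R 1 (complex.Re om)%:C lam (normr1 _) lam01 om_lt0.
have [L L0 hL] := norm_realP zero_coef.
pose g (j : int) : C := ((K + L) * `|nu j| ^+ k *
  (if 0 <= j then expR (- (nu j * T)) else 1) * expR (nu j * complex.Re z))%:C.
apply: (@abs_bounded_pair _ _ _ _ g) => [j Y|]; last first.
  apply: (@abs_bounded_int _ _ lam (K + L) (Num.min (complex.Re z) (T - complex.Re z)) k) => //.
  - by rewrite lt_min z0 subr_gt0.
  - exact: addr_ge0.
  move=> j; rewrite /g normcR lecR.
  have KL : 0 <= K + L by exact: addr_ge0.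
  set s := Num.min _ _.
  have s1 : s <= complex.Re z by rewrite ge_min lexx.
  have s2 : s <= T - complex.Re z by rewrite ge_min lexx orbT.
  rewrite ger0_norm; last first.
    by rewrite !mulr_ge0 ?exprn_ge0 ?expR_ge0//; case: ifP; rewrite ?expR_ge0.
  rewrite -[leLHS]mulrA ler_wpM2l ?mulr_ge0 ?exprn_ge0//.
  case: ifP => [/(nu_ge0 lam01) n0|/negbT]; last first.
    rewrite -ltNge => /(nu_lt0 lam01) n0.
    by rewrite mul1r ler_expR (ltr0_norm n0); nra.
  by rewrite -expRD ler_expR (ger0_norm n0); nra.
have normE p : `|(nu p.1)%:C ^+ k * double_coef p * cexp ((nu p.1)%:C * z)| =
    (`|nu p.1| ^+ k * expR (nu p.1 * complex.Re z))%:C * `|double_coef p|.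
  by rewrite normrM norm_cexp Re_realM normrM normrX normcR -rmorphXn mulrAC rmorphM.
rewrite (eq_bigr (fun i => (`|nu j| ^+ k * expR (nu j * complex.Re z))%:C *
  `|double_coef (j, i)|)); last by move=> i _; exact: (normE (j, i)).
rewrite -mulr_sumr /g.
have -> : ((K + L) * `|nu j| ^+ k * (if 0 <= j then expR (- (nu j * T)) else 1) *
    expR (nu j * complex.Re z))%:C = (`|nu j| ^+ k * expR (nu j * complex.Re z))%:C *
   ((K + L) * (if 0 <= j then expR (- (nu j * T)) else 1))%:C.
  by rewrite -rmorphM/=; congr _%:C; ring.
apply: ler_wpM2l; first by rewrite ler0c mulr_ge0 ?exprn_ge0 ?expR_ge0.
pose rho := expR (- (nu j * T)).
have rho_gt0 : 0 < rho by exact: expR_gt0.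
have hKj : `|(1 - rho)^-1| <= K * (if 0 <= j then 1 else rho^-1).
  have := hK j; rewrite /ratio invr1 mul1r.
  have -> : cexp ((nu j)%:C * (complex.Re om)%:C) = rho%:C.
    rewrite -rmorphM /cexp/= cos0 sin0 -[_ +i* _]/((1 : R)%:C) rmorph1 mulr1.
    by rewrite /rho mulrN opprK.
  by rewrite -(rmorph1 (real_complex R)) -rmorphB -fmorphV normcR lecR /rho expRN invrK.
have [nj0|nj0] := eqVneq (nu j) 0.
  have [j0 l0] := nu_eq0 nj0.
  have -> : \sum_(i <- Y) `|double_coef (j, i)| = L%:C * \sum_(i <- Y) `|(0 ^+ i)%:C|.
    rewrite mulr_sumr; apply: eq_bigr => i _; rewrite /double_coef/= nj0 eqxx expr0n.
    by case: eqP => _; rewrite ?hL ?normr1 ?mulr1// !normr0 mulr0.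
  have -> : (0 <= j) = true by rewrite j0.
  rewrite -/rho (_ : rho = 1); last by rewrite /rho nj0 mul0r oppr0 expR0.
  have Y1 : \sum_(i <- Y) `|(0 ^+ i)%:C| <= 1 :> C.
    by have := @sum_geom_le R 0 Y; rewrite lexx ltr01 subr0 invr1; exact.
  apply: le_trans (ler_wpM2l _ Y1) _; first by rewrite ler0c.
  by rewrite !mulr1 lecR lerDr.
have [n0|n0] := ltP 0 (nu j).
  have rho1 : rho < 1 by rewrite expR_lt1 oppr_lt0 mulr_gt0.
  have jp : 0 <= j by rewrite leNgt; apply/negP => /(nu_lt0 lam01); rewrite ltNge (ltW n0).
  rewrite jp -/rho in hKj *.
  have -> : \sum_(i <- Y) `|double_coef (j, i)| = rho%:C * \sum_(i <- Y) `|(rho ^+ i)%:C|.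
    rewrite mulr_sumr; apply: eq_bigr => i _; rewrite /double_coef/= (negbTE nj0) n0.
    by rewrite normrX (norm_ratio _ _ theta1) -/rho normcR ger0_norm ?exprn_ge0 ?ltW// exprS rmorphXn.
  have rho01 : 0 <= rho < 1 by rewrite rho1 ltW.
  apply: le_trans (_ : rho%:C * ((1 - rho)^-1)%:C <= _).
    by rewrite ler_wpM2l ?sum_geom_le// ler0c ltW.
  rewrite -rmorphM lecR mulrC (ler_wpM2r (ltW rho_gt0))//.
  have := ler_norm (1 - rho)^-1; lra.
have {}n0 : nu j < 0 by rewrite lt_neqAle nj0.
have rho1 : rho^-1 < 1 by rewrite invf_lt1// -expR0 ltr_expR oppr_gt0 nmulr_rlt0.
have jn : (0 <= j) = false.
  by apply/negP => /(nu_ge0 lam01); rewrite leNgt n0.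
rewrite jn mulr1 in hKj *.
have -> : \sum_(i <- Y) `|double_coef (j, i)| = \sum_(i <- Y) `|(rho^-1 ^+ i)%:C|.
  apply: eq_bigr => i _; rewrite /double_coef/= (negbTE nj0) (ltNge 0) (ltW n0)/=.
  rewrite normrN normfV normrX (norm_ratio _ _ theta1) -/rho normcR.
  by rewrite ger0_norm ?exprn_ge0 ?invr_ge0 ?ltW// exprVn fmorphV rmorphXn.
have rho01 : 0 <= rho^-1 < 1 by rewrite rho1 invr_ge0 ltW.
apply: le_trans (sum_geom_le Y rho01) _.
rewrite lecR; apply: le_trans (_ : K <= _); last by rewrite lerDl.
have rho2 : 1 - rho < 0 by rewrite subr_lt0; move: rho1; rewrite invf_lt1.
move: hKj; rewrite normfV ltr0_norm// -ler_pdivrMr ?invr_gt0// invrK.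
apply: le_trans; rewrite le_eqVlt; apply/orP; left; apply/eqP.
have h1 : rho != 0 by rewrite gt_eqF.
have h2 : rho - 1 != 0 by rewrite -opprB oppr_eq0 lt_eqF.
have h3 : 1 - rho != 0 by rewrite lt_eqF.
by field; rewrite h1 h2 h3.
Qed.

Lemma has_sum_expansion (z s : C) : 0 < complex.Re z < T ->
  has_sum (fun j => (nu j)%:C ^+ k * cexp ((nu j)%:C * z) * (rt j / (1 - rt j)) -
    (if j == 0 then omitted theta om lam k else 0)) s ->
  has_sum (fun e : R * R => expansion_coef theta lam k e * cexp (e.1%:C * z) *
    cexp (e.2%:C * om)) s.
Proof.
move=> hz hs.
have hd : has_sum (fun p : int * nat =>
    (nu p.1)%:C ^+ k * double_coef p * cexp ((nu p.1)%:C * z)) s.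
  apply: (has_sum_pair (double_coef_bounded hz) _ hs) => j.
  have := has_sumZ (cexp ((nu j)%:C * z)) (has_sum_double_coef j).
  have -> : cexp ((nu j)%:C * z) * ((nu j)%:C ^+ k * (rt j / (1 - rt j)) -
      (if j == 0 then omitted theta om lam k else 0)) =
    (nu j)%:C ^+ k * cexp ((nu j)%:C * z) * (rt j / (1 - rt j)) -
      (if j == 0 then omitted theta om lam k else 0).
    have -> : cexp ((nu j)%:C * z) * ((nu j)%:C ^+ k * (rt j / (1 - rt j)) -
        (if j == 0 then omitted theta om lam k else 0)) =
      (nu j)%:C ^+ k * cexp ((nu j)%:C * z) * (rt j / (1 - rt j)) -
        cexp ((nu j)%:C * z) * (if j == 0 then omitted theta om lam k else 0).
      by rewrite mulrBr mulrCA mulrA.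
    congr (_ - _); case: (eqVneq j 0) => [j0|_]; last by rewrite mulr0.
    rewrite /omitted; case: (eqVneq (rt 0) 1) => [/(ratio_eq1 theta1 lam01 om_lt0)[_ l0]|_]; last by rewrite mulr0.
    by rewrite j0 l0 addr0 mul0r cexp0 mul1r.
  by apply: eq_has_sum => i; rewrite mulrC.
have nuI : injective (fun j : int => nu j).
  by move=> j j' /addIr/eqP; rewrite eqr_int => /eqP.
have int_nu j : nu j - lam \is a Num.int by rewrite addrK intr_int.
have exponentE j i : 0 < nu j -> (nu j * i.+1%:R) / nu j = i.+1%:R :> R.
  by move=> n0; rewrite mulrAC divff ?mul1r// gt_eqF.
have exponentNE j i : nu j < 0 -> - (- nu j * i%:R / nu j) = i%:R :> R.
  by move=> n0; rewrite mulNr mulNr opprK mulrAC divff ?mul1r// lt_eqF.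
(* [double_exponent] is injective only on the support: for [nu j] = 0 all i share the exponent (0,
   0), but only i = 0 has a nonzero coefficient. *)
apply: (has_sum_transfer (h := double_exponent) _ _ _ hd).
- move=> [j i] [j' i']; rewrite !mulf_eq0 !negb_or /= => /andP[/andP[_ h1] _] /andP[/andP[_ h2] _].
  rewrite /double_exponent/= => -[/nuI jj]; rewrite -jj in h2 *.
  move: h1 h2; rewrite /double_coef/=; case: (eqVneq (nu j) 0) => [nj0|nj0].
    case: (eqVneq i 0%N) => [->|]; last by rewrite eqxx.
    case: (eqVneq i' 0%N) => [->//|]; last by rewrite eqxx.
  case: ifP => n0 _ _.
    by move=> /(mulfI nj0)/eqP; rewrite eqr_nat eqSS => /eqP ->.
  have nj0' : - nu j != 0 by rewrite oppr_eq0.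
  by move=> /(mulfI nj0')/eqP; rewrite eqr_nat => /eqP ->.
- move=> [j i]; rewrite /= !mulf_eq0 !negb_or /= => /andP[/andP[_ h1] _].
  rewrite mulrAC; congr (_ * _).
  rewrite /expansion_coef /geometric_coef/= int_nu -mulrA; congr (_ * _).
  move: h1; rewrite /double_coef/=; case: (eqVneq (nu j) 0) => [nj0|nj0].
    case: (eqVneq i 0%N) => [_ _|_]; last by rewrite eqxx.
    by rewrite nj0 ltxx oppr0 mul0r eqxx mul0r cexp0 mulr1.
  case: (ltP 0 (nu j)) => n0 _.
    rewrite exponentE// natr_nat ltr0n/= natrK /ratio (exprMn _ theta^-1) exprVn.
    by rewrite rmorphM rmorph_nat mulrAC mulrC -mulrA (mulrC om) mulrC -cexpX; congr (_ * cexp _); ring.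
  have {}n0 : nu j < 0 by rewrite lt_neqAle nj0.
  rewrite exponentNE// natr_nat natrK /ratio (exprMn _ theta^-1) exprVn.
  rewrite invfM invrK mulNr; congr (- (_ * _)).
  rewrite -exprVn -cexpN -cexpX rmorphM rmorphN rmorph_nat; congr cexp; ring.
move=> [x y]; rewrite /= !mulf_eq0 !negb_or /= => /andP[/andP[h1 _] _].
move: h1; rewrite /expansion_coef /geometric_coef/=; case: ifP; last by rewrite eqxx.
move=> /intrP[j xj]; have {xj} -> : x = nu j by rewrite -xj subrK.
rewrite mulf_eq0 negb_or => /andP[nuk].
have hE i : double_coef (j, i) != 0 ->
   (nu (j, i).1)%:C ^+ k * double_coef (j, i) * cexp ((nu (j, i).1)%:C * z) != 0.
  by move=> d0; apply: mulf_neq0 (cexp_neq0 _); exact: mulf_neq0.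
have r0 := ratio_neq0 om lam theta1 j.
case: (eqVneq (nu j) 0) => [nj0|nj0].
  case: (eqVneq y 0) => [->|]; last by rewrite eqxx.
  move=> c0; exists (j, 0%N); last by rewrite /double_exponent/= nj0 ltxx oppr0 mul0r.
  by apply: hE; rewrite /double_coef/= nj0 eqxx.
case: (ltP 0 (nu j)) => n0.
  case: ifP => [/andP[/natrP[[|i] yi]]|]; last by rewrite eqxx.
    by rewrite yi ltxx.
  move=> _ _; exists (j, i).
    by apply: hE; rewrite /double_coef/= (negbTE nj0) n0 expf_neq0.
  by rewrite /double_exponent/= n0 -yi mulrC divfK.
have {}n0 : nu j < 0 by rewrite lt_neqAle nj0.
case: ifP => [/natrP[i yi]|]; last by rewrite eqxx.
move=> _; exists (j, i).
  apply: hE; rewrite /double_coef/= (negbTE nj0) ltNge (ltW n0)/=.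
  by rewrite oppr_eq0 invr_eq0 expf_neq0.
by rewrite /double_exponent/= ltNge (ltW n0)/= -yi mulrNN mulrC divfK.
Qed.

End Sum.

Lemma exists_weierstrass_expansion (theta phi : C) (lam : R) (k : nat) :
  `|theta| = 1 -> 0 <= lam < 1 -> phi = cexp (twopii * lam%:C) ->
  is_weierstrass_expansion theta phi lam k.+1
    (fun e => (-1) ^+ k.+1 / k`!%:R * expansion_coef theta lam k e).
Proof.
move=> theta1 lam01 hphi tau tau0.
pose om := twopii * tau.
have om_lt0 : complex.Re om < 0.
  rewrite /om; case: (tau) tau0 => a b /= b0.
  by rewrite mul0r sub0r oppr_lt0 mulr_gt0// mulr_gt0 ?pi_gt0.
have qpowE x : qpow tau x = cexp (x%:C * om).
  by rewrite /qpow /om; congr cexp; rewrite mulrAC mulrC.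
have norm_q : `|qpow tau 1| = (expR (complex.Re om))%:C.
  by rewrite qpowE rmorph1 mul1r norm_cexp.
have [G [G_mero G_neg G_pos]] := exists_eulerian lam01 k.
pose P z := (-1) ^+ k.+1 / k`!%:R * weier theta om lam k G z.
exists P; split; first split.
- move=> p; apply: meromorphic_atZ.
  exact: meromorphic_at_weier.
- move=> z; rewrite norm_q norm_cexp ltcR ltcR1 expR_lt1 ltr_expR => hz.
  have := has_sumZ ((-1) ^+ k.+1 / k`!%:R) (weier_has_sum theta1 lam01 om_lt0 G_neg G_pos hz).
  apply: eq_has_sum => j; rewrite /weier_term/=; congr (_ * _).
  rewrite qpowE -/(ratio theta om lam j); case: ifP => // /and3P[nj0 /eqP th1 _].
  have -> : ratio theta om lam j = 1.
    by rewrite /ratio (eqP nj0) mul0r cexp0 th1 invr1 mulr1.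
  by rewrite subrr invr0 mulr0.
- move=> z; rewrite normrM norm_q norm_cexp -rmorphM ltcR1 ltc1R -expRD.
  rewrite expR_lt1 expR_gt1 => /andP[h1 h2].
  have hz : 0 < complex.Re z < - complex.Re om by rewrite h2; lra.
  have := has_sumZ ((-1) ^+ k.+1 / k`!%:R) (has_sum_expansion theta1 lam01 om_lt0 hz
    (weier_has_sum_pos theta1 lam01 om_lt0 G_neg G_pos hz)).
  by apply: eq_has_sum => e; rewrite qpowE !mulrA.
Qed.

End Expansion.

(** * Square bracket modes as residues *)

Section FormalPowerSeries.
Context {R : realType}.
Local Notation C := R[i].
Implicit Types (f g h u : @fps R).

Definition fps_trunc (N : nat) f : {poly C} := \poly_(i < N) f i.

(** A coefficient of a product depends on finitely many coefficients of the factors, so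
    commutativity, associativity and the Leibniz rule are inherited from polynomials. *)
Lemma fps_mulE N f g n : (n < N)%N ->
  fps_mul f g n = (fps_trunc N f * fps_trunc N g)`_n.
Proof.
move=> nN; rewrite coefM; apply: eq_bigr => -[i /= i_n] _.
by rewrite !coef_poly (leq_ltn_trans _ nN)// (leq_ltn_trans _ nN)// leq_subr.
Qed.

Lemma fps_mulC f g : fps_mul f g = fps_mul g f.
Proof. by apply/funext => n; rewrite !(@fps_mulE n.+1)// mulrC. Qed.

Lemma fps_mulA f g h : fps_mul f (fps_mul g h) = fps_mul (fps_mul f g) h.
Proof.
apply/funext => n.
transitivity ((fps_trunc n.+1 f * (fps_trunc n.+1 g * fps_trunc n.+1 h))`_n).
  rewrite coefM; apply: eq_bigr => -[i /= i_n] _.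
  by rewrite (@fps_mulE n.+1) ?coef_poly ?i_n// ltnS leq_subr.
rewrite mulrA coefM; apply: eq_bigr => -[i /= i_n] _.
by rewrite (@fps_mulE n.+1)// [(fps_trunc _ h)`__]coef_poly ltnS leq_subr.
Qed.

Lemma fps_mulDl f g h :
  fps_mul (fun n => f n + g n) h = fun n => fps_mul f h n + fps_mul g h n.
Proof.
apply/funext => n; rewrite /fps_mul -big_split.
by apply: eq_bigr => i _; rewrite mulrDl.
Qed.

Lemma fps_mulBl f g h :
  fps_mul (fun n => f n - g n) h = fun n => fps_mul f h n - fps_mul g h n.
Proof.
apply/funext => n; rewrite /fps_mul -sumrB.
by apply: eq_bigr => i _; rewrite mulrBl.
Qed.

Lemma fps_mulZl (a : C) f h :
  fps_mul (fun n => a * f n) h = fun n => a * fps_mul f h n.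
Proof.
apply/funext => n; rewrite /fps_mul mulr_sumr.
by apply: eq_bigr => i _; rewrite mulrA.
Qed.

Lemma fps_mul1 f : fps_mul fps_one f = f.
Proof.
apply/funext => n; rewrite /fps_mul big_ord_recl/= /fps_one eqxx mul1r subn0.
by rewrite big1 ?addr0// => i _; rewrite mul0r.
Qed.

Lemma fps_powS f k : fps_pow f k.+1 = fps_mul f (fps_pow f k).
Proof. by []. Qed.

Lemma fps_pow_eq0 u k n : u 0%N = 0 -> (n < k)%N -> fps_pow u k n = 0.
Proof.
move=> u0; elim: k n => // k IHk n nk; rewrite fps_powS /fps_mul big1// => i _.
have [i0|i0] := posnP i; first by rewrite i0 u0 mul0r.
rewrite IHk ?mulr0//; case: i i0 => [] [|i] //= hi _; lia.
Qed.

Lemma fps_mulV f : f 0%N = 1 -> fps_mul f (fps_inv f) = fps_one.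
Proof.
move=> f0; pose u := fun i => fps_one i - f i.
have u0 : u 0%N = 0 by rewrite /u f0 subrr.
apply/funext => n.
(* [fps_inv] cuts the geometric series at a bound that depends on the coefficient. As [u] has no
   constant term, u^j starts in degree j, so all coefficients up to n can use the same cut and the
   sum telescopes. *)
have invE i : (i <= n)%N -> fps_inv f i = \sum_(j < n.+1) fps_pow u j i.
  move=> i_n; rewrite /fps_inv -!(big_mkord predT (fun j => fps_pow u j i)).
  rewrite (@big_cat_nat _ _ _ i.+1 0 n.+1)//= [X in _ + X]big_nat [X in _ + X]big1 ?addr0// => j /andP[ij _].
  exact: fps_pow_eq0.
rewrite /fps_mul.
under eq_bigr => i _ do rewrite invE ?leq_subr// mulr_sumr.
rewrite exchange_big/=.
have step j : \sum_(i < n.+1) f i * fps_pow u j (n - i)%N =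
    fps_pow u j n - fps_pow u j.+1 n.
  rewrite -/(fps_mul f (fps_pow u j) n).
  have -> : f = fun i => fps_one i - u i by apply/funext => i; rewrite subKr.
  by rewrite fps_mulBl fps_mul1.
under eq_bigr => j _ do rewrite step.
rewrite -(big_mkord predT (fun j => fps_pow u j n - fps_pow u j.+1 n)).
under eq_bigr do rewrite -opprB; rewrite sumrN telescope_sumr//.
by rewrite (@fps_pow_eq0 u n.+1)// sub0r opprK.
Qed.

Definition fps_deriv f : @fps R := fun n => n.+1%:R * f n.+1.

Lemma fps_derivM f g : fps_deriv (fps_mul f g) =
  fun n => fps_mul (fps_deriv f) g n + fps_mul f (fps_deriv g) n.
Proof.
apply/funext => n; rewrite /fps_deriv (@fps_mulE n.+2)//.
rewrite mulr_natl -coef_deriv derivM coefD !coefM; congr (_ + _).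
  apply: eq_bigr => -[i /= i_n] _; rewrite coef_deriv !coef_poly ltnS i_n.
  by rewrite mulr_natl (leq_ltn_trans (leq_subr _ _))// ltnS leqnSn.
apply: eq_bigr => -[i /= i_n] _; rewrite coef_deriv !coef_poly.
by rewrite mulr_natl (leq_trans i_n (leqnSn _)) !ltnS leq_subr.
Qed.

Definition fps_shift f : @fps R := fun n => if n is n'.+1 then f n' else 0.

Lemma fps_shiftM f g : fps_mul (fps_shift f) g = fps_shift (fps_mul f g).
Proof.
apply/funext => -[|n]; first by rewrite /fps_mul big_ord1 mul0r.
by rewrite /fps_mul big_ord_recl/= mul0r add0r; apply: eq_bigr => i _.
Qed.

Lemma fps_exp0 (a : C) : fps_exp a 0%N = 1.
Proof. by rewrite /fps_exp expr0 fact0 divr1. Qed.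

Lemma fps_expD (a b : C) : fps_mul (fps_exp a) (fps_exp b) = fps_exp (a + b).
Proof.
apply/funext => n; rewrite /fps_mul /fps_exp exprDn_comm; last exact: mulrC.
rewrite mulr_suml (reindex_inj rev_ord_inj)/=; apply: eq_bigr => -[i i_n] _ /=.
rewrite subSS subKn// -mulr_natr.
have : ('C(n, i) * (i`! * (n - i)`!))%:R = n`!%:R :> C by rewrite bin_fact.
rewrite !natrM => <-.
have f1 : i`!%:R != 0 :> C by rewrite pnatr_eq0 -lt0n fact_gt0.
have f2 : (n - i)`!%:R != 0 :> C by rewrite pnatr_eq0 -lt0n fact_gt0.
have f3 : 'C(n, i)%:R != 0 :> C by rewrite pnatr_eq0 -lt0n bin_gt0.
by field; rewrite f1 f2 f3.
Qed.

Local Notation E := (@fps_expm1 R).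
Local Notation I := (fps_inv E).

Lemma expm1_shift : fps_shift E = fun n => fps_exp 1 n - fps_one n.
Proof.
apply/funext => -[|n]; rewrite /fps_shift /fps_exp /fps_one /fps_expm1/=.
  by rewrite expr0 fact0 divr1 subrr.
by rewrite expr1n subr0 mul1r.
Qed.

Lemma expm1V : fps_mul E I = fps_one.
Proof. by apply: fps_mulV; rewrite /fps_expm1 invr1. Qed.

Lemma fps_deriv_one : fps_deriv fps_one = fun=> 0 :> C.
Proof. by apply/funext => n; rewrite /fps_deriv /fps_one mulr0. Qed.

Lemma deriv_expm1V :
  fps_deriv I = fun n => (-1) * fps_mul (fps_deriv E) (fps_mul I I) n.
Proof.
have h0 : (fun n => fps_mul (fps_deriv E) I n + fps_mul E (fps_deriv I) n) =
    (fun=> 0 : C).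
  by rewrite -fps_derivM expm1V fps_deriv_one.
apply/funext => n; have := congr1 (fun f => fps_mul f I n) h0.
rewrite fps_mulDl -fps_mulA -(fps_mulA E) [fps_mul (fps_deriv I) I]fps_mulC.
rewrite (fps_mulA E I) expm1V fps_mul1 => h1.
have {}h1 : fps_mul (fps_deriv E) (fps_mul I I) n + fps_deriv I n = 0.
  by rewrite h1 /fps_mul big1// => i _; rewrite mul0r.
by rewrite mulN1r; apply/eqP; rewrite -addr_eq0 addrC h1.
Qed.

Lemma deriv_expm1V_pow k : fps_deriv (fps_pow I k) =
  fun n => - k%:R * fps_mul (fps_deriv E) (fps_pow I k.+1) n.
Proof.
elim: k => [|k IHk].
  by rewrite fps_deriv_one; apply/funext => n; rewrite oppr0 mul0r.
rewrite fps_powS fps_derivM deriv_expm1V IHk; apply/funext => n.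
set Q := fps_mul (fps_deriv E) (fps_pow I k.+1).
rewrite (fps_mulZl (-1) (fps_mul (fps_deriv E) (fps_mul I I))).
rewrite (fps_mulC I (fun n0 => - k%:R * Q n0)) (fps_mulZl (- k%:R) Q).
have -> : fps_mul Q I = fps_mul (fps_deriv E) (fps_pow I k.+2).
  by rewrite /Q -fps_mulA [fps_mul _ I]fps_mulC.
by rewrite -!fps_mulA -natr1; ring.
Qed.

Lemma exp1_expm1 : fps_exp 1 = fun n => E n + fps_shift (fps_deriv E) n.
Proof.
apply/funext => -[|n]; rewrite /fps_exp /fps_shift /fps_deriv /fps_expm1.
  by rewrite expr0 fact0 addr0 divr1 invr1.
have f0 : n.+1%:R + 1 != 0 :> C by rewrite natr1 pnatr_eq0.
have f1 : n.+1`!%:R != 0 :> C by rewrite pnatr_eq0 -lt0n fact_gt0.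
rewrite expr1n (factS n.+1) natrM -natr1.
by move: (n.+1%:R : C) f0 => x f0; field; rewrite f1 f0.
Qed.

Lemma expm1V_powS k : fps_mul E (fps_pow I k.+1) = fps_pow I k.
Proof. by rewrite fps_powS fps_mulA expm1V fps_mul1. Qed.

(* e^z = (z E)' = E + z E', and E' E^(-k-1) = - (E^(-k))' / k. *)
Lemma exp1_expm1V_pow k :
  fps_mul (fps_exp 1) (fps_pow I k.+2) k.+1 = 0.
Proof.
rewrite exp1_expm1 fps_mulDl expm1V_powS fps_shiftM /fps_shift.
have := congr1 (fun f => f k) (deriv_expm1V_pow k.+1); rewrite /fps_deriv.
have k0 : k.+1%:R != 0 :> C by rewrite pnatr_eq0.
rewrite mulNr -mulrN => /(mulfI k0) ->.
by rewrite addNr.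
Qed.

(** The residue at z = 0 of e^((h+1) z) (e^z - 1)^(-k-1): with the pole z^(-k-1) factored out it
    becomes the coefficient of z^k. *)
Definition res_coef (h : C) (k : nat) : C :=
  fps_mul (fps_exp (h + 1)) (fps_pow I k.+1) k.

Lemma res_coef0 (a : C) : res_coef a 0 = 1.
Proof.
by rewrite /res_coef /fps_mul big_ord1 fps_exp0 mul1r subn0 fps_powS /fps_mul
  big_ord1 /fps_pow/= /fps_one mulr1 /fps_inv big_ord1.
Qed.

(** Pascal's rule comes from e^((h+1) z) = e^(h z) + (e^z - 1) e^(h z): the second summand lowers
    the order of the pole by one. *)
Lemma res_coefS (h : C) k :
  res_coef h k.+1 = res_coef (h - 1) k.+1 + res_coef (h - 1) k.
Proof.
rewrite /res_coef subrK.
have -> : fps_exp (h + 1) = fun n => fps_exp h n + fps_mul (fps_shift E) (fps_exp h) n.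
  rewrite -fps_expD [fps_mul (fps_exp h) _]fps_mulC.
  apply/funext => n; rewrite expm1_shift fps_mulBl fps_mul1.
  by rewrite addrCA subrr addr0.
rewrite fps_mulDl fps_shiftM fps_shiftM; congr (_ + _).
rewrite /fps_shift [fps_mul E _]fps_mulC -fps_mulA.
by rewrite expm1V_powS.
Qed.

Lemma gbin0 (m : int) : @gbin R m 0 = 1.
Proof. by rewrite /gbin big_ord0 fact0 divr1. Qed.

Lemma gbinS (m : int) k :
  @gbin R m k.+1 = gbin (m - 1) k.+1 + gbin (m - 1) k.
Proof.
rewrite /gbin; set P := \prod_(j < k) ((m - 1)%:~R - j%:R) : C.
have -> : \prod_(j < k.+1) (m%:~R - j%:R) = m%:~R * P :> C.
  rewrite big_ord_recl/= subr0; congr (_ * _); apply: eq_bigr => i _.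
  by rewrite /bump/= natrD intrB/=; ring.
rewrite big_ord_recr/= -/P intrB factS natrM.
have f0 : k.+1%:R != 0 :> C by rewrite pnatr_eq0.
have f1 : k`!%:R != 0 :> C by rewrite pnatr_eq0 -lt0n fact_gt0.
move: f0; rewrite -natr1 => f0.
by field; rewrite f0 f1.
Qed.

Lemma gbin0S k : @gbin R 0 k.+1 = 0.
Proof. by rewrite /gbin big_ord_recl subr0 !mul0r. Qed.

(* Both sides satisfy Pascal's rule and agree at m = 0. *)
Lemma res_coefE (m : int) k : res_coef m%:~R k = gbin m k.
Proof.
elim: k m => [m|k IHk m]; first by rewrite res_coef0 gbin0.
elim/int_ind: m => [|m IHm|m IHm].
- rewrite gbin0S /res_coef add0r; exact: exp1_expm1V_pow.
- rewrite res_coefS gbinS; have -> : (m.+1%:Z)%:~R - 1 = (m%:Z)%:~R :> C.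
    by rewrite -[_.+1%:~R]/(m.+1%:R) -natr1 addrK.
  have -> : m.+1%:Z - 1 = m%:Z by lia.
  by rewrite IHm IHk.
have := res_coefS (- m%:Z)%:~R k; rewrite IHm gbinS.
have -> : (- m%:Z)%:~R - 1 = (- m.+1%:Z)%:~R :> C.
  by rewrite !intrN -opprD -[_.+1%:~R]/(m.+1%:R) -natr1.
have -> : - m%:Z - 1 = - m.+1%:Z by lia.
by rewrite IHk => /addIr.
Qed.

(** The sum is a coefficient of e^(-x z) times e^(al z) (e^z - 1)^(-k-1), and al - x = m + 1 is the
    exponent in the residue [res_coef m k]. The terms with j > k are 0, so any cut beyond [k] will
    do. *)
Lemma sum_sq_coef (al x : R) (m : int) (k K : nat) :
  m%:~R = al - 1 - x -> (k < K)%N ->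
  \sum_(j < K) ((- x)%:C ^+ j / j`!%:R) * sq_coef al k j = gbin m k.
Proof.
move=> mE kK; rewrite -res_coefE /res_coef.
have -> : m%:~R + 1 = (- x)%:C + al%:C :> C.
  have -> : m%:~R = (m%:~R)%:C :> C by rewrite rmorph_int.
  rewrite mE -(rmorph1 (real_complex R)) -!rmorphD; congr _%:C; ring.
rewrite -fps_expD -fps_mulA {1}/fps_mul.
rewrite -(big_mkord predT (fun j => (- x)%:C ^+ j / j`!%:R * sq_coef al k j)).
rewrite -(big_mkord predT (fun j => fps_exp (- x)%:C j *
  fps_mul (fps_exp al%:C) (fps_pow I k.+1) (k - j)%N)).
rewrite (@big_cat_nat _ _ _ k.+1 0 K)//= [X in _ + X]big_nat [X in _ + X]big1 ?addr0.
  apply: eq_big_nat => j /andP[_ jk]; congr (_ * _); rewrite /sq_coef.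
  have -> : k%:Z - j%:Z = (k - j)%N%:Z by lia.
  by have -> : - k%:Z - 1 = Negz k by lia.
move=> j /andP[kj _]; rewrite /sq_coef.
by have [d ->] : exists d, k%:Z - j%:Z = Negz d; [exists (j - k).-1; lia|rewrite mulr0].
Qed.

End FormalPowerSeries.

(** * Eigenspaces and traces *)

Section LinearMaps.
Context {R : realType}.
Local Notation C := R[i].
Variables (U W : lmodType C) (f : U -> W).
Hypothesis f_linear : linear f.

Lemma lin_add u v : f (u + v) = f u + f v.
Proof. by have := f_linear 1 u v; rewrite !scale1r. Qed.

Lemma lin_zero : f 0 = 0.
Proof. by apply: (addIr (f 0)); rewrite -lin_add !add0r. Qed.

Lemma lin_scale a u : f (a *: u) = a *: f u.
Proof. by have := f_linear a u 0; rewrite !addr0 lin_zero addr0. Qed.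

Lemma lin_opp u : f (- u) = - f u.
Proof. by rewrite -scaleN1r lin_scale scaleN1r. Qed.

Lemma lin_sub u v : f (u - v) = f u - f v.
Proof. by rewrite lin_add lin_opp. Qed.

Lemma lin_bigsum (I : Type) (s : seq I) (P : pred I) (F : I -> U) :
  f (\sum_(i <- s | P i) F i) = \sum_(i <- s | P i) f (F i).
Proof. by rewrite (big_morph f lin_add lin_zero). Qed.

End LinearMaps.

Section FiniteSupport.

Lemma fsbig_supported (I : choiceType) (V : nmodType) (D : set I) (f : I -> V)
    (s : seq I) : uniq s -> (forall i, D i -> f i != 0 -> i \in s) ->
  \sum_(i \in D) f i = \sum_(i <- s | i \in D) f i.
Proof.
move=> us fs; rewrite fsbig_mkcond [RHS]big_mkcond/=.
rewrite (fsbigE s)//; last first.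
  move=> i _ /=; rewrite /patch; case: ifP => // /set_mem Di.
  by apply: contraNeq; exact: fs.
by apply: eq_big => [i|i _]; rewrite ?in_setT.
Qed.

Lemma fsbigT_supported (I : choiceType) (V : nmodType) (f : I -> V) (s : seq I) :
  uniq s -> (forall i, i \notin s -> f i = 0) ->
  \sum_(i \in [set: I]) f i = \sum_(i <- s) f i.
Proof.
move=> us fs; rewrite (fsbig_supported us)//.
  by apply: eq_bigl => i; rewrite in_setT.
by move=> i _; apply: contraR => /fs ->.
Qed.

Lemma fsbig_single (I : choiceType) (V : nmodType) (D : set I) (f : I -> V) (i0 : I) :
  D i0 -> (forall i, D i -> i != i0 -> f i = 0) -> \sum_(i \in D) f i = f i0.
Proof.
move=> Di0 f0; rewrite (@fsbig_supported _ _ _ _ [:: i0])//.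
  by rewrite big_mkcond big_seq1 mem_set.
by move=> i Di; apply: contraR; rewrite inE => /(f0 _ Di) ->.
Qed.

Lemma fsbig_zero (I : choiceType) (V : nmodType) (D : set I) (f : I -> V) :
  (forall i, D i -> f i = 0) -> \sum_(i \in D) f i = 0.
Proof.
move=> f0; rewrite (@fsbig_supported _ _ _ _ [::]) ?big_nil//.
by move=> i /f0 ->; rewrite eqxx.
Qed.

Lemma finite_set_seq (I : choiceType) (D : set I) : finite_set D ->
  exists2 s : seq I, uniq s & forall i, D i -> i \in s.
Proof.
move=> fD; exists (fset_set D); first exact: fset_uniq.
by move=> i Di; rewrite in_fset_set// mem_set.
Qed.

End FiniteSupport.

Section EigenComponents.
Context {R : realType}.
Local Notation C := R[i].
Variables (U : lmodType C) (T : U -> U).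
Hypotheses (T_linear : linear T) (T_decomp : forall u, exists f, eigen_decomp T u f).

Let T0 : T 0 = 0. Proof. exact: lin_zero. Qed.
Let TD u v : T (u + v) = T u + T v. Proof. exact: lin_add. Qed.
Let TZ a u : T (a *: u) = a *: T u. Proof. exact: lin_scale. Qed.

(** Applying T - l0 removes [f l0] and multiplies each other [f l] by the nonzero scalar l - l0,
    which gives a shorter relation. *)
Lemma eigen_sum_eq0 (s : seq C) (f : C -> U) : uniq s ->
  (forall l, eigsp T l (f l)) -> \sum_(l <- s) f l = 0 ->
  forall l, l \in s -> f l = 0.
Proof.
elim: s f => // l0 s IHs f /= /andP[l0s us] fT fs0.
have h l : l \in s -> f l = 0.
  move=> ls; have l_l0 : l != l0 by apply: contraNneq l0s => <-.
  have := IHs (fun l => (l - l0) *: f l) us _ _ l ls.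
  have gT l' : eigsp T l' ((l' - l0) *: f l').
    by rewrite /eigsp/= TZ fT !scalerA mulrC.
  move=> /(_ gT); have -> : \sum_(j <- s) (j - l0) *: f j = 0.
    have : T (\sum_(j <- l0 :: s) f j) - l0 *: \sum_(j <- l0 :: s) f j = 0.
      by rewrite fs0 T0 scaler0 subrr.
    rewrite (lin_bigsum T_linear) scaler_sumr -sumrB big_cons fT subrr add0r => {2}<-.
    by apply: eq_bigr => j _; rewrite fT scalerBl.
  by move=> /(_ erefl)/eqP; rewrite scaler_eq0 subr_eq0 (negbTE l_l0) => /eqP.
move=> l; rewrite inE => /orP[/eqP ->|/h//].
move: fs0; rewrite big_cons big_seq big1 ?addr0// => i; exact: h.
Qed.

Lemma eigen_decompP u (f : C -> U) : eigen_decomp T u f <->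
  (exists s : seq C, [/\ uniq s, forall l, l \notin s -> f l = 0 &
     u = \sum_(l <- s) f l]) /\ (forall l, eigsp T l (f l)).
Proof.
split=> [[/finite_set_seq[s us hs] fT ->]|[[s [us hs ->]] fT]].
  split=> //; exists s; split=> //.
    by move=> l; apply: contraNeq => /hs.
  by apply: fsbigT_supported => // l; apply: contraNeq => /hs.
split=> //; last by rewrite (fsbigT_supported us).
apply: sub_finite_set (finite_seq s) => l /= fl; apply: contraNT fl => ls.
by rewrite hs.
Qed.

Lemma eigen_decomp_unique u (f g : C -> U) :
  eigen_decomp T u f -> eigen_decomp T u g -> f = g.
Proof.
move=> /eigen_decompP[[s [us hs uE]] fT] /eigen_decompP[[t [ut ht uE']] gT].
apply/funext => l; apply/eqP; rewrite -subr_eq0; apply/eqP.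
pose r := undup (s ++ t).
have sr (h : C -> U) (s' : seq C) : uniq s' -> {subset s' <= r} -> (forall l, l \notin s' -> h l = 0) ->
    \sum_(l <- r) h l = \sum_(l <- s') h l.
  move=> us' s'r hs'; rewrite -!(fsbigT_supported)//; first exact: undup_uniq.
  by move=> i ir; apply: hs'; apply: contra ir; exact: s'r.
have [lr|] := boolP (l \in r); last first.
  by rewrite mem_undup mem_cat negb_or => /andP[ls lt]; rewrite hs// ht// subrr.
apply: (@eigen_sum_eq0 r (fun l => f l - g l)) => //.
- exact: undup_uniq.
- by move=> l'; rewrite /eigsp/= TD -scaleN1r TZ gT fT scalerDr !scalerA mulrC.
- rewrite sumrB (sr f s)// ?(sr g t)//; first by rewrite -uE -uE' subrr.
    by move=> i it; rewrite mem_undup mem_cat it orbT.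
  by move=> i it; rewrite mem_undup mem_cat it.
Qed.

Lemma eigen_comp_decomp u : eigen_decomp T u (fun l => eigen_comp T l u).
Proof.
have [f fu] := T_decomp u.
suff -> : (fun l => eigen_comp T l u) = f by [].
apply/funext => l; rewrite /eigen_comp.
case: xgetP => [w _ [g [gu ->]]|/(_ (f l))[]]; last by exists f.
by rewrite (eigen_decomp_unique gu fu).
Qed.

Lemma eigen_compE u f l : eigen_decomp T u f -> eigen_comp T l u = f l.
Proof. by move=> /(eigen_decomp_unique (eigen_comp_decomp u)) <-. Qed.

Lemma eigen_comp_eigsp l u : eigsp T l (eigen_comp T l u).
Proof. by have [_ h _] := eigen_comp_decomp u. Qed.

Lemma eigen_comp_seq u : exists s : seq C, [/\ uniq s,
  forall l, l \notin s -> eigen_comp T l u = 0 &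
  u = \sum_(l <- s) eigen_comp T l u].
Proof. by have /eigen_decompP[] := eigen_comp_decomp u. Qed.

Lemma eigen_comp_homog l l' u : eigsp T l u ->
  eigen_comp T l' u = if l' == l then u else 0.
Proof.
move=> uT; apply: (@eigen_compE _ (fun l' => if l' == l then u else 0)).
apply/eigen_decompP; split; last first.
  by move=> k; case: eqP => [->//|_]; rewrite /eigsp/= T0 scaler0.
exists [:: l]; split=> //; last by rewrite big_seq1 eqxx.
by move=> k; rewrite inE => /negbTE ->.
Qed.

Lemma eigen_comp_linear l : linear (eigen_comp T l).
Proof.
move=> a u v.
apply: (@eigen_compE _ (fun l => a *: eigen_comp T l u + eigen_comp T l v)).
apply/eigen_decompP; split; last first.
  move=> k; rewrite /eigsp/= TD TZ !eigen_comp_eigsp scalerDr.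
  by rewrite !scalerA mulrC.
have [s [us hs uE]] := eigen_comp_seq u; have [t [ut ht vE]] := eigen_comp_seq v.
have sub (h : C -> U) (s' : seq C) : uniq s' -> {subset s' <= undup (s ++ t)} ->
   (forall l, l \notin s' -> h l = 0) ->
    \sum_(l <- undup (s ++ t)) h l = \sum_(l <- s') h l.
  move=> us' s'r hs'; rewrite -!(fsbigT_supported)//; first exact: undup_uniq.
  by move=> i ir; apply: hs'; apply: contra ir; exact: s'r.
exists (undup (s ++ t)); split; first exact: undup_uniq.
  move=> k; rewrite mem_undup mem_cat negb_or => /andP[ks kt].
  by rewrite hs// ht// scaler0 addr0.
rewrite big_split -scaler_sumr/= {1}uE {1}vE.
rewrite (sub (fun l => eigen_comp T l u) s)// ?(sub (fun l => eigen_comp T l v) t)//.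
  by move=> i it; rewrite mem_undup mem_cat it orbT.
by move=> i it; rewrite mem_undup mem_cat it.
Qed.

Lemma eigen_comp_shift (S : U -> U) (d : C) : linear S ->
  (forall l u, eigsp T l u -> eigsp T (l + d) (S u)) ->
  forall l u, eigen_comp T (l + d) (S u) = S (eigen_comp T l u).
Proof.
move=> S_linear hS l u.
have S0 := lin_zero S_linear.
have -> : l = (l + d) - d by rewrite addrK.
rewrite subrK.
apply: (@eigen_compE _ (fun l' => S (eigen_comp T (l' - d) u))).
apply/eigen_decompP; split; last first.
  by move=> k; rewrite -{1}(subrK d k); apply: hS; exact: eigen_comp_eigsp.
have [s [us hs uE]] := eigen_comp_seq u.
exists [seq k + d | k <- s]; split.
- by rewrite map_inj_uniq// => x y /addIr.
- move=> k ks; rewrite hs ?S0//; apply: contra ks => ks.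
  by apply/mapP; exists (k - d) => //; rewrite subrK.
rewrite big_map; under eq_bigr do rewrite addrK.
by rewrite {1}uE (lin_bigsum S_linear).
Qed.

End EigenComponents.

(** * Traces on finite-dimensional subspaces *)

Section Trace.
Context {R : realType}.
Local Notation C := R[i].
Variable U : lmodType C.
Implicit Types (W : set U) (X Y : U -> U).

Let lin_sum (X : U -> U) (d : nat) (a : 'I_d -> C) (e : 'I_d -> U) : linear X ->
  X (\sum_i a i *: e i) = \sum_i a i *: X (e i).
Proof.
move=> X_linear; rewrite (lin_bigsum X_linear).
by apply: eq_bigr => i _; exact: lin_scale.
Qed.

Lemma basis_matrix W W' (d d' : nat) (e : 'I_d -> U) (e' : 'I_d' -> U) X :
  is_basis W e -> is_basis W' e' -> (forall w, W w -> W' (X w)) ->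
  exists A : 'M[C]_(d', d), forall j, X (e j) = \sum_i A i j *: e' i.
Proof.
move=> [We _] [_ He'] hX.
have /choice[a ha] : forall j, exists a : 'rV[C]_d', X (e j) = \sum_i a 0 i *: e' i.
  by move=> j; have [a [-> _]] := He' _ (hX _ (We j)); exists a.
by exists (\matrix_(i, j) a j 0 i) => j; rewrite ha; apply: eq_bigr => i _; rewrite mxE.
Qed.

Lemma basis_inj W (d : nat) (e : 'I_d -> U) (a b : 'I_d -> C) : is_basis W e ->
  W (\sum_i a i *: e i) -> \sum_i a i *: e i = \sum_i b i *: e i -> a =1 b.
Proof.
move=> [_ He] Wa ab i; have [a0 [_ a0U]] := He _ Wa.
have ha : a0 = \row_j a j by apply: a0U; apply: eq_bigr => j _; rewrite mxE.
have hb : a0 = \row_j b j by apply: a0U; rewrite ab; apply: eq_bigr => j _; rewrite mxE.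
by have := congr1 (fun v : 'rV_d => v 0 i) (esym ha); rewrite hb !mxE.
Qed.

(** If P and Q are the matrices of [X] and [Y] between the two bases, then A = Q P and B = P Q. *)
Lemma trace_cyclic_mx W W' (d d' : nat) (e : 'I_d -> U) (e' : 'I_d' -> U) X Y
    (A : 'M[C]_d) (B : 'M[C]_d') : linear X -> linear Y ->
  is_basis W e -> is_basis W' e' ->
  (forall w, W w -> W' (X w)) -> (forall w, W' w -> W (Y w)) ->
  (forall j, Y (X (e j)) = \sum_i A i j *: e i) ->
  (forall j, X (Y (e' j)) = \sum_i B i j *: e' i) -> \tr A = \tr B.
Proof.
move=> Xl Yl He He' hX hY hA hB.
have [P hP] := basis_matrix He He' hX; have [Q hQ] := basis_matrix He' He hY.
have comp (Z : U -> U) n m k (f1 : 'I_n -> U) (f2 : 'I_m -> U) (f3 : 'I_k -> U) (Q1 : 'M[C]_(m, n)) (Q2 : 'M[C]_(k, m)) (v : 'I_n -> U) :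
    linear Z -> (forall j, v j = \sum_i Q1 i j *: f2 i) -> (forall j, Z (f2 j) = \sum_i Q2 i j *: f3 i) ->
    forall j, Z (v j) = \sum_i (Q2 *m Q1) i j *: f3 i.
  move=> Zl h1 h2 j; rewrite h1 lin_sum//.
  under eq_bigr do rewrite h2 scaler_sumr; rewrite exchange_big/=.
  apply: eq_bigr => i _; rewrite mxE scaler_suml; apply: eq_bigr => l _.
  by rewrite scalerA mulrC.
have AE : A = Q *m P.
  apply/matrixP => i j; apply: (basis_inj He (a := fun i => A i j) (b := fun i => (Q *m P) i j)).
    by rewrite -hA; apply: hY; apply: hX; have [] := He.
  by rewrite -hA (comp Y _ _ _ e e' e P Q (fun j => X (e j)) Yl hP hQ).
have BE : B = P *m Q.
  apply/matrixP => i j; apply: (basis_inj He' (a := fun i => B i j) (b := fun i => (P *m Q) i j)).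
    by rewrite -hB; apply: hX; apply: hY; have [] := He'.
  by rewrite -hB (comp X _ _ _ e' e e' Q P (fun j => Y (e' j)) Xl hQ hP).
by rewrite AE BE mxtrace_mulC.
Qed.

Lemma trace_onE W (d : nat) (e : 'I_d -> U) X (A : 'M[C]_d) : linear X ->
  is_basis W e -> (forall w, W w -> W (X w)) ->
  (forall j, X (e j) = \sum_i A i j *: e i) -> trace_on W X = \tr A.
Proof.
move=> Xl He hX hA; rewrite /trace_on.
case: xgetP => [t _ [d' [e' [A' [He' hA' ->]]]]|/(_ (\tr A))[]]; last first.
  by exists d, e, A.
(* Cyclicity with the identity as one factor is invariance under change of basis, so the choice made
   by [xget] does not matter. *)
by apply: (@trace_cyclic_mx W W d' d e' e id X).
Qed.

Lemma trace_on_cyclic W W' X Y : linear X -> linear Y ->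
  finite_dim W -> finite_dim W' ->
  (forall w, W w -> W' (X w)) -> (forall w, W' w -> W (Y w)) ->
  trace_on W (fun w => Y (X w)) = trace_on W' (fun w => X (Y w)).
Proof.
move=> Xl Yl [d [e He]] [d' [e' He']] hX hY.
have YXl : linear (fun w => Y (X w)) by move=> a u v; rewrite Xl Yl.
have XYl : linear (fun w => X (Y w)) by move=> a u v; rewrite Yl Xl.
have YXW w : W w -> W (Y (X w)) by move=> /hX/hY.
have XYW w : W' w -> W' (X (Y w)) by move=> /hY/hX.
have [A hA] := basis_matrix He He YXW; have [B hB] := basis_matrix He' He' XYW.
rewrite (trace_onE YXl He YXW hA) (trace_onE XYl He' XYW hB).
exact: (trace_cyclic_mx Xl Yl He He' hX hY hA hB).
Qed.

Lemma trace_on_linear W (a : C) X Y : linear X -> linear Y -> finite_dim W ->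
  (forall w, W w -> W (X w)) -> (forall w, W w -> W (Y w)) ->
  (forall w, W w -> W (a *: X w + Y w)) ->
  trace_on W (fun w => a *: X w + Y w) = a * trace_on W X + trace_on W Y.
Proof.
move=> Xl Yl [d [e He]] hX hY hXY.
have [A hA] := basis_matrix He He hX; have [B hB] := basis_matrix He He hY.
rewrite (trace_onE Xl He hX hA) (trace_onE Yl He hY hB).
rewrite -mxtraceZ -mxtraceD; apply: (trace_onE _ He hXY).
  by move=> b u v; rewrite Xl Yl !scalerDr addrACA !scalerA mulrC.
move=> j; rewrite hA hB scaler_sumr -big_split; apply: eq_bigr => i _ /=.
by rewrite !mxE scalerDl scalerA.
Qed.

Lemma trace_on_eq0 W X : linear X -> finite_dim W ->
  (forall w, W w -> W (X w)) -> (forall w, W w -> X w = 0) -> trace_on W X = 0.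
Proof.
move=> Xl [d [e He]] hX X0.
rewrite (trace_onE (A := 0) Xl He hX) ?mxtrace0// => j.
rewrite X0; last by have [] := He.
by rewrite big1// => i _; rewrite mxE scale0r.
Qed.

End Trace.

(** * Modes and vertex operators on a module *)

Section EigenspaceClosure.
Context {R : realType}.
Local Notation C := R[i].
Variables (U : lmodType C) (T : U -> U).
Hypothesis T_linear : linear T.

Lemma eigsp_zero l : eigsp T l 0.
Proof. by rewrite /eigsp/= (lin_zero T_linear) scaler0. Qed.

Lemma eigsp_add l u v : eigsp T l u -> eigsp T l v -> eigsp T l (u + v).
Proof. by rewrite /eigsp/= (lin_add T_linear) scalerDr => -> ->. Qed.

Lemma eigsp_scale l a u : eigsp T l u -> eigsp T l (a *: u).
Proof. by rewrite /eigsp/= (lin_scale T_linear) => ->; rewrite !scalerA mulrC. Qed.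

Lemma eigsp_fsum l (I : choiceType) (D : set I) (F : I -> U) :
  (forall i, eigsp T l (F i)) -> eigsp T l (\sum_(i \in D) F i).
Proof.
move=> hF; elim/big_ind: _ => // [|u v]; [exact: eigsp_zero|exact: eigsp_add].
Qed.

End EigenspaceClosure.

Section Parity.
Context {R : realType}.

Lemma par_proj_other (U : lmodType R[i]) (S : superspace U) al be u :
  has_parity S be u -> al != be -> S al u = 0.
Proof. by move=> <- /negbTE ab; rewrite par_projK ab. Qed.

Local Notation C := R[i].
Variables (U : lmodType C) (S : superspace U).

Lemma par_proj_parity al u : has_parity S al (S al u).
Proof. by rewrite /has_parity par_projK eqxx. Qed.

Lemma par_proj_shift (W : lmodType C) (S' : superspace W) (ga : bool) (X : U -> W) :
  linear X -> (forall be u, has_parity S be u -> has_parity S' (ga (+) be) (X u)) ->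
  forall be u, S' (ga (+) be) (X u) = X (S be u).
Proof.
move=> X_linear hX be u; rewrite {1}(par_proj_sum S u) (lin_add X_linear) linearD.
have h0 := hX _ _ (par_proj_parity false u).
have h1 := hX _ _ (par_proj_parity true u).
case: be.
  by rewrite h1 (par_proj_other (S := S') h0) ?add0r//; case: (ga).
by rewrite h0 (par_proj_other (S := S') h1) ?addr0//; case: (ga).
Qed.

Lemma parity_aut_linear : linear (parity_aut S).
Proof.
by move=> a u v; rewrite /parity_aut (linearP (S false)) (linearP (S true)) opprD addrACA scalerBr.
Qed.

Lemma parity_aut_shift (ga : bool) (X : U -> U) : linear X ->
  (forall be u, has_parity S be u -> has_parity S (ga (+) be) (X u)) ->
  forall u, parity_aut S (X u) = (-1) ^+ ga *: X (parity_aut S u).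
Proof.
move=> X_linear hX u; have h := par_proj_shift X_linear hX.
rewrite /parity_aut (lin_sub X_linear).
have := h false u; have := h true u; case: (ga) => /= -> ->.
  by rewrite scaleN1r opprB.
by rewrite scale1r.
Qed.

Lemma par_projE al u : S al u = 2^-1 *: (u + (-1) ^+ al *: parity_aut S u).
Proof.
have -> : u + (-1) ^+ al *: parity_aut S u = 2 *: S al u.
  rewrite {1}(par_proj_sum S u) /parity_aut scaler_nat mulr2n.
  case: al => /=; first by rewrite expr1 scaleN1r opprB addrC addrA subrK.
  by rewrite expr0 scale1r addrACA subrr addr0.
by rewrite scalerA mulVf ?scale1r// pnatr_eq0.
Qed.

(** The projections are (1 + sigma) / 2 and (1 - sigma) / 2. This turns commutation of g with sigma
    into the fact that the parity components of v are again g-eigenvectors. *)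
Lemma par_proj_comm (X : U -> U) : linear X ->
  (forall u, X (parity_aut S u) = parity_aut S (X u)) ->
  forall al u, S al (X u) = X (S al u).
Proof.
move=> X_linear hX al u.
by rewrite !par_projE (lin_scale X_linear) (lin_add X_linear) (lin_scale X_linear) hX.
Qed.

End Parity.

Section Modes.
Context {R : realType}.
Local Notation C := R[i].
Variables (c : C) (V : lmodType C) (A : vosa c V) (M : lmodType C) (B : vmodule A M).
Local Notation LV := (vmode A (omega A) 1).
Local Notation LM := (mmode B (omega A) 1).
Local Notation "u _( n )" := (mmode B u n) (at level 8, format "u _( n )").

Lemma LV_linear : linear LV. Proof. exact: vmode_linr. Qed.
Lemma LM_linear : linear LM. Proof. exact: mmode_linr. Qed.

Lemma V_decomp (u : V) : exists f, eigen_decomp LV u f.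
Proof. by have [r0 h] := vgraded A; have [f [hf _]] := h u; exists f. Qed.

Lemma M_decomp (u : M) : exists f, eigen_decomp LM u f.
Proof. by have [r0 h] := mgraded B; have [f [hf _]] := h u; exists f. Qed.

Lemma commutator_formula al be a b (m k : int) (w : M) :
  has_parity (vpar A) al a -> has_parity (vpar A) be b ->
  a _(m) (b _(k) w) - (-1) ^+ (al * be)%N *: b _(k) (a _(m) w) =
  \sum_(i \in [set: nat]) gbin m i *: (vmode A a i%:Z b) _(m + k - i%:Z) w.
Proof.
move=> ha hb; have := mborcherds B m 0 k w ha hb.
rewrite [RHS](@fsbig_single _ _ _ _ 0%N)//; last first.
  move=> [//|i] _ _; rewrite gbin0S mulr0 scale0r//.
have -> : m + 0 - 0%:Z = m by lia.
have -> : k + 0%:Z = k by lia.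
have -> : 0 + k - 0%:Z = k by lia.
have -> : m + 0%:Z = m by lia.
rewrite gbin0 mulr1 expr0 scale1r add0n => <-.
by apply: eq_fsbigr => i _; rewrite add0r.
Qed.

Lemma associativity_formula al be a b (i : nat) (k : int) (w : M) :
  has_parity (vpar A) al a -> has_parity (vpar A) be b ->
  (vmode A a i%:Z b) _(k) w =
  \sum_(j \in [set: nat]) ((-1) ^+ j * gbin i%:Z j) *:
    (a _(i%:Z - j%:Z) (b _(k + j%:Z) w) -
     (-1) ^+ (i + al * be)%N *: b _(i%:Z + k - j%:Z) (a _(j%:Z) w)).
Proof.
move=> ha hb; have := mborcherds B 0 i%:Z k w ha hb.
rewrite [LHS](@fsbig_single _ _ _ _ 0%N)//; last first.
  move=> [//|j] _ _; rewrite gbin0S scale0r//.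
have -> : i%:Z + 0%:Z = i%:Z by lia.
have -> : 0 + k - 0%:Z = k by lia.
rewrite gbin0 scale1r absz_nat => ->.
by apply: eq_fsbigr => j _; rewrite !add0r.
Qed.

(** In the commutator formula with m = 1 only i = 0 and i = 1 survive: omega(0) b acts as the
    derivative, which gives - (k + 1) b(k), and omega(1) b is [LV b]. Since [b] may have mixed
    parity, its two components are treated separately. *)
Lemma omega_commutator (b : V) (k : int) (w : M) :
  LM (b _(k) w) - b _(k) (LM w) = (LV b) _(k) w - (k + 1)%:~R *: b _(k) w.
Proof.
have main be (b' : V) : has_parity (vpar A) be b' ->
    LM (b' _(k) w) - b' _(k) (LM w) = (LV b') _(k) w - (k + 1)%:~R *: b' _(k) w.
  move=> hb; have := commutator_formula 1 k w (omega_even A) hb.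
  rewrite mul0n expr0 scale1r => ->.
  rewrite (@fsbig_supported _ _ _ _ [:: 0%N; 1%N])//; last first.
    move=> [//|[//|i]] _; rewrite (gbinS 1) (_ : 1 - 1 = 0 :> int)// !gbin0S.
    by rewrite addr0 scale0r eqxx.
  rewrite big_mkcond !big_cons big_nil !in_setT/= addr0.
  rewrite gbin0 (gbinS 1) (_ : 1 - 1 = 0 :> int)// gbin0 gbin0S add0r !scale1r.
  rewrite (addrC 1 k) addr0 addrC; congr (_ + _).
    by rewrite addrK.
  have -> : vmode A (omega A) 0%:Z b' = vmode A (omega A) 0 b' by [].
  by rewrite mderivation addrK intrN scaleNr.
have h (b1 b2 : V) : LM ((b1 + b2) _(k) w) - (b1 + b2) _(k) (LM w) =
    (LM (b1 _(k) w) - b1 _(k) (LM w)) + (LM (b2 _(k) w) - b2 _(k) (LM w)).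
  by rewrite !(lin_add (mmode_linl B _ _)) (lin_add LM_linear) opprD addrACA.
rewrite [in LHS](par_proj_sum (vpar A) b) h !(main _ _ (par_proj_parity _ _ _)).
rewrite [in RHS](par_proj_sum (vpar A) b) (lin_add LV_linear).
by rewrite !(lin_add (mmode_linl B _ _)) scalerDr opprD addrACA.
Qed.

(** The weight of [u] as far as [M] can see it; it makes sense even where [u] is not known to be an
    eigenvector in [V]. *)
Definition field_degree (u : V) (rho : R) : Prop := forall (k : int) l w,
  eigsp LM l w -> eigsp LM (l + (rho - k%:~R - 1)%:C) (u _(k) w).

Lemma homogeneous_field_degree (u : V) (r : R) : eigsp LV r%:C u -> field_degree u r.
Proof.
move=> ur k l w wl; rewrite /eigsp/=.
have := omega_commutator u k w; rewrite ur wl.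
rewrite (lin_scale (mmode_linr B _ _)) (lin_scale (mmode_linl B _ _)).
move/eqP; rewrite subr_eq => /eqP ->.
rewrite -scalerBl -scalerDl; congr (_ *: _).
rewrite !rmorphB/= rmorph_int rmorph1 intrD/=; ring.
Qed.

(* By associativity on [M], so that [a(i)b] need not be shown to be homogeneous
   in [V]. *)
Lemma mode_field_degree al be (a b : V) (r s : R) (i : nat) :
  has_parity (vpar A) al a -> has_parity (vpar A) be b ->
  eigsp LV r%:C a -> eigsp LV s%:C b ->
  field_degree (vmode A a i%:Z b) (r + s - i%:R - 1).
Proof.
move=> ha hb ar bs k l w wl; rewrite (associativity_formula i k w ha hb).
have ad := homogeneous_field_degree ar; have bd := homogeneous_field_degree bs.
apply: eigsp_fsum; first exact: LM_linear.
move=> j; apply: eigsp_scale; first exact: LM_linear.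
rewrite -scaleNr; apply: eigsp_add; first exact: LM_linear.
  have := ad (i%:Z - j%:Z) _ _ (bd (k + j%:Z) _ _ wl); congr (eigsp _ _ _).
  rewrite -addrA -rmorphD; congr (_ + _%:C).
  by rewrite intrB intrD -!pmulrn; ring.
apply: eigsp_scale; first exact: LM_linear.
have := bd (i%:Z + k - j%:Z) _ _ (ad j%:Z _ _ wl); congr (eigsp _ _ _).
rewrite -addrA -rmorphD; congr (_ + _%:C).
by rewrite intrB intrD -!pmulrn; ring.
Qed.

Lemma par_proj_LV al u : vpar A al (LV u) = LV (vpar A al u).
Proof.
apply: (par_proj_shift (ga := false) LV_linear) => be w.
exact: (vmode_par 1 (omega_even A)).
Qed.

Lemma par_proj_LM al w : mpar B al (LM w) = LM (mpar B al w).
Proof.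
apply: (par_proj_shift (ga := false) LM_linear) => be u.
exact: (mmode_par 1 (omega_even A)).
Qed.

Lemma eigsp_vpar al l u : eigsp LV l u -> eigsp LV l (vpar A al u).
Proof. by rewrite /eigsp/= -par_proj_LV => ->; rewrite linearZ. Qed.

Lemma eigsp_mpar al l u : eigsp LM l u -> eigsp LM l (mpar B al u).
Proof. by rewrite /eigsp/= -par_proj_LM => ->; rewrite linearZ. Qed.

Lemma wt_comp_linear r : linear (wt_comp A r).
Proof. exact: (eigen_comp_linear LV_linear V_decomp). Qed.

Lemma wt_comp_vpar al r u : wt_comp A r (vpar A al u) = vpar A al (wt_comp A r u).
Proof.
have vl : linear (vpar A al) by move=> a x y; rewrite linearP.
have := eigen_comp_shift LV_linear V_decomp (d := 0) vl.
move=> /(_ _ r%:C u); rewrite addr0; apply => l w; rewrite addr0.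
exact: eigsp_vpar.
Qed.

Lemma wt_comp_homog r s u : eigsp LV s%:C u ->
  wt_comp A r u = if r == s then u else 0.
Proof.
move=> us; rewrite /wt_comp (eigen_comp_homog LV_linear V_decomp _ us).
by rewrite (inj_eq (@complexI _)).
Qed.

Lemma wt_comp_eigsp r u : eigsp LV r%:C (wt_comp A r u).
Proof. exact: (eigen_comp_eigsp LV_linear V_decomp). Qed.

(** [eigen_comp] is indexed by complex numbers; the grading makes every eigenvalue that occurs real,
    so no component is lost by indexing over [R]. *)
Lemma wt_comp_seq u : exists s : seq R, [/\ uniq s,
  forall r, r \notin s -> wt_comp A r u = 0 & u = \sum_(r <- s) wt_comp A r u].
Proof.
have [s [us hs uE]] := eigen_comp_seq LV_linear V_decomp u.
have [r0 h] := vgraded A; have [f [fu freal]] := h u.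
have realE l : eigen_comp LV l u != 0 -> l = (complex.Re l)%:C.
  by rewrite (eigen_compE LV_linear V_decomp _ fu) => /freal[r _ ->].
pose s' := [seq complex.Re l | l <- s & eigen_comp LV l u != 0].
have sE : [seq r%:C | r <- s'] = [seq l <- s | eigen_comp LV l u != 0].
  rewrite -map_comp -[RHS]map_id; apply/eq_in_map => l.
  by rewrite mem_filter => /andP[/realE lE _]; rewrite /= -lE.
exists s'; split.
- rewrite -(map_inj_uniq (@complexI _)) sE; exact: filter_uniq.
- move=> r rs; apply/eqP; apply: contraNT rs => ru.
  rewrite -(mem_map (@complexI _)) sE mem_filter ru/=.
  by apply: contraNT ru => /hs; rewrite /wt_comp => ->.
rewrite {1}uE (bigID (fun l => eigen_comp LV l u != 0))/= [X in _ + X]big1 ?addr0.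
  by rewrite -big_filter -sE big_map.
by move=> l /negPn/eqP.
Qed.

End Modes.

(** * Coefficients of vertex operators and their brackets *)

Section VertexCoefficients.
Context {R : realType}.
Local Notation C := R[i].
Variables (c : C) (V : lmodType C) (A : vosa c V) (M : lmodType C) (B : vmodule A M).
Local Notation LV := (vmode A (omega A) 1).
Local Notation LM := (mmode B (omega A) 1).
Local Notation "u _( n )" := (mmode B u n) (at level 8, format "u _( n )").
Local Notation LMl := (@LM_linear R c V A M B).
Local Notation Md := (@M_decomp R c V A M B).

(** At most one [k] qualifies; the sum form yields the operator 0 when [x] lies outside the coset
    rho + Z. *)
Definition mode_at (rho : R) (u : V) (x : R) (w : M) : M :=
  \sum_(k \in [set k : int | rho - k%:~R - 1 = x]) u _(k) w.

Lemma mode_atE rho u x w (k : int) : rho - k%:~R - 1 = x ->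
  mode_at rho u x w = u _(k) w.
Proof.
move=> kx; apply: fsbig_single => // k' /= k'x; apply: contraNeq => _.
by rewrite -(eqr_int R); apply/eqP; lra.
Qed.

Lemma mode_at_none rho u x w : (forall k : int, rho - k%:~R - 1 <> x) ->
  mode_at rho u x w = 0.
Proof. by move=> kx; apply: fsbig_zero => k /kx. Qed.

Lemma mode_at_linl rho x w : linear (fun u => mode_at rho u x w).
Proof.
move=> a u v; have [[k kx]|nk] := pselect (exists k : int, rho - k%:~R - 1 = x).
  by rewrite !(mode_atE _ _ kx) (mmode_linl B).
by rewrite !mode_at_none ?scaler0 ?addr0// => k kx; apply: nk; exists k.
Qed.

Lemma mode_at_linr rho u x : linear (mode_at rho u x).
Proof.
move=> a w w'; have [[k kx]|nk] := pselect (exists k : int, rho - k%:~R - 1 = x).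
  by rewrite !(mode_atE _ _ kx) (mmode_linr B).
by rewrite !mode_at_none ?scaler0 ?addr0// => k kx; apply: nk; exists k.
Qed.

Lemma vertex_coef_seq u x w (s : seq R) : uniq s ->
  (forall r, r \notin s -> wt_comp A r u = 0) ->
  vertex_coef B u x w = \sum_(r <- s) mode_at r (wt_comp A r u) x w.
Proof.
move=> us hs; apply: fsbigT_supported => // r /hs ->.
exact: (lin_zero (mode_at_linl r x w)).
Qed.

Lemma vertex_coef_linr u x : linear (vertex_coef B u x).
Proof.
have [s [us hs _]] := wt_comp_seq A u.
move=> a w w'; rewrite !(vertex_coef_seq _ _ us hs) scaler_sumr -big_split.
by apply: eq_bigr => r _; rewrite mode_at_linr.
Qed.

Lemma vertex_coef_linl x w : linear (fun u => vertex_coef B u x w).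
Proof.
move=> a u v.
have [s [us hs _]] := wt_comp_seq A u; have [t [ut ht _]] := wt_comp_seq A v.
have usub r : r \notin undup (s ++ t) -> wt_comp A r u = 0.
  by rewrite mem_undup mem_cat negb_or => /andP[/hs].
have vsub r : r \notin undup (s ++ t) -> wt_comp A r v = 0.
  by rewrite mem_undup mem_cat negb_or => /andP[_ /ht].
have uu := undup_uniq (s ++ t).
rewrite (vertex_coef_seq _ _ uu usub) (vertex_coef_seq _ _ uu vsub).
rewrite (@vertex_coef_seq _ _ _ (undup (s ++ t)))//; last first.
  by move=> r rs; rewrite wt_comp_linear usub// vsub// scaler0 addr0.
rewrite scaler_sumr -big_split; apply: eq_bigr => r _.
by rewrite wt_comp_linear mode_at_linl.
Qed.

(** On an eigenvector of L(0) the weight components of [u] shift the eigenvalue by distinct amounts,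
    so projecting to one eigenvalue isolates one component; [u] itself shifts by a single amount, so
    only the component [rho] can act. *)
Lemma field_degree_comp u rho r (k : int) w : field_degree B u rho ->
  (wt_comp A r u) _(k) w = if r == rho then u _(k) w else 0.
Proof.
move=> urho.
have main l w' : eigsp LM l w' ->
    (wt_comp A r u) _(k) w' = if r == rho then u _(k) w' else 0.
  move=> w'l; have [s [us hs uE]] := wt_comp_seq A u.
  have hr r' := @homogeneous_field_degree _ _ _ _ _ B _ _ (wt_comp_eigsp A r' u) k l w' w'l.
  have pE r' : eigen_comp LM (l + (r - k%:~R - 1)%:C) ((wt_comp A r' u) _(k) w') =
      if r == r' then (wt_comp A r' u) _(k) w' else 0.
    rewrite (eigen_comp_homog LMl Md _ (hr r')) (inj_eq (addrI l)) (inj_eq (@complexI _)).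
    by rewrite !(inj_eq (addIr _)).
  have : eigen_comp LM (l + (r - k%:~R - 1)%:C) (u _(k) w') = (wt_comp A r u) _(k) w'.
    rewrite [in LHS]uE (lin_bigsum (mmode_linl B k w')).
    rewrite (lin_bigsum (eigen_comp_linear LMl Md _)).
    under eq_bigr do rewrite pE.
    have [rs|rs] := boolP (r \in s).
      rewrite (bigD1_seq r rs us)/= eqxx big1 ?addr0// => r'.
      by rewrite eq_sym => /negbTE ->.
    rewrite (hs r rs) (lin_zero (mmode_linl B k w')) big_seq big1// => r' r's.
    by case: eqP => // rr'; rewrite rr' r's in rs.
  rewrite (eigen_comp_homog LMl Md _ (urho k l w' w'l)) (inj_eq (addrI l)).
  by rewrite (inj_eq (@complexI _)) !(inj_eq (addIr _)) => <-.
have [s [_ _ wE]] := eigen_comp_seq LMl Md w.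
rewrite wE !(lin_bigsum (mmode_linr B _ k)).
under eq_bigr do rewrite (main _ _ (eigen_comp_eigsp LMl Md _ w)).
by case: eqP => // _; rewrite big1.
Qed.

Lemma vertex_coef_degree u rho x w : field_degree B u rho ->
  vertex_coef B u x w = mode_at rho u x w.
Proof.
move=> urho; have modeE r : mode_at r (wt_comp A r u) x w =
    if r == rho then mode_at r u x w else 0.
  have [[k kx]|nk] := pselect (exists k : int, r - k%:~R - 1 = x).
    by rewrite !(mode_atE _ _ kx) (field_degree_comp _ _ _ urho).
  by rewrite !mode_at_none ?if_same// => k kx; apply: nk; exists k.
rewrite /vertex_coef (@fsbig_single _ _ _ _ rho)//.
  by have := modeE rho; rewrite eqxx.
by move=> r _ rrho; have := modeE r; rewrite (negbTE rrho).
Qed.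

Lemma has_parity_sum (U : lmodType C) (S : superspace U) al (I : Type) (s : seq I)
    (P : pred I) (F : I -> U) : (forall i, has_parity S al (F i)) ->
  has_parity S al (\sum_(i <- s | P i) F i).
Proof. by move=> hF; rewrite /has_parity linear_sum; apply: eq_bigr => i _; apply: hF. Qed.

Lemma vertex_coef_parity al be u x w : has_parity (vpar A) al u ->
  has_parity (mpar B) be w -> has_parity (mpar B) (al (+) be) (vertex_coef B u x w).
Proof.
move=> ual wbe; have [s [us hs _]] := wt_comp_seq A u.
rewrite (vertex_coef_seq _ _ us hs); apply: has_parity_sum => r.
have ral : has_parity (vpar A) al (wt_comp A r u).
  by rewrite /has_parity -wt_comp_vpar ual.
have [[k kx]|nk] := pselect (exists k : int, r - k%:~R - 1 = x).
  by rewrite (mode_atE _ _ kx); exact: (mmode_par k ral wbe).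
by rewrite mode_at_none ?/has_parity ?linear0// => k kx; apply: nk; exists k.
Qed.

Lemma vmode_trunc_nat a b : exists K : nat, forall k : nat, (K <= k)%N ->
  vmode A a k%:Z b = 0.
Proof.
have [N hN] := vmode_trunc A a b; exists `|N|%N => k Nk; apply: hN; lia.
Qed.

Lemma sq_mode_homog r v (m K : nat) b : eigsp LV r%:C v ->
  (forall k : nat, (K <= k)%N -> vmode A v k%:Z b = 0) ->
  sq_mode A v m%:Z b = \sum_(k < K) sq_coef r k%:Z m%:Z *: vmode A v k%:Z b.
Proof.
move=> vr vK; rewrite /sq_mode (@fsbig_single _ _ _ _ r)//; last first.
  move=> r' _ r'r; apply: fsbig_zero => k _.
  rewrite (wt_comp_homog _ vr) (negbTE r'r).
  by rewrite (lin_zero (vmode_linl A k b)) scaler0.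
rewrite (wt_comp_homog _ vr) eqxx.
rewrite (@fsbigT_supported _ _ _ [seq Posz k | k <- iota 0 K]).
- by rewrite big_map -{1}(subn0 K) -/(index_iota 0 K) big_mkord.
- by rewrite map_inj_uniq ?iota_uniq// => i j [].
move=> [k|k] hk.
  rewrite vK ?scaler0// leqNgt; apply: contra hk => kK.
  by rewrite map_f// mem_iota.
rewrite /sq_coef; have [d ->] : exists d, Negz k - m%:Z = Negz d.
  by exists (k + m)%N; lia.
by rewrite scale0r.
Qed.

Lemma sq_mode_linr r v (m : nat) : eigsp LV r%:C v -> linear (sq_mode A v m%:Z).
Proof.
move=> vr a b b'.
have [K hK] := vmode_trunc_nat v b; have [K' hK'] := vmode_trunc_nat v b'.
have h (k : nat) : (maxn K K' <= k)%N -> vmode A v k%:Z b = 0.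
  by rewrite geq_max => /andP[/hK].
have h' (k : nat) : (maxn K K' <= k)%N -> vmode A v k%:Z b' = 0.
  by rewrite geq_max => /andP[_ /hK'].
rewrite (sq_mode_homog _ vr h) (sq_mode_homog _ vr h').
rewrite (sq_mode_homog (K := maxn K K') _ vr); last first.
  by move=> k kK; rewrite (vmode_linr A v k) h// h'// scaler0 addr0.
rewrite scaler_sumr -big_split; apply: eq_bigr => k _ /=.
by rewrite (vmode_linr A v k) scalerDr !scalerA mulrC.
Qed.

Lemma sq_mode_eq0 r v b (K : nat) : eigsp LV r%:C v ->
  (forall k : nat, (K <= k)%N -> vmode A v k%:Z b = 0) ->
  forall m : nat, (K <= m)%N -> sq_mode A v m%:Z b = 0.
Proof.
move=> vr vK m Km; rewrite (sq_mode_homog _ vr vK) big1// => -[k /= kK] _.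
rewrite /sq_coef; have [d ->] : exists d, k%:Z - m%:Z = Negz d.
  by exists (m - k).-1; lia.
by rewrite scale0r.
Qed.

Definition exp_coef (x : R) (m : nat) : C := (- x)%:C ^+ m / m`!%:R.

Lemma homogeneous_bracket al be v u (r s x y : R) (N : int) (K : nat) w :
  has_parity (vpar A) al v -> has_parity (vpar A) be u ->
  eigsp LV r%:C v -> eigsp LV s%:C u -> N%:~R = r - 1 - x ->
  (forall k : nat, (K <= k)%N -> vmode A v k%:Z u = 0) ->
  v _(N) (vertex_coef B u y w) -
    (-1) ^+ (al * be)%N *: vertex_coef B u y (v _(N) w) =
  \sum_(m < K) exp_coef x m *: vertex_coef B (sq_mode A v m%:Z u) (y + x) w.
Proof.
move=> hv hu vr us NE vK.
have -> : \sum_(m < K) exp_coef x m *: vertex_coef B (sq_mode A v m%:Z u) (y + x) w =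
    \sum_(k < K) gbin N k *: mode_at (r + s - k%:R - 1) (vmode A v k%:Z u) (y + x) w.
  under eq_bigr => m _.
    rewrite (sq_mode_homog _ vr vK) (lin_bigsum (vertex_coef_linl _ _)) scaler_sumr.
    over.
  rewrite exchange_big; apply: eq_bigr => k _ /=.
  rewrite -(sum_sq_coef NE (ltn_ord k)) scaler_suml; apply: eq_bigr => m _.
  rewrite (lin_scale (vertex_coef_linl _ _)) scalerA; congr (_ *: _).
  apply: vertex_coef_degree; exact: (mode_field_degree k hv hu vr us).
have ud := homogeneous_field_degree (B := B) us.
rewrite !(vertex_coef_degree _ _ ud).
(* If [y] is not in s + Z, then, [N] being an integer, [y + x] is not an exponent of any v(i)u, and
   both sides are 0. *)
have [[k ky]|nk] := pselect (exists k : int, s - k%:~R - 1 = y); last first.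
  rewrite !(mode_at_none (rho := s)).
  - rewrite (lin_zero (mmode_linr B v N)) scaler0 subr0 big1// => i _.
    rewrite mode_at_none ?scaler0// => k kyx; apply: nk; exists (k - N + i%:Z).
    by rewrite intrD intrB NE -pmulrn; lra.
  - by move=> k ky; apply: nk; exists k.
  - by move=> k ky; apply: nk; exists k.
rewrite !(mode_atE _ _ ky) (commutator_formula B N k w hv hu).
rewrite (@fsbigT_supported _ _ _ (iota 0 K)) ?iota_uniq//; last first.
  move=> i; rewrite mem_iota add0n leq0n /= -leqNgt => Ki.
  by rewrite vK// (lin_zero (mmode_linl B _ _)) scaler0.
rewrite -{1}(subn0 K) -/(index_iota 0 K) big_mkord; apply: eq_bigr => i _.
congr (_ *: _); apply/esym/mode_atE.
by rewrite intrB intrD NE -pmulrn; lra.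
Qed.

(** [K0] is fixed before [y] and [w], and every larger [K] works; this lets the weight components of
    [u], and later all factors of the product, share one truncation. *)
Lemma vertex_bracket al be v u (r x : R) (N : int) :
  has_parity (vpar A) al v -> has_parity (vpar A) be u ->
  eigsp LV r%:C v -> N%:~R = r - 1 - x ->
  exists K0 : nat, forall K, (K0 <= K)%N -> forall y w,
  v _(N) (vertex_coef B u y w) =
  \sum_(m < K) exp_coef x m *: vertex_coef B (sq_mode A v m%:Z u) (y + x) w +
    (-1) ^+ (al * be)%N *: vertex_coef B u y (v _(N) w).
Proof.
move=> hv hu vr NE; have [s [us hs uE]] := wt_comp_seq A u.
have hP r' : exists K0 : nat, forall K, (K0 <= K)%N -> forall y w,
  v _(N) (vertex_coef B (wt_comp A r' u) y w) =
  \sum_(m < K) exp_coef x m *: vertex_coef B (sq_mode A v m%:Z (wt_comp A r' u)) (y + x) w +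
    (-1) ^+ (al * be)%N *: vertex_coef B (wt_comp A r' u) y (v _(N) w).
  have [K0 hK0] := vmode_trunc_nat v (wt_comp A r' u).
  exists K0 => K KK0 y w.
  have hr' : has_parity (vpar A) be (wt_comp A r' u).
    by rewrite /has_parity -wt_comp_vpar hu.
  rewrite -(homogeneous_bracket y w hv hr' vr (wt_comp_eigsp A r' u) NE) ?subrK// => k Kk.
  by apply: hK0; exact: leq_trans Kk.
rewrite uE; elim/big_ind: _ => [|u1 u2 [K1 h1] [K2 h2]|r' _]; last exact: hP.
  exists 0%N => K _ y w.
  rewrite big1 => [|m _]; last first.
    by rewrite (lin_zero (sq_mode_linr m vr)) (lin_zero (vertex_coef_linl _ _)) scaler0.
  by rewrite !(lin_zero (vertex_coef_linl _ _)) (lin_zero (mmode_linr B v N)) scaler0 addr0.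
exists (maxn K1 K2) => K; rewrite geq_max => /andP[KK1 KK2] y w.
rewrite !(lin_add (vertex_coef_linl _ _)) (lin_add (mmode_linr B v N)) (h1 K KK1) (h2 K KK2).
rewrite scalerDr addrACA -big_split; congr (_ + _); apply: eq_bigr => m _ /=.
by rewrite (lin_add (sq_mode_linr m vr)) (lin_add (vertex_coef_linl _ _)) scalerDr.
Qed.

End VertexCoefficients.

(** * Supertraces and their recursion *)

Section OperatorProducts.
Context {R : realType}.
Local Notation C := R[i].
Variable M : lmodType C.

Lemma foldr_enumS n (f : 'I_n.+1 -> M -> M) (w : M) :
  foldr f w (enum 'I_n.+1) =
  f ord0 (foldr (fun i => f (lift ord0 i)) w (enum 'I_n)).
Proof. by rewrite enum_ordSl /= foldr_map. Qed.

Lemma foldr_linear (I : Type) (s : seq I) (f : I -> M -> M) :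
  (forall i, linear (f i)) -> linear (fun w => foldr f w s).
Proof. by move=> fl a u v; elim: s => //= i s ->; rewrite fl. Qed.

(* The sign is the one for moving [a] past [f 0, ..., f (r - 1)]. *)
Lemma foldr_bracket n (f D : 'I_n -> M -> M) (a : M -> M) (al : bool)
    (ep : 'I_n -> bool) (w : M) : (forall i, linear (f i)) ->
  (forall i w, a (f i w) = D i w + ((-1) ^+ (al * ep i)%N : C) *: f i (a w)) ->
  a (foldr f w (enum 'I_n)) =
  \sum_(r < n) ((-1) ^+ (al * \sum_(s < n | (s < r)%N) ep s)%N : C) *:
     foldr (fun i => if i == r then D i else f i) w (enum 'I_n) +
  ((-1) ^+ (al * \sum_(s < n) ep s)%N : C) *: foldr f (a w) (enum 'I_n).
Proof.
elim: n f D ep => [|n IHn] f D ep fl fD.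
  by rewrite enum_ord0 !big_ord0 muln0 expr0 scale1r add0r.
rewrite !foldr_enumS fD (IHn (fun i => f (lift ord0 i)) (fun i => D (lift ord0 i))
  (fun i => ep (lift ord0 i)))//.
rewrite [X in _ = X + _]big_ord_recl.
have -> : (\sum_(s < n.+1 | (s < @ord0 n)%N) ep s)%N = 0%N by rewrite big1.
rewrite muln0 expr0 scale1r foldr_enumS eqxx -addrA; congr (_ + _).
rewrite (lin_add (fl _)) (lin_bigsum (fl _)) scalerDr scaler_sumr; congr (_ + _).
  apply: eq_bigr => r _.
  rewrite (lin_scale (fl _)) scalerA -exprD -mulnDr foldr_enumS/=.
  congr ((-1) ^+ (_ * _)%N *: f _ _).
    by rewrite [RHS]big_mkcond big_ord_recl/= -big_mkcond.
by rewrite (lin_scale (fl _)) scalerA -exprD -mulnDr [in RHS]big_ord_recl.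
Qed.

Lemma foldr_slot (I : eqType) (s : seq I) (r : I) (f : I -> M -> M) (K : nat)
    (a : nat -> C) (G : nat -> I -> M -> M) (w : M) : (forall i, linear (f i)) ->
  uniq s -> r \in s ->
  foldr (fun i => if i == r then (fun w => \sum_(m < K) a m *: G m i w) else f i) w s =
  \sum_(m < K) a m *: foldr (fun i => if i == r then G m i else f i) w s.
Proof.
move=> fl; elim: s => //= i s IHs /andP[iNs us].
have same (H : I -> M -> M) : r \notin s ->
    foldr (fun i => if i == r then H i else f i) w s = foldr f w s.
  elim: (s) => //= j t IHt; rewrite inE negb_or eq_sym => /andP[/negbTE -> rt].
  by rewrite IHt.
rewrite inE => /orP[/eqP ri|rs].
  have rNs : r \notin s by rewrite ri.
  rewrite -ri eqxx (same (fun i w => \sum_(m < K) a m *: G m i w) rNs).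
  by apply: eq_bigr => m _; rewrite (same (G m) rNs).
have ir : i == r = false by apply: contraNF iNs => /eqP ->.
rewrite ir IHs// (lin_bigsum (fl i)); apply: eq_bigr => m _.
by rewrite (lin_scale (fl i)).
Qed.

Lemma foldr_slot_eq0 (I : eqType) (s : seq I) (r : I) (f : I -> M -> M) (w : M) :
  (forall i, linear (f i)) -> r \in s -> (forall w, f r w = 0) ->
  foldr f w s = 0.
Proof.
move=> fl rs fr; elim: s rs => //= i s IHs; rewrite inE => /orP[/eqP <-//|rs].
by rewrite IHs// (lin_zero (fl i)).
Qed.

Definition ffun_cons n (b : bool) (ep : {ffun 'I_n -> bool}) : {ffun 'I_n.+1 -> bool} :=
  [ffun i => if unlift ord0 i is Some j then ep j else b].

Lemma sum_ffun_cons n (F : {ffun 'I_n.+1 -> bool} -> M) :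
  \sum_(ep : {ffun 'I_n.+1 -> bool}) F ep =
  \sum_(b : bool) \sum_(ep : {ffun 'I_n -> bool}) F (ffun_cons b ep).
Proof.
rewrite pair_bigA/= (reindex (fun p : bool * {ffun 'I_n -> bool} => ffun_cons p.1 p.2))//=.
exists (fun ep : {ffun 'I_n.+1 -> bool} => (ep ord0, [ffun i => ep (lift ord0 i)])).
  move=> [b ep] _; rewrite /= ffunE unlift_none; congr pair.
  by apply/ffunP => i; rewrite !ffunE liftK.
move=> ep _; apply/ffunP => i; rewrite ffunE /=.
by case: unliftP => [j ->|->]; rewrite ?ffunE.
Qed.

Lemma foldr_ffun n (f : 'I_n -> M -> M) (g : 'I_n -> bool -> M -> M) (w : M) :
  (forall i b, linear (g i b)) -> (forall i w, f i w = \sum_(b : bool) g i b w) ->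
  foldr f w (enum 'I_n) =
  \sum_(ep : {ffun 'I_n -> bool}) foldr (fun i => g i (ep i)) w (enum 'I_n).
Proof.
elim: n f g => [|n IHn] f g gl fg.
  rewrite enum_ord0/= (big_pred1 [ffun=> false])// => ep.
  by apply/esym/eqP/ffunP => -[].
rewrite foldr_enumS (IHn _ (fun i => g (lift ord0 i)))// fg sum_ffun_cons.
apply: eq_bigr => b _; rewrite (lin_bigsum (gl _ _)); apply: eq_bigr => ep _.
rewrite foldr_enumS ffunE unlift_none; congr (g _ _ _).
by elim: (enum 'I_n) => //= i s ->; rewrite ffunE liftK.
Qed.

End OperatorProducts.

(** * Supertraces, one power of q at a time *)

Section Supertrace.
Context {R : realType}.
Local Notation C := R[i].
Variables (c : C) (V : lmodType C) (A : vosa c V) (M : lmodType C) (B : vmodule A M).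
Local Notation LM := (mmode B (omega A) 1).
Local Notation LMl := (@LM_linear R c V A M B).
Local Notation Md := (@M_decomp R c V A M B).
Local Notation sg := (parity_aut (mpar B)).
Local Notation lev s := (s + c / 24%:R).

Let comp_linear l : linear (eigen_comp LM l). Proof. exact: (eigen_comp_linear LMl Md). Qed.
Let sg_linear : linear sg. Proof. exact: parity_aut_linear. Qed.

Lemma eigsp_sg l w : eigsp LM l w -> eigsp LM l (sg w).
Proof.
move=> wl; rewrite /parity_aut -scaleN1r; apply: (eigsp_add LMl).
  exact: eigsp_mpar.
by apply: (eigsp_scale LMl); exact: eigsp_mpar.
Qed.

Lemma sg_eigen_comp l w : eigen_comp LM l (sg w) = sg (eigen_comp LM l w).
Proof.
have := eigen_comp_shift LMl Md (d := 0) sg_linear.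
by move=> /(_ _ l w); rewrite addr0; apply => k u; rewrite addr0; exact: eigsp_sg.
Qed.

Definition graded_op (X : M -> M) (l : C) (w : M) := eigen_comp LM l (sg (X w)).

Lemma graded_op_linear X l : linear X -> linear (graded_op X l).
Proof. by move=> Xl a u v; rewrite /graded_op Xl sg_linear comp_linear. Qed.

Lemma graded_op_eigsp X l w : eigsp LM l w -> eigsp LM l (graded_op X l w).
Proof. by move=> _; exact: (eigen_comp_eigsp LMl Md). Qed.

Lemma STr_linear (a : C) (X Y : M -> M) s : linear X -> linear Y ->
  STr B (fun w => a *: X w + Y w) s = a * STr B X s + STr B Y s.
Proof.
move=> Xl Yl; rewrite /STr -/LM.
have -> : (fun w => eigen_comp LM (lev s) (sg (a *: X w + Y w))) =
    (fun w => a *: graded_op X (lev s) w + graded_op Y (lev s) w).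
  by apply/funext => w; rewrite sg_linear comp_linear.
apply: trace_on_linear.
- exact: graded_op_linear.
- exact: graded_op_linear.
- exact: mfinite.
- exact: graded_op_eigsp.
- exact: graded_op_eigsp.
move=> w wl; apply: (eigsp_add LMl); last exact: graded_op_eigsp.
by apply: (eigsp_scale LMl); exact: graded_op_eigsp.
Qed.

Lemma STr0 s : STr B (fun=> 0) s = 0.
Proof.
have l0 : linear (fun _ : M => 0 : M) by move=> a u v; rewrite scaler0 addr0.
apply: trace_on_eq0; [exact: (graded_op_linear _ l0)|exact: mfinite|exact: graded_op_eigsp|].
by move=> w _; rewrite (lin_zero sg_linear) (lin_zero (comp_linear _)).
Qed.

Lemma STr_scale (a : C) X s : linear X -> STr B (fun w => a *: X w) s = a * STr B X s.
Proof.
move=> Xl; have l0 : linear (fun _ : M => 0 : M) by move=> b u v; rewrite scaler0 addr0.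
have := STr_linear a s Xl l0; rewrite STr0 addr0 => <-; congr (STr B _ s).
by apply/funext => w; rewrite addr0.
Qed.

Lemma STr_sum (I : Type) (r : seq I) (P : pred I) (X : I -> M -> M) s :
  (forall i, linear (X i)) ->
  STr B (fun w => \sum_(i <- r | P i) X i w) s = \sum_(i <- r | P i) STr B (X i) s.
Proof.
move=> Xl; elim: r => [|i r IHr].
  rewrite big_nil -(STr0 s); congr (STr B _ s).
  by apply/funext => w; rewrite big_nil.
rewrite big_cons; case: ifP => Pi; last first.
  by rewrite -IHr; congr (STr B _ s); apply/funext => w; rewrite big_cons Pi.
have sl : linear (fun w => \sum_(i <- r | P i) X i w).
  move=> a u v; rewrite scaler_sumr -big_split; apply: eq_bigr => j _.
  by rewrite Xl.
rewrite -IHr -[STr B (X i) s]mul1r -(STr_linear 1 s (Xl i) sl); congr (STr B _ s).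
by apply/funext => w; rewrite big_cons Pi scale1r.
Qed.

(** Below the bound of the grading the eigenspace is 0. This is what ends the iteration of the
    recursion and makes the products of series finite. *)
Lemma STr_low : exists r0 : R, forall X s, linear X ->
  complex.Re (lev s) < r0 -> STr B X s = 0.
Proof.
have [r0 h] := mgraded B; exists r0 => X s Xl hs.
apply: trace_on_eq0; [exact: (graded_op_linear _ Xl)|exact: mfinite|exact: graded_op_eigsp|].
move=> w wl; have [f [fw freal]] := h w.
have wE : eigen_comp LM (lev s) w = w by rewrite (eigen_comp_homog LMl Md _ wl) eqxx.
suff -> : w = 0 by rewrite (lin_zero Xl) (lin_zero sg_linear) (lin_zero (comp_linear _)).
apply/eqP; apply: contraLR isT => w0.
have [|r r0r lr] := freal (lev s).
  by rewrite -(eigen_compE LMl Md _ fw) wE.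
by move: hs; rewrite lr/= ltNge r0r.
Qed.

(** Moving sigma cyclically around the trace and back through [X] changes the sign, so the
    supertrace equals its negative. *)
Lemma STr_odd X s : linear X ->
  (forall w, sg (X w) = - X (sg w)) -> STr B X s = 0.
Proof.
move=> Xl Xodd; pose W := eigsp LM (lev s).
have pXl : linear (fun w => eigen_comp LM (lev s) (X w)).
  by move=> a u v; rewrite Xl comp_linear.
have pXW w : W w -> W (eigen_comp LM (lev s) (X w)).
  by move=> _; exact: (eigen_comp_eigsp LMl Md).
have h1 : STr B X s = trace_on W (fun w => sg (eigen_comp LM (lev s) (X w))).
  by congr trace_on; apply/funext => w; exact: sg_eigen_comp.
have h2 : STr B X s = - STr B X s.
  rewrite {1}h1 (trace_on_cyclic (W' := W) pXl sg_linear)//; first last.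
  - by move=> w; exact: eigsp_sg.
  - exact: mfinite.
  - exact: mfinite.
  rewrite -mulN1r -STr_scale//; congr trace_on; apply/funext => w.
  by rewrite scaleN1r (lin_opp sg_linear) Xodd opprK.
by apply/eqP; move/eqP: h2; rewrite -addr_eq0 -mulr2n mulrn_eq0.
Qed.

(** Since [a] raises L(0) by [d], it maps between two eigenspaces, and cyclicity compares the trace
    on one with that on the other; this is the origin of the shift in [s]. The sign is the cost of
    moving [a] past sigma. *)
Lemma STr_cyclic (a X : M -> M) (d : C) (al : bool) s : linear a -> linear X ->
  (forall l w, eigsp LM l w -> eigsp LM (l + d) (a w)) ->
  (forall w, sg (a w) = (-1) ^+ al *: a (sg w)) ->
  STr B (fun w => X (a w)) s = (-1) ^+ al * STr B (fun w => a (X w)) (s + d).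
Proof.
move=> al_ Xl ad asg.
have aXl : linear (fun w => a (X w)) by move=> b u v; rewrite Xl al_.
rewrite -STr_scale//.
have lE : lev (s + d) = lev s + d by rewrite addrAC.
have gl := graded_op_linear (lev s) Xl.
rewrite /STr -/LM lE.
rewrite -[LHS]/(trace_on (eigsp LM (lev s)) (fun w => graded_op X (lev s) (a w))).
rewrite (trace_on_cyclic (W' := eigsp LM (lev s + d)) al_ gl).
- congr trace_on; apply/funext => w.
  rewrite /graded_op -(eigen_comp_shift LMl Md al_ ad) (lin_scale sg_linear).
  by rewrite asg scalerA -exprD addnn -mul2n exprM sqrrN expr1n expr1n scale1r.
- exact: mfinite.
- exact: mfinite.
- by move=> w; exact: ad.
- by move=> w _; exact: (eigen_comp_eigsp LMl Md).
Qed.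

End Supertrace.

(** * Moving a mode around the supertrace *)

Section Recursion.
Context {R : realType}.
Local Notation C := R[i].
Variables (c : C) (V : lmodType C) (A : vosa c V) (M : lmodType C) (B : vmodule A M).
Variables (g : {linear V -> V}) (gM : {linear M -> M}) (theta : C).
Hypotheses (gM_mode : forall a n w, gM (mmode B a n w) = mmode B (g a) n (gM w))
  (gM_parity : forall w, gM (parity_aut (mpar B) w) = parity_aut (mpar B) (gM w))
  (g_parity : forall a, g (parity_aut (vpar A) a) = parity_aut (vpar A) (g a))
  (theta_neq0 : theta != 0).
Local Notation LV := (vmode A (omega A) 1).
Local Notation LM := (mmode B (omega A) 1).
Local Notation sg := (parity_aut (mpar B)).

Let gMl : linear gM. Proof. by move=> a u v; rewrite linearP. Qed.

Lemma foldr_vertex_parity n (us : 'I_n -> V) (y : 'I_n -> R) (ep : 'I_n -> bool) be w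
    (s : seq 'I_n) : (forall i, has_parity (vpar A) (ep i) (us i)) ->
  has_parity (mpar B) be w ->
  has_parity (mpar B) (odd (\sum_(i <- s) ep i) (+) be)
    (foldr (fun i => vertex_coef B (us i) (y i)) w s).
Proof.
move=> hus hw; elim: s => [|i s IHs] /=; first by rewrite big_nil.
rewrite big_cons oddD -addbA oddb.
exact: vertex_coef_parity.
Qed.

Lemma homogeneous_recursion n (v : V) (al : bool) (r x : R) (N : int)
    (us : 'I_n -> V) (ep : 'I_n -> bool) (y : 'I_n -> R) :
  has_parity (vpar A) al v -> eigsp LV r%:C v -> g v = theta^-1 *: v ->
  N%:~R = r - 1 - x -> (forall i, has_parity (vpar A) (ep i) (us i)) ->
  exists K0 : nat, forall K, (K0 <= K)%N -> forall s,
  let f i := vertex_coef B (us i) (y i) in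
  STr B (fun w => gM (mmode B v N (foldr f w (enum 'I_n)))) s =
  \sum_(r < n) \sum_(m < K) exp_coef x m *
     ((-1) ^+ (al * \sum_(s < n | (s < r)%N) ep s)%N *
      STr B (fun w => gM (foldr (fun i => if i == r then
        vertex_coef B (sq_mode A v m%:Z (us i)) (y i + x) else f i) w (enum 'I_n))) s) +
  theta * STr B (fun w => gM (mmode B v N (foldr f w (enum 'I_n)))) (s + x%:C).
Proof.
move=> hv vr gv NE hus.
have /choice[K1 hK1] := fun i => @vertex_bracket _ _ _ A _ B _ _ _ _ _ _ _ hv (hus i) vr NE.
exists (\max_i K1 i) => K K0K s f.
have fl i : linear (f i) by exact: vertex_coef_linr.
have bracket i w : mmode B v N (f i w) =
    \sum_(m < K) exp_coef x m *: vertex_coef B (sq_mode A v m%:Z (us i)) (y i + x) w +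
    ((-1) ^+ (al * ep i)%N : C) *: f i (mmode B v N w).
  by apply: hK1; apply: leq_trans K0K; exact: leq_bigmax.
set X := fun w => foldr f w (enum 'I_n).
have Xl : linear X by exact: foldr_linear.
have vNl : linear (mmode B v N) by exact: mmode_linr.
have gvXl : linear (fun w => gM (mmode B v N (X w))) by move=> a u w; rewrite Xl vNl gMl.
pose G r m w := foldr (fun i => if i == r then
        vertex_coef B (sq_mode A v m%:Z (us i)) (y i + x) else f i) w (enum 'I_n).
have Gl r' m : linear (G r' m).
  by apply: foldr_linear => i; case: eqP => // _; exact: vertex_coef_linr.
have opE w : gM (mmode B v N (X w)) =
    \sum_(r < n) \sum_(m < K) (exp_coef x m * (-1) ^+ (al * \sum_(s < n | (s < r)%N) ep s)%N)
      *: gM (G r m w) +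
    ((-1) ^+ (al * \sum_(i < n) ep i)%N : C) *: gM (X (mmode B v N w)).
  rewrite (foldr_bracket w fl bracket) (lin_add gMl) (lin_scale gMl); congr (_ + _).
  rewrite (lin_bigsum gMl); apply: eq_bigr => r' _.
  rewrite (lin_scale gMl).
  have -> : foldr (fun i => if i == r' then fun w => \sum_(m < K) exp_coef x m *:
      vertex_coef B (sq_mode A v m%:Z (us i)) (y i + x) w else f i) w (enum 'I_n) =
     \sum_(m < K) exp_coef x m *: G r' m w.
    have enum_r' : r' \in enum 'I_n by rewrite mem_enum.
    exact: (foldr_slot K (exp_coef x) (fun m i =>
      vertex_coef B (sq_mode A v m%:Z (us i)) (y i + x)) w fl (enum_uniq _) enum_r').
  rewrite (lin_bigsum gMl) scaler_sumr; apply: eq_bigr => m _.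
  by rewrite (lin_scale gMl) scalerA mulrC.
have gXl : linear (fun w => gM (X w)) by move=> a u w; rewrite Xl gMl.
have vd l w : eigsp LM l w -> eigsp LM (l + x%:C) (mmode B v N w).
  move=> wl; have := homogeneous_field_degree vr N wl; congr (eigsp _ (_ + _%:C) _).
  by rewrite NE; ring.
have vsg w : sg (mmode B v N w) = (-1) ^+ al *: mmode B v N (sg w).
  by apply: parity_aut_shift vNl _ w => be w'; exact: (mmode_par N hv).
set ga := odd (\sum_(i < n) ep i).
have Xsg w : sg (X w) = (-1) ^+ ga *: X (sg w).
  apply: parity_aut_shift Xl _ w => be w' hw'.
  by rewrite /ga -big_enum; exact: foldr_vertex_parity.
(* After the cyclic move v(N) stands to the left of [gM]; as g v = theta^-1 v, moving it back inside
   costs the factor [theta]. *)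
have Tcyc : STr B (fun w => gM (X (mmode B v N w))) s =
    (-1) ^+ al * theta * STr B (fun w => gM (mmode B v N (X w))) (s + x%:C).
  rewrite (STr_cyclic s vNl gXl vd vsg) -mulrA -(STr_scale B theta (s + x%:C) gvXl).
  have -> : (fun w => theta *: gM (mmode B v N (X w))) = fun w => mmode B v N (gM (X w)).
    apply/funext => w; rewrite gM_mode gv (lin_scale (mmode_linl B _ _)) scalerA.
    by rewrite mulfV// scale1r.
  by [].
have Todd s' : al && ~~ ga -> STr B (fun w => gM (mmode B v N (X w))) s' = 0.
  move=> /andP[al1 /negbTE ga0]; apply: STr_odd => // w.
  rewrite -gM_parity vsg Xsg ga0 expr0 scale1r al1 expr1 scaleN1r.
  by rewrite (lin_opp gMl).
have sumE : STr B (fun w => gM (mmode B v N (X w))) s =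
   \sum_(r < n) \sum_(m < K) exp_coef x m *
     ((-1) ^+ (al * \sum_(s < n | (s < r)%N) ep s)%N * STr B (fun w => gM (G r m w)) s) +
   (-1) ^+ (al * \sum_(i < n) ep i)%N * STr B (fun w => gM (X (mmode B v N w))) s.
  have gGl (r' : 'I_n) m : linear (fun w => (exp_coef x m * (-1) ^+ (al * \sum_(s < n | (s < r')%N) ep s)%N)
      *: gM (G r' m w)).
    by move=> a u w; rewrite (Gl r' m) gMl scalerDr !scalerA mulrC.
  have sGl (r' : 'I_n) : linear (fun w => \sum_(m < K) (exp_coef x m *
      (-1) ^+ (al * \sum_(s < n | (s < r')%N) ep s)%N) *: gM (G r' m w)).
    move=> a u w; rewrite scaler_sumr -big_split; apply: eq_bigr => m _.
    exact: (gGl r' m).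
  have ssGl : linear (fun w => \sum_(r' < n) \sum_(m < K) (exp_coef x m *
      (-1) ^+ (al * \sum_(s < n | (s < r')%N) ep s)%N) *: gM (G r' m w)).
    move=> a u w; rewrite scaler_sumr -big_split; apply: eq_bigr => r' _.
    exact: (sGl r').
  have Zl : linear (fun w => gM (X (mmode B v N w))).
    by move=> a u w; rewrite vNl Xl gMl.
  transitivity (STr B (fun w => ((-1) ^+ (al * \sum_(i < n) ep i)%N : C) *: gM (X (mmode B v N w)) +
    \sum_(r' < n) \sum_(m < K) (exp_coef x m *
      (-1) ^+ (al * \sum_(s < n | (s < r')%N) ep s)%N) *: gM (G r' m w)) s).
    by congr (STr B _ s); apply/funext => w; rewrite opE addrC.
  rewrite (STr_linear B _ s Zl ssGl) addrC; congr (_ + _).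
  rewrite STr_sum//; apply: eq_bigr => r' _; rewrite STr_sum//; apply: eq_bigr => m _.
  rewrite STr_scale ?mulrA// => a u w.
  by rewrite (Gl r' m) gMl.
rewrite -/X sumE Tcyc; congr (_ + _).
(* If [v] is odd and the product of the [us i] is even, both traces vanish;
   otherwise the signs of cyclicity and of the brackets cancel. *)
rewrite !mulrA; have [alga|] := boolP (al && ~~ ga).
  by rewrite Todd// !mulr0.
have signE (a b : bool) : ~~ (a && ~~ b) -> (-1) ^+ (a && b) * (-1) ^+ a = 1 :> C.
  by case: a; case: b => //= _; rewrite ?expr1 ?mulrNN mulr1.
by move=> /signE; rewrite -[(-1) ^+ (al * _)%N]signr_odd oddM oddb => ->; rewrite mul1r.
Qed.

End Recursion.

Section NPointRecursion.
Context {R : realType}.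
Local Notation C := R[i].
Variables (c : C) (V : lmodType C) (A : vosa c V) (M : lmodType C) (B : vmodule A M).
Variables (g : {linear V -> V}) (gM : {linear M -> M}) (theta : C).
Hypotheses (gM_mode : forall a n w, gM (mmode B a n w) = mmode B (g a) n (gM w))
  (gM_parity : forall w, gM (parity_aut (mpar B) w) = parity_aut (mpar B) (gM w))
  (g_parity : forall a, g (parity_aut (vpar A) a) = parity_aut (vpar A) (g a))
  (theta_neq0 : theta != 0).
Variables (v : V) (wt : R) (n : nat) (vs : n.-tuple V).
Hypotheses (hwt : vmode A (omega A) 1 v = wt%:C *: v) (hgv : g v = theta^-1 *: v).
Local Notation LV := (vmode A (omega A) 1).

Let gMl : linear gM. Proof. by move=> a u w; rewrite linearP. Qed.

Lemma vertex_prod_linear k (us : k.-tuple V) y : linear (vertex_prod B us y).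
Proof. by apply: foldr_linear => i; exact: vertex_coef_linr. Qed.

Lemma vertex_prod_insert (al : bool) (ep : {ffun 'I_n -> bool}) (r : 'I_n) (m : nat)
    (x : R) (y : 'rV[R]_n) w :
  vertex_prod B [tuple (let u := vpar A (ep i) (tnth vs i) in
     if i == r then sq_mode A (vpar A al v) m%:Z u else u) | i < n]
     (y + x *: delta_mx 0 r) w =
  foldr (fun i => if i == r then
     vertex_coef B (sq_mode A (vpar A al v) m%:Z (vpar A (ep i) (tnth vs i))) (y 0 i + x)
     else vertex_coef B (vpar A (ep i) (tnth vs i)) (y 0 i)) w (enum 'I_n).
Proof.
rewrite /vertex_prod; congr (foldr _ _ _); apply/funext => i.
rewrite tnth_mktuple !mxE eqxx/=; case: eqP => _; first by rewrite mulr1.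
by rewrite mulr0 addr0.
Qed.

Definition mode_trace (N : int) (y : 'rV[R]_n) (s : C) : C :=
  STr B (fun w => gM (mmode B v N (vertex_prod B vs y w))) s.

Definition insert_sum (x : R) (y : 'rV[R]_n) (K : nat) (s : C) : C :=
  \sum_(r < n) \sum_(m < K) exp_coef x m *
    npoint_insert B gM v vs r m (y + x *: delta_mx 0 r, s).

Lemma mode_trace_recursion (x : R) (N : int) (y : 'rV[R]_n) : N%:~R = wt - 1 - x ->
  exists K0 : nat, forall K, (K0 <= K)%N -> forall s,
  mode_trace N y s = insert_sum x y K s + theta * mode_trace N y (s + x%:C).
Proof.
move=> NE.
have vpar_g al : g (vpar A al v) = theta^-1 *: vpar A al v.
  have gl : linear g by move=> a u w; rewrite linearP.
  by rewrite -(par_proj_comm gl g_parity) hgv linearZ.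
(* The signs in the brackets refer to parities, so the trace is expanded multilinearly over all
   parities [al] of v and [ep] of the other vectors. *)
pose T al (ep : {ffun 'I_n -> bool}) s := STr B (fun w => gM (mmode B (vpar A al v) N
   (foldr (fun i => vertex_coef B (vpar A (ep i) (tnth vs i)) (y 0 i)) w (enum 'I_n)))) s.
have opl al (ep : {ffun 'I_n -> bool}) : linear (fun w => gM (mmode B (vpar A al v) N
   (foldr (fun i => vertex_coef B (vpar A (ep i) (tnth vs i)) (y 0 i)) w (enum 'I_n)))).
  move=> a u w.
  rewrite (foldr_linear (enum 'I_n) (f := fun i => vertex_coef B (vpar A (ep i) (tnth vs i)) (y 0 i))).
    by rewrite (mmode_linr B) gMl.
  by move=> i; exact: vertex_coef_linr.
have traceE s : mode_trace N y s = \sum_(al : bool) \sum_(ep : {ffun 'I_n -> bool}) T al ep s.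
  transitivity (STr B (fun w => \sum_(al : bool) \sum_(ep : {ffun 'I_n -> bool})
     gM (mmode B (vpar A al v) N
   (foldr (fun i => vertex_coef B (vpar A (ep i) (tnth vs i)) (y 0 i)) w (enum 'I_n)))) s).
    congr (STr B _ s); apply/funext => w.
    rewrite {1}(par_proj_sum (vpar A) v) (lin_add (mmode_linl B _ _)) (lin_add gMl).
    rewrite big_bool addrC.
    have prodE : vertex_prod B vs y w = \sum_(ep : {ffun 'I_n -> bool})
        foldr (fun i => vertex_coef B (vpar A (ep i) (tnth vs i)) (y 0 i)) w (enum 'I_n).
      apply: (foldr_ffun (g := fun i b => vertex_coef B (vpar A b (tnth vs i)) (y 0 i))).
        by move=> i b; exact: vertex_coef_linr.
      move=> i w'.
      have := lin_add (vertex_coef_linl B (y 0 i) w') (vpar A false (tnth vs i)) (vpar A true (tnth vs i)).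
      by rewrite -par_proj_sum big_bool addrC => ->.
    by congr (_ + _); rewrite prodE (lin_bigsum (mmode_linr B _ _)) (lin_bigsum gMl).
  rewrite STr_sum => [|al]; last first.
    move=> a u w; rewrite scaler_sumr -big_split; apply: eq_bigr => ep _.
    exact: opl.
  by apply: eq_bigr => al _; rewrite STr_sum// => ep; exact: opl.
have /choice[K1 hK1] : forall p : bool * {ffun 'I_n -> bool}, exists K0 : nat,
   forall K, (K0 <= K)%N -> forall s,
   T p.1 p.2 s = \sum_(r < n) \sum_(m < K) exp_coef x m * (psign p.1 p.2 r *
     npoint B gM [tuple (let u := vpar A (p.2 i) (tnth vs i) in
       if i == r then sq_mode A (vpar A p.1 v) m%:Z u else u) | i < n]
       (y + x *: delta_mx 0 r, s)) + theta * T p.1 p.2 (s + x%:C).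
  move=> [al ep].
  have [K0 hK0] := homogeneous_recursion (B := B) gM_mode gM_parity theta_neq0
    (fun i => y 0 i) (par_proj_parity (vpar A) al v)
    (eigsp_vpar al hwt) (vpar_g al) NE (fun i => par_proj_parity (vpar A) (ep i) (tnth vs i)).
  exists K0 => K KK0 s; rewrite /T (hK0 K KK0 s); congr (_ + _).
  apply: eq_bigr => r _; apply: eq_bigr => m _; congr (_ * (_ * _)).
  rewrite /npoint; congr (STr B _ s); apply/funext => w.
  by rewrite vertex_prod_insert.
exists (\max_p K1 p) => K KK s; rewrite !traceE.
have -> : \sum_(al : bool) \sum_(ep : {ffun 'I_n -> bool}) T al ep s =
   \sum_(al : bool) \sum_(ep : {ffun 'I_n -> bool}) (\sum_(r < n) \sum_(m < K) exp_coef x m * (psign al ep r *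
     npoint B gM [tuple (let u := vpar A (ep i) (tnth vs i) in
       if i == r then sq_mode A (vpar A al v) m%:Z u else u) | i < n]
       (y + x *: delta_mx 0 r, s)) + theta * T al ep (s + x%:C)).
  apply: eq_bigr => al _; apply: eq_bigr => ep _; apply: (hK1 (al, ep)).
  by apply: leq_trans KK; exact: (leq_bigmax (al, ep)).
under eq_bigr do rewrite big_split -mulr_sumr/=.
rewrite big_split/= -mulr_sumr; congr (_ + _).
rewrite /insert_sum pair_bigA/= exchange_big/=; apply: eq_bigr => r _.
rewrite exchange_big/=; apply: eq_bigr => m _.
by rewrite -mulr_sumr -(pair_bigA _ (fun al ep => psign al ep r * npoint B gM
   [tuple (let u := vpar A (ep i) (tnth vs i) in
       if i == r then sq_mode A (vpar A al v) m%:Z u else u) | i < n]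
       (y + x *: delta_mx 0 r, s))).
Qed.

Lemma npoint_low : exists r0 : R, forall s, complex.Re (s + c / 24%:R) < r0 ->
  (forall N y, mode_trace N y s = 0) /\
  forall r m y, npoint_insert B gM v vs r m (y, s) = 0.
Proof.
have [r0 h] := STr_low B; exists r0 => s hs; split=> [N y|r m y].
  apply: h => // a u w.
  by rewrite vertex_prod_linear (mmode_linr B) gMl.
rewrite /npoint_insert; apply: big1 => al _; apply: big1 => ep _.
rewrite /npoint h ?mulr0// => a u w.
by rewrite vertex_prod_linear gMl.
Qed.

(** Only finitely many pairs of parity components of v and of some v_r occur, so one truncation
    bound serves all of them; it makes the sum over m finite uniformly in the exponents. *)
Lemma npoint_insert_eq0 : exists K0 : nat, forall m, (K0 <= m)%N ->
  forall r e, npoint_insert B gM v vs r m e = 0.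
Proof.
have /choice[K1 hK1] : forall p : bool * bool * 'I_n, exists K0 : nat, forall k : nat,
    (K0 <= k)%N -> vmode A (vpar A p.1.1 v) k%:Z (vpar A p.1.2 (tnth vs p.2)) = 0.
  by move=> p; exact: vmode_trunc_nat.
exists (\max_p K1 p) => m Km r [y s].
rewrite /npoint_insert; apply: big1 => al _; apply: big1 => ep _.
rewrite /npoint; suff -> : (fun w => gM (vertex_prod B [tuple (let u := vpar A (ep i) (tnth vs i) in
       if i == r then sq_mode A (vpar A al v) m%:Z u else u) | i < n] y w)) = (fun=> 0).
  by rewrite /= STr0 mulr0.
apply/funext => w; rewrite -[RHS](lin_zero gMl); congr (gM _).
apply: (foldr_slot_eq0 (r := r)).
- by move=> i; exact: vertex_coef_linr.
- by rewrite mem_enum.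
move=> w'; rewrite tnth_mktuple eqxx /=.
rewrite (sq_mode_eq0 (eigsp_vpar al hwt) (K := \max_p K1 p))//.
  exact: (lin_zero (vertex_coef_linl B _ _)).
move=> k Kk; apply: (hK1 (al, ep r, r)); apply: leq_trans Kk.
exact: (leq_bigmax (al, ep r, r)).
Qed.

End NPointRecursion.

Section SeriesProduct.
Context {R : realType}.
Local Notation C := R[i].

(** The lifted series does not contain q_z, so the first factor must supply the whole exponent [x]
    of q_z, and with it the exponent [- x] of q_r; only its exponent [t] of q remains free. *)
Lemma qs_mulE n (r : 'I_n) (p : R * R -> C) (F : @qseries R n)
    (e1 : 'rV[R]_n.+1) (e2 : C) (ts : seq R) : uniq ts ->
  let x := e1 0 ord0 in
  let y : 'rV[R]_n := \row_i e1 0 (lift ord0 i) in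
  (forall t, t \notin ts -> p (x, t) * F (y + x *: delta_mx 0 r, e2 - t%:C) = 0) ->
  qs_mul (qs_diff r p) (qs_lift F) (e1, e2) =
  \sum_(t <- ts) p (x, t) * F (y + x *: delta_mx 0 r, e2 - t%:C).
Proof.
move=> uts x y hts.
pose D : 'rV[R]_n.+1 := delta_mx 0 ord0 - delta_mx 0 (lift ord0 r).
have D0 : D 0 ord0 = 1 by rewrite !mxE eqxx (negbTE (neq_lift _ _)) subr0.
pose d t : ('rV[R]_n.+1 * C)%type := (x *: D, t%:C).
have termE t : qs_diff r p (d t) * qs_lift F ((e1, e2) - d t) =
    p (x, t) * F (y + x *: delta_mx 0 r, e2 - t%:C).
  rewrite /qs_diff /qs_lift /= -/D.
  have -> : (x *: D) 0 ord0 = x by rewrite mxE D0 mulr1.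
  rewrite !eqxx/= [X in X == 0]mxE [X in _ + X]mxE [X in _ - X]mxE D0 mulr1 subrr eqxx.
  congr (_ * F (_, _)); apply/rowP => i.
  rewrite !mxE !eqxx/= (inj_eq lift_inj) sub0r.
  by rewrite mulrN opprK.
rewrite /qs_mul (@fsbigT_supported _ _ _ [seq d t | t <- ts]).
- by rewrite big_map; apply: eq_bigr => t _; exact: termE.
- by rewrite map_inj_uniq// => t t' [].
move=> [d1 d2] dts; have [->|h1] := eqVneq (qs_diff r p (d1, d2)) 0.
  by rewrite mul0r.
have [->|h2] := eqVneq (qs_lift F ((e1, e2) - (d1, d2))) 0.
  by rewrite mulr0.
have dE : (d1, d2) = d (complex.Re d2).
  move: h1 h2; rewrite /qs_diff /qs_lift /=.
  case: ifP => [/andP[/eqP d1E /eqP imd]|]; last by rewrite eqxx.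
  case: ifP => [|]; last by rewrite eqxx.
  rewrite mxE [X in _ + X]mxE subr_eq0 => /eqP xE _ _; rewrite /d; congr pair.
    by rewrite d1E /D /x xE.
  by case: d2 imd {dts} => a b /= ->.
rewrite dE termE hts//; apply: contra dts => ts_t.
by rewrite dE; apply/mapP; exists (complex.Re d2).
Qed.

End SeriesProduct.

(** * The n-point recursion *)

Section Phases.
Context {R : realType}.
Local Notation C := R[i].

Lemma cexp_twopii_int (m : int) : cexp (twopii * (m%:~R : R)%:C) = 1 :> C.
Proof.
have h : cexp twopii = 1 :> C.
  by rewrite /cexp /twopii/= mulr_natl expR0 cos2pi sin2pi mul1r.
have hn (k : nat) : cexp (twopii * (k%:R : R)%:C) = 1 :> C.
  by rewrite mulrC rmorph_nat cexpX h expr1n.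
case: m => k; first exact: hn.
by rewrite NegzE mulrNz rmorphN mulrN cexpN hn invr1.
Qed.

(** For the fractional part u, cos (2 pi u) = 1 forces sin (pi u) = 0, while sin (pi u) > 0 for 0 <
    u < 1. *)
Lemma cexp_twopii_eq1 (x : R) : cexp (twopii * x%:C) = 1 -> x \is a Num.int.
Proof.
move=> hx; pose u := x - (Num.floor x)%:~R.
have u01 : 0 <= u < 1.
  by have /andP[] := floor_itv x; rewrite /u intrD => ? ?; apply/andP; split; lra.
have hu : cexp (twopii * u%:C) = 1.
  by rewrite /u rmorphB mulrBr cexpD cexpN cexp_twopii_int invr1 mulr1.
have cos_u : cos ((pi * u) *+ 2) = 1.
  have uE : twopii * u%:C = 0 +i* ((pi * u) *+ 2).
    by apply/eqP; rewrite eq_complex/=; apply/andP; split; apply/eqP; ring.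
  by move/(congr1 (@complex.Re R)): hu; rewrite uE /cexp/= expR0 !mul1r mul0r subr0.
have sin_u : sin (pi * u) = 0.
  move: cos_u; rewrite cos_mulr2n => h.
  apply/eqP; rewrite -sqrf_eq0 sin2cos2; apply/eqP; lra.
have u0 : u = 0.
  apply/eqP; apply: contraTT isT => u0.
  have : 0 < sin (pi * u).
    move/andP: u01 => [u_ge0 u1]; have u_gt0 : 0 < u by rewrite lt_neqAle eq_sym u0.
    by apply: sin_gt0_pi; rewrite mulr_gt0 ?pi_gt0//= gtr_pMr ?pi_gt0.
  by rewrite sin_u ltxx.
by rewrite -[x](subrK (Num.floor x)%:~R) -/u u0 add0r intr_int.
Qed.

Lemma cexp_twopii_eq (x y : R) : cexp (twopii * x%:C) = cexp (twopii * y%:C) :> C ->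
  x - y \is a Num.int.
Proof.
move=> xy; apply: cexp_twopii_eq1.
by rewrite rmorphB mulrBr cexpD cexpN xy mulfV// cexp_neq0.
Qed.

End Phases.

(** * Solving T(s) = S(s) + theta T(s + x) *)

Section SolveRecursion.
Context {R : realType}.
Local Notation C := R[i].
Variables (theta : C) (T S : C -> C) (x : R).
Hypotheses (theta_neq0 : theta != 0)
  (rec : forall s, T s = S s + theta * T (s + x%:C)).

Lemma iterate_recursion_up (J : nat) s :
  T s = \sum_(j < J) theta ^+ j * S (s + (x * j%:R)%:C) +
    theta ^+ J * T (s + (x * J%:R)%:C).
Proof.
elim: J => [|J IHJ]; first by rewrite big_ord0 mulr0 addr0 expr0 mul1r add0r.
rewrite big_ord_recr/= {1}IHJ rec mulrDr addrA exprSr -mulrA; congr (_ + _ * (_ * T _)).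
by rewrite -addrA -rmorphD; congr (_ + _%:C); rewrite -natr1; ring.
Qed.

Lemma iterate_recursion_down (J : nat) s :
  T s = - (\sum_(j < J) theta ^- j.+1 * S (s - (x * j.+1%:R)%:C)) +
    theta ^- J * T (s - (x * J%:R)%:C).
Proof.
elim: J => [|J IHJ].
  by rewrite big_ord0 mulr0 oppr0 addr0 expr0 invr1 mul1r add0r.
rewrite big_ord_recr/= {1}IHJ opprD -addrA; congr (_ + _).
have -> : T (s - (x * J.+1%:R)%:C) = S (s - (x * J.+1%:R)%:C) + theta * T (s - (x * J%:R)%:C).
  rewrite rec; congr (_ + _ * T _); have -> : x * J.+1%:R = x * J%:R + x by ring.
  by rewrite rmorphD opprD addrA subrK.
by rewrite mulrDr addrA addNr add0r mulrA exprSr invfM -[X in _ = X * _]mulrA mulVf// mulr1.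
Qed.

(** The direction of iteration is the one that lowers the real part of the argument. The offset [d]
    will be c / 24, the difference between a power of q and the L(0)-eigenvalue; [ts] lists the
    exponents of q reached before [T] vanishes. *)
Lemma solve_recursion (s : C) (r0 : R) (d : C) :
  (forall s, complex.Re (s + d) < r0 -> T s = 0) -> x != 0 ->
  exists ts : seq R, [/\ uniq ts,
    forall t, t \notin ts -> geometric_coef theta (x, t) = 0 \/ complex.Re (s - t%:C + d) < r0 &
    T s = - \sum_(t <- ts) geometric_coef theta (x, t) * S (s - t%:C)].
Proof.
move=> low x0.
have ReD y : complex.Re (s + y%:C + d) = complex.Re (s + d) + y.
  by case: (s) (d) => a b [a' b'] /=; ring.
have [x_gt0|x_le0] := ltP 0 x.
  (* After this many steps of length [x] the real part has dropped below [r0]. *)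
  pose J := (Num.truncn ((complex.Re (s + d) - r0) / x)).+1.
  have vanish j : (J <= j)%N -> complex.Re (s - (x * j%:R)%:C + d) < r0.
    move=> Jj; have : (complex.Re (s + d) - r0) / x < j%:R.
      by apply: lt_le_trans (truncnS_gt _) _; rewrite ler_nat.
    rewrite ltr_pdivrMr// => h.
    by rewrite -rmorphN ReD; move: h; lra.
  exists [seq x * j.+1%:R | j <- iota 0 J]; split.
  - rewrite map_inj_uniq ?iota_uniq// => i j /(mulfI x0)/eqP.
    by rewrite eqr_nat eqSS => /eqP.
  - move=> t ts; rewrite /geometric_coef/= (negbTE x0) x_gt0.
    case: ifP => [/andP[/natrP[j tj] t_gt0]|]; last by left.
    have tE : t = x * j%:R by rewrite -tj mulrC divfK.
    right; rewrite tE; apply: vanish; rewrite leqNgt.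
    apply: contra ts => jJ; apply/mapP; exists j.-1.
      by rewrite mem_iota add0n (leq_ltn_trans (leq_pred j)).
    by rewrite prednK// -(ltr0n R) -tj.
  rewrite (iterate_recursion_down J) (low _ (vanish J (leqnn _))) mulr0 addr0.
  rewrite big_map -[J in iota 0 J](subn0 J) -/(index_iota 0 J) big_mkord; congr (- _).
  apply: eq_bigr => j _; rewrite /geometric_coef/= (negbTE x0) x_gt0.
  by rewrite mulrAC mulfV// mul1r natr_nat ltr0n/= natrK.
have x_lt0 : x < 0 by rewrite lt_neqAle x0.
pose J := (Num.truncn ((complex.Re (s + d) - r0) / - x)).+1.
have vanish j : (J <= j)%N -> complex.Re (s + (x * j%:R)%:C + d) < r0.
  move=> Jj; have : (complex.Re (s + d) - r0) / - x < j%:R.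
    by apply: lt_le_trans (truncnS_gt _) _; rewrite ler_nat.
  rewrite ltr_pdivrMr ?oppr_gt0// => h.
  by rewrite ReD; move: h; lra.
exists [seq - (x * j%:R) | j <- iota 0 J]; split.
- rewrite map_inj_uniq ?iota_uniq// => i j /oppr_inj/(mulfI x0)/eqP.
  by rewrite eqr_nat => /eqP.
- move=> t ts; rewrite /geometric_coef/= (negbTE x0) ltNge x_le0/=.
  case: ifP => [/natrP[j tj]|]; last by left.
  have tE : t = - (x * j%:R) by rewrite -tj mulrN opprK mulrC divfK.
  right; rewrite tE rmorphN opprK; apply: vanish; rewrite leqNgt.
  apply: contra ts => jJ; apply/mapP; exists j => //.
  by rewrite mem_iota add0n.
rewrite (iterate_recursion_up J) (low _ (vanish J (leqnn _))) mulr0 addr0.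
rewrite big_map -[J in iota 0 J](subn0 J) -/(index_iota 0 J) big_mkord -sumrN.
apply: eq_bigr => j _; rewrite /geometric_coef/= (negbTE x0) ltNge x_le0/=.
by rewrite mulNr opprK mulrAC mulfV// mul1r natr_nat natrK mulNr opprK rmorphN opprK.
Qed.

End SolveRecursion.

Section MainIdentity.
Context {R : realType}.
Local Notation C := R[i].
Variables (c : C) (V : lmodType C) (A : vosa c V) (M : lmodType C) (B : vmodule A M).
Variables (g : {linear V -> V}) (gM : {linear M -> M}) (theta phi : C) (lam : R).
Hypotheses (gM_mode : forall a n w, gM (mmode B a n w) = mmode B (g a) n (gM w))
  (gM_parity : forall w, gM (parity_aut (mpar B) w) = parity_aut (mpar B) (gM w))
  (g_parity : forall a, g (parity_aut (vpar A) a) = parity_aut (vpar A) (g a))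
  (theta_neq0 : theta != 0).
Variables (v : V) (wt : R) (n : nat) (vs : n.-tuple V).
Hypotheses (hwt : vmode A (omega A) 1 v = wt%:C *: v) (hgv : g v = theta^-1 *: v).
Hypotheses (hphi : phi = cexp (twopii * wt%:C)) (hphilam : phi = cexp (twopii * lam%:C)).

Definition weierstrass_coef (k : nat) (e : R * R) : C :=
  (-1) ^+ k / k.-1`!%:R * expansion_coef theta lam k.-1 e.

Lemma weierstrass_coefE m x t : x - lam \is a Num.int ->
  weierstrass_coef m.+1 (x, t) = - (geometric_coef theta (x, t) * exp_coef x m).
Proof.
move=> xlam; rewrite /weierstrass_coef /expansion_coef /= xlam /exp_coef.
by rewrite (_ : (- x)%:C = - x%:C); [rewrite (exprNn x%:C) exprS; ring|exact: rmorphN].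
Qed.

Lemma weierstrass_coef_eq0 m x t : x - lam \isn't a Num.int ->
  weierstrass_coef m.+1 (x, t) = 0.
Proof. by move=> /negbTE xlam; rewrite /weierstrass_coef /expansion_coef /= xlam mulr0. Qed.

Local Notation insert_series := (fun e => \sum_(r < n) \sum_(m \in [set: nat])
  qs_mul (qs_diff r (weierstrass_coef m.+1)) (qs_lift (npoint_insert B gM v vs r m)) e).
Local Notation tail e := (\row_i e 0 (lift ord0 i)).

(** The coefficient of P_(m+1) factors into a part depending on theta but not on m and the Taylor
    coefficient [exp_coef x m]; summing over m and r first therefore reassembles the commutator term
    [insert_sum]. *)
Lemma insert_seriesE : exists K0 : nat, forall K, (K0 <= K)%N ->
  forall (e1 : 'rV[R]_n.+1) (e2 : C) (ts : seq R), let x := e1 0 ord0 in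
  x - lam \is a Num.int -> uniq ts ->
  (forall t, t \notin ts -> geometric_coef theta (x, t) = 0 \/
     forall r m y, npoint_insert B gM v vs r m (y, e2 - t%:C) = 0) ->
  insert_series (e1, e2) = - \sum_(t <- ts) geometric_coef theta (x, t) *
    insert_sum B gM v vs x (tail e1) K (e2 - t%:C).
Proof.
have [K0 hK0] := npoint_insert_eq0 B gM vs hwt.
exists K0 => K K0K e1 e2 ts x xlam uts hts.
have termE r m : qs_mul (qs_diff r (weierstrass_coef m.+1))
    (qs_lift (npoint_insert B gM v vs r m)) (e1, e2) =
    - \sum_(t <- ts) geometric_coef theta (x, t) * (exp_coef x m *
    npoint_insert B gM v vs r m (tail e1 + x *: delta_mx 0 r, e2 - t%:C)).
  rewrite (qs_mulE uts) => [|t /hts[h|->]]; last by rewrite mulr0.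
    rewrite -sumrN; apply: eq_bigr => t _.
    by rewrite weierstrass_coefE// mulNr mulrA.
  by rewrite weierstrass_coefE// h mul0r oppr0 mul0r.
transitivity (\sum_(r < n) \sum_(m < K) - \sum_(t <- ts) geometric_coef theta (x, t) *
   (exp_coef x m * npoint_insert B gM v vs r m (tail e1 + x *: delta_mx 0 r, e2 - t%:C))).
  apply: eq_bigr => r _; rewrite (@fsbigT_supported _ _ _ (iota 0 K)) ?iota_uniq//.
    rewrite -[K in iota 0 K]subn0 -/(index_iota 0 K) big_mkord.
    by apply: eq_bigr => m _; exact: termE.
  move=> m; rewrite mem_iota add0n leq0n/= -leqNgt => Km.
  rewrite termE big1 ?oppr0// => t _; rewrite hK0 ?mulr0//.
  exact: leq_trans Km.
under eq_bigr => r _ do rewrite sumrN exchange_big/=.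
rewrite sumrN exchange_big/=; congr (- _); apply: eq_bigr => t _.
rewrite /insert_sum mulr_sumr; apply: eq_bigr => r _.
by rewrite mulr_sumr.
Qed.

Lemma npoint_cons (e1 : 'rV[R]_n.+1) e2 :
  npoint B gM [tuple of v :: vs] (e1, e2) =
  STr B (fun w => gM (mode_at B wt v (e1 0 ord0) (vertex_prod B vs (tail e1) w))) e2.
Proof.
rewrite /npoint; congr (STr B _ e2); apply/funext => w; congr (gM _).
rewrite /vertex_prod foldr_enumS -(vertex_coef_degree _ _ (homogeneous_field_degree hwt)).
rewrite tnth0; congr (vertex_coef B v _ _).
have -> // : (fun i => vertex_coef B (tnth [tuple of v :: vs] (lift ord0 i)) (e1 0 (lift ord0 i))) =
  (fun i => vertex_coef B (tnth vs i) (tail e1 0 i)).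
by apply/funext => i; rewrite tnthS mxE.
Qed.

Lemma npoint_recursion (e : ('rV[R]_n.+1 * C)%type) :
  npoint B gM [tuple of v :: vs] e =
  (theta == 1)%:R * (phi == 1)%:R * qs_lift (npoint_zero B gM wt v vs) e + insert_series e.
Proof.
case: e => e1 e2; rewrite npoint_cons.
set x := e1 0 ord0; set y := tail e1.
have wtlam : wt - lam \is a Num.int by apply: cexp_twopii_eq; rewrite -hphi.
(* If [x] is not in wt + Z, no mode of v has this exponent and the left side is 0. The coefficients
   of P vanish as well, since lam + Z = wt + Z, and the term with o(v) would need x = 0 and an
   integral weight. *)
have [[N Nx]|noN] := pselect (exists N : int, wt - N%:~R - 1 = x); last first.
  have xlam : x - lam \isn't a Num.int.
    apply/negP => xlam; apply: noN.
    have /intrP[N hN] : wt - lam - (x - lam) - 1 \is a Num.int.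
      exact: rpredB (rpredB wtlam xlam) (rpred1 _).
    by exists N; rewrite -hN; ring.
  transitivity (0 : C).
    rewrite -[RHS](STr0 B e2); congr (STr B _ e2); apply/funext => w.
    by rewrite mode_at_none ?linear0// => N Nx; apply: noN; exists N.
  rewrite big1 => [|r _]; last first.
    apply: fsbig_zero => m _; rewrite (qs_mulE (ts := [::]))// ?big_nil//.
    by move=> t _; rewrite weierstrass_coef_eq0// mul0r.
  rewrite addr0 /qs_lift/=; have [x0|_] := eqVneq (e1 0 ord0) 0; last by rewrite mulr0.
  have [phi1|_] := eqVneq phi 1; last by rewrite mulr0 mul0r.
  have /intrP[j hj] : wt \is a Num.int by apply: cexp_twopii_eq1; rewrite -hphi.
  case: noN; exists (j - 1); rewrite hj intrD mulrNz; move: x0; rewrite -/x => ->; ring.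
have NE : N%:~R = wt - 1 - x by rewrite -Nx; ring.
have xlam : x - lam \is a Num.int.
  have -> : x - lam = wt - lam - N%:~R - 1 by rewrite NE; ring.
  exact: rpredB (rpredB wtlam (intr_int _ _)) (rpred1 _).
have [K1 hK1] := mode_trace_recursion (B := B) gM_mode gM_parity g_parity theta_neq0 vs hwt hgv y NE.
have [K2 hK2] := insert_seriesE.
set K := maxn K1 K2; have {}hK1 := hK1 K (leq_maxl _ _).
have {}hK2 := hK2 K (leq_maxr _ _) e1 e2 _ xlam.
have -> : STr B (fun w => gM (mode_at B wt v x (vertex_prod B vs y w))) e2 =
    mode_trace B gM v vs N y e2.
  by congr (STr B _ e2); apply/funext => w; rewrite (mode_atE _ _ _ Nx).
have [r0 low] := npoint_low B gM v vs.
have [x0|x_neq0] := eqVneq x 0; last first.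
  rewrite /qs_lift/= -/x (negbTE x_neq0) mulr0 add0r.
  have lowT s : complex.Re (s + c / 24%:R) < r0 -> mode_trace B gM v vs N y s = 0.
    by move=> /low[].
  have [ts [uts hts ->]] := solve_recursion theta_neq0 hK1 e2 lowT x_neq0.
  rewrite (hK2 _ uts)// => t /hts[|h]; [by left|right=> r m y'].
  exact: (low _ h).2.
(* For x = 0 the recursion relates a level only to itself, so t = 0 is the only exponent. For theta
   <> 1 the coefficient theta^-1 / (1 - theta^-1) = - 1 / (1 - theta) is exactly the division by 1 -
   theta. *)
rewrite (hK2 [:: 0])//=; last first.
  by move=> t; rewrite inE /geometric_coef/= -/x x0 eqxx => /negbTE ->; left.
rewrite big_seq1 rmorph0 subr0 -/y /geometric_coef/= -/x x0 !eqxx.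
have := hK1 e2; rewrite x0 rmorph0 addr0 => recE.
have [theta1|theta1] := eqVneq theta 1; last first.
  rewrite !mul0r add0r; have theta1' : theta - 1 != 0 by rewrite subr_eq0.
  have -> : insert_sum B gM v vs 0 y K e2 = (1 - theta) * mode_trace B gM v vs N y e2.
    by rewrite mulrBl mul1r {1}recE addrK.
  by field; rewrite theta_neq0.
have -> : insert_sum B gM v vs 0 y K e2 = 0.
  by move: recE; rewrite theta1 mul1r => /eqP; rewrite -[X in X == _]add0r (inj_eq (addIr _)) eq_sym => /eqP.
rewrite mulr0 oppr0 addr0 /qs_lift/= -/x x0 eqxx.
(* With x = 0 the mode index is N = wt - 1, so v(N) is the zero mode o(v) and phi = 1. *)
have wtE : wt = (N + 1)%:~R by rewrite intrD NE x0; ring.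
rewrite hphi wtE cexp_twopii_int eqxx !mul1r /npoint_zero.
congr (STr B _ e2); apply/funext => w.
by rewrite /zero_mode intr_int intrKfloor addrK.
Qed.

End MainIdentity.

Theorem theorem3p6 (R : realType) (c : R[i]) (V : lmodType R[i])
    (A : vosa c V) (g : {linear V -> V})
    (hg : is_automorphism A g)
    (hgsigma : forall a, g (parity_aut (vpar A) a) = parity_aut (vpar A) (g a))
    (M : lmodType R[i]) (B : vmodule A M) (gM : {linear M -> M})
    (hM : stable_under B g gM)
    (v : V) (wt : R) (hwt : vmode A (omega A) 1 v = wt%:C *: v)
    (theta : R[i]) (htheta : `|theta| = 1) (hgv : g v = theta^-1 *: v)
    (phi : R[i]) (hphi : phi = cexp (twopii * wt%:C))
    (lam : R) (hlam : 0 <= lam < 1) (hphilam : phi = cexp (twopii * lam%:C))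
    (n : nat) (vs : n.-tuple V) :
  exists P : nat -> R * R -> R[i],
    (forall k : nat, (0 < k)%N ->
       is_weierstrass_expansion theta phi lam k (P k)) /\
    forall e : ('rV[R]_n.+1 * R[i])%type,
      npoint B gM [tuple of v :: vs] e =
        (theta == 1)%:R * (phi == 1)%:R *
          qs_lift (npoint_zero B gM wt v vs) e +
        \sum_(r < n) \sum_(m \in [set: nat])
          qs_mul (qs_diff r (P m.+1)) (qs_lift (npoint_insert B gM v vs r m)) e.
Proof.
have [_ gM_mode gM_parity] := hM.
have theta_neq0 : theta != 0 by rewrite -normr_eq0 htheta oner_eq0.
exists (weierstrass_coef theta lam); split=> [[//|k] _|e].
  exact: exists_weierstrass_expansion.
exact: npoint_recursion.
Qed.
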